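(* Let $H>\tfrac12$ and let $B$ be an $m$-dimensional fractional Brownian motion with Hurst parameter $H$. Let $\alpha,\kappa,\gamma>0$ satisfy $\alpha>\tfrac12$, $H-\kappa>\tfrac12$, $H-\kappa+\gamma\alpha>1$ and $\alpha<H-\kappa$. Let $\zeta\in(\alpha,1]$, let $f_n\colon\mathbb{R}_+\times\mathbb{R}^d\to L(\mathbb{R}^m,\mathbb{R}^d)$ ($n\ge1$) be deterministic and belong to $\mathcal{C}^{\zeta,2}$, and let $\bar f\colon\mathbb{R}^d\to L(\mathbb{R}^m,\mathbb{R}^d)$ be in $\mathrm{BC}^2$ (viewed as a time-independent element of $\mathcal C^{\zeta,2}$), such that $\lim_{n\to\infty}|f_n-\bar f|_{-\kappa,\gamma}=0$. Let $x^n$ and $x$ be the $\mathcal{C}^\alpha$ solutions of $$dx^n_t=f_n(t,x^n_t)\,dB_t,\qquad dx_t=\bar f(x_t)\,dB_t,$$ with $x^n_0=x_0$, the integrals interpreted pathwise as Young integrals. Then $x^n\to x$ in probability in $\mathcal{C}^\alpha([0,T])$ for every $T>0$. The same conclusion holds for the equations $dx^n_t=f_n(t,x^n_t)\,dB_t+g_n(t,x^n_t)\,dt$ and $dx_t=\bar f(x_t)\,dB_t+\bar g(x_t)\,dt$, where $g_n,\bar g$ (with values in $\mathbb{R}^d$) satisfy the same hypotheses as $f_n,\bar f$.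
   Context: $\mathcal{C}^{\zeta,2}$ is the space of functions $t\mapsto f(t,\cdot)$ that are $\zeta$-Hölder continuous in time with values in $\mathrm{BC}^2$ (bounded $\mathcal C^2$ functions with bounded first and second derivatives). For $f\colon\mathbb{R}\times\mathbb{R}^d\to\mathbb{R}$ (componentwise for matrix-valued $f$), $|f|_{-\kappa,\gamma}$ is the smallest $K$ such that, writing $\hat f(t,x)=\int_0^tf(r,x)\,dr$, $|\hat f(t,x)-\hat f(s,x)|\le K|t-s|^{1-\kappa}$ and $|\hat f(t,x)-\hat f(s,x)-\hat f(t,y)+\hat f(s,y)|\le K|t-s|^{1-\kappa}|x-y|^\gamma$ uniformly over $|s-t|\le1$ and $x,y\in\mathbb{R}^d$. *)

(* Defs.v *)
From HB Require Import structures.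
From mathcomp Require Import all_boot all_order all_algebra.
From mathcomp Require Import all_classical all_reals all_analysis.
Set Implicit Arguments. Unset Strict Implicit. Unset Printing Implicit Defensive.
Import Order.TTheory GRing.Theory Num.Theory.
Import numFieldNormedType.Exports.
Local Open Scope classical_set_scope.
Local Open Scope ring_scope.

Section Defs.
Variable R : realType.

Definition pdir (d : nat) (i : 'I_d) : 'cV[R]_d := delta_mx i 0.

(** BC^2 : bounded C^2 functions R^d -> R^(d x k), with bounded first and
    second (partial) derivatives; norms are the max-of-entries matrix norms. *)
Definition isBC2 (d k : nat) (h : 'cV[R]_d -> 'M[R]_(d, k)) : Prop :=
  (forall x, differentiable h x) /\
  (forall (i : 'I_d) x, differentiable (fun y => derive h y (pdir i)) x) /\
  (forall (i j : 'I_d),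
     continuous (fun y => derive (fun z => derive h z (pdir i)) y (pdir j))) /\
  exists C : R, forall x (i j : 'I_d),
    [/\ `|h x| <= C, `|derive h x (pdir i)| <= C &
        `|derive (fun z => derive h z (pdir i)) x (pdir j)| <= C].

Definition Cz2 (zeta : R) (d k : nat) (f : R -> 'cV[R]_d -> 'M[R]_(d, k)) : Prop :=
  (forall t, 0 <= t -> isBC2 (f t)) /\
  exists C : R, forall s t, 0 <= s -> 0 <= t -> `|t - s| <= 1 ->
    forall x (i j : 'I_d),
    [/\ `|f t x - f s x| <= C * `|t - s| `^ zeta,
        `|derive (f t) x (pdir i) - derive (f s) x (pdir i)|
            <= C * `|t - s| `^ zeta &
        `|derive (fun z => derive (f t) z (pdir i)) x (pdir j)
          - derive (fun z => derive (f s) z (pdir i)) x (pdir j)|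
            <= C * `|t - s| `^ zeta].

Definition fhat (d k : nat) (f : R -> 'cV[R]_d -> 'M[R]_(d, k)) (t : R)
  (x : 'cV[R]_d) : 'M[R]_(d, k) :=
  \matrix_(i, j) Rintegral lebesgue_measure `[0, t] (fun r => f r x i j).

Definition negnorm (kappa gamma : R) (d k : nat)
  (f : R -> 'cV[R]_d -> 'M[R]_(d, k)) : \bar R :=
  ereal_inf [set K%:E | K in [set K : R | 0 <= K /\
    forall s t (x y : 'cV[R]_d), 0 <= s -> 0 <= t -> `|t - s| <= 1 ->
      `|fhat f t x - fhat f s x| <= K * `|t - s| `^ (1 - kappa) /\
      `|fhat f t x - fhat f s x - fhat f t y + fhat f s y|
         <= K * `|t - s| `^ (1 - kappa) * `|x - y| `^ gamma]].

(** Partitions a = p_0 < p_1 < ... < p_n = b, given as the tail list. *)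
Definition is_part (a b : R) (p : seq R) : bool :=
  path <%R a p && (last a p == b).

Definition mesh (a : R) (p : seq R) : R :=
  \big[Num.max/0]_(uv <- zip (a :: p) p) (uv.2 - uv.1).

Definition RSsum (d k : nat) (y : R -> 'M[R]_(d, k)) (b : R -> 'M[R]_(k, 1))
  (a : R) (p : seq R) : 'M[R]_(d, 1) :=
  \sum_(uv <- zip (a :: p) p) y uv.1 *m (b uv.2 - b uv.1).

Definition young_int (d k : nat) (y : R -> 'M[R]_(d, k)) (b : R -> 'M[R]_(k, 1))
  (a t : R) (I : 'M[R]_(d, 1)) : Prop :=
  forall e : R, 0 < e -> exists2 delta : R, 0 < delta &
    forall p, is_part a t p -> mesh a p < delta -> `|RSsum y b a p - I| < e.

Definition timep (t : R) : 'M[R]_(1, 1) := const_mx t.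

Definition loc_holder (alpha : R) (d : nat) (x : R -> 'cV[R]_d) : Prop :=
  forall T, 0 < T -> exists C : R, forall s t, 0 <= s <= T -> 0 <= t <= T ->
    `|x t - x s| <= C * `|t - s| `^ alpha.

Definition young_sol (alpha : R) (d m : nat) (f : R -> 'cV[R]_d -> 'M[R]_(d, m))
  (b : R -> 'cV[R]_m) (x0 : 'cV[R]_d) (x : R -> 'cV[R]_d) : Prop :=
  loc_holder alpha x /\
  forall t, 0 <= t -> exists I, young_int (fun r => f r (x r)) b 0 t I /\
                              x t = x0 + I.

Definition young_sol_drift (alpha : R) (d m : nat)
  (f : R -> 'cV[R]_d -> 'M[R]_(d, m)) (g : R -> 'cV[R]_d -> 'cV[R]_d)
  (b : R -> 'cV[R]_m) (x0 : 'cV[R]_d) (x : R -> 'cV[R]_d) : Prop :=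
  loc_holder alpha x /\
  forall t, 0 <= t -> exists I J,
    [/\ young_int (fun r => f r (x r)) b 0 t I,
        young_int (fun r => g r (x r)) timep 0 t J &
        x t = x0 + I + J].

Definition hnorm (alpha T : R) (d : nat) (y : R -> 'cV[R]_d) : \bar R :=
  let S1 := [set (`|y t|)%:E | t in `[0, T]] in
  let S2 := [set r%:E | r in [set r : R | exists s t,
      [/\ 0 <= s, s < t, t <= T & r = `|y t - y s| / (t - s) `^ alpha]]] in
  (ereal_sup S1 + ereal_sup S2)%E.

Definition fbm_cov (H s t : R) : R :=
  (s `^ (2 * H) + t `^ (2 * H) - `|t - s| `^ (2 * H)) / 2.

Definition gauss_law (v : R) (A : set R) : \bar R :=
  if v == 0 then \d_(0 : R) A else normal_prob 0 (Num.sqrt v) A.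

(** B is an m-dimensional fractional Brownian motion with Hurst parameter H
    (indexed by t >= 0): continuous paths, measurable coordinates, and every
    finite linear combination of coordinates is centred Gaussian with the
    variance given by the fBm covariance, components being independent
    (jointly Gaussian, uncorrelated). *)
Definition is_fBm (d0 : measure_display) (Omega : measurableType d0)
  (P : probability Omega R) (H : R) (m : nat) (B : R -> Omega -> 'cV[R]_m)
  : Prop :=
  [/\ (forall t (j : 'I_m), measurable_fun setT (fun w => B t w j 0)),
      (forall w, {within `[0, +oo[, continuous (fun t => B t w)}) &
      (forall s : seq ('I_m * R * R), all (fun u => 0 <= u.1.2) s ->
         forall A, measurable A ->
         P [set w | \sum_(u <- s) u.2 * B u.1.2 w u.1.1 0 \in A] =
         gauss_law (\sum_(u <- s) \sum_(v <- s)
                      u.2 * v.2 * (u.1.1 == v.1.1)%:R * fbm_cov H u.1.2 v.1.2)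
                   A)].

(** x^n -> x in probability in C^alpha([0,T]) for every T > 0
    (the bad events are enclosed in measurable events of vanishing
    probability, i.e. convergence in (outer) probability). *)
Definition conv_prob_Calpha (d0 : measure_display) (Omega : measurableType d0)
  (P : probability Omega R) (alpha : R) (d : nat)
  (xn : nat -> Omega -> R -> 'cV[R]_d) (x : Omega -> R -> 'cV[R]_d) : Prop :=
  forall T, 0 < T -> forall e : R, 0 < e ->
    exists A : nat -> set Omega,
      [/\ forall n, measurable (A n),
          forall n, [set w | (e%:E < hnorm alpha T (fun t => (xn n w t - x w t)%R))%E]
                      `<=` A n &
          (fun n => P (A n)) @ \oo --> 0%E].

End Defs.

(* Main.v *)
Require Import Defs.
From HB Require Import structures.
From mathcomp Require Import all_boot all_order all_algebra.
From mathcomp Require Import all_classical all_reals all_analysis.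
From mathcomp Require Import measurable_realfun ring lra zify.
Set Implicit Arguments. Unset Strict Implicit. Unset Printing Implicit Defensive.
Import Order.TTheory GRing.Theory Num.Theory.
Import numFieldNormedType.Exports.
Local Open Scope classical_set_scope.
Local Open Scope ring_scope.

(** Write [D_n(t, z)] for the Wiener integral of [f_n(., z) - fbar(z)] over
    [[0, t]]. Since [H - kappa > 1/2], its increments over an interval of
    length [h] are Gaussian with standard deviation at most
    [C |f_n - fbar|_{-kappa,gamma} h^(H - kappa)], with a further factor
    [|z - z'|^gamma] for differences in [z]: expanding in the Haar basis, the
    level-[N] term pairs increments of the primitive of [f_n - fbar] with second
    differences of [B], whose covariances are summable. Gaussian tails and a
    union bound over dyadic intervals and over grids of mesh [2^-k] then bound,
    off an event of small probability, all dyadic increments of [D_n] at grid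
    points by [eps 2^(-k eta)], for some [eta < H - kappa] with
    [eta + gamma alpha > 1]; the same bound makes [B] Hoelder.

    Off that event the argument is pathwise. The solution [x^n] solves the limit
    equation up to the remainder obtained by integrating [D_n(dr, x^n_r)], which
    a dyadic sewing argument along [x^n] rounded to the grids controls by [eps].
    Young estimates on short dyadic intervals bound the [alpha]-Hoelder norm of
    [x^n - x] by a constant times [eps], the constant depending only on [fbar],
    [gbar], the horizon and the Hoelder constant of [B]. *)

(** * Dyadic sums, sewing and chaining *)

(** The norms of [f_n] in the space [Cz2] may be unbounded in [n], so Young estimates cannot use the
    coefficients of the equation for [x^n]. Their regularity serves for fixed [n] only, to pass to
    fine meshes without a rate; every constant comes from the limit coefficients, [B] and the size
    of the noise. The Hoelder constant of [x^n] is likewise merely finite, and halving arguments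
    eliminate it. Grids are forced by the randomness of [x^n]: the noise must be small at all points
    that the path may visit, while a union bound handles finitely many, and these must be fine
    enough for rounding to cost no more than the path's own increments. Plain increments of [B] will
    not do: for [H > 1/2] their covariances are not summable. With second differences the level-[N]
    term over a cell of level [k] has variance of order [2 ^ (N - k)] times
    [2 ^ (- 2 N (H - kappa))], and this decays geometrically in [N] by [H - kappa > 1/2]. The Wiener
    integral is never constructed: each noise bound holds for the Riemann sums of all levels [N]
    with the same constant. *)

Section RealFacts.
Variable R : realType.
Implicit Types (q c C : R).

Lemma geometric_partial_le q n : 0 <= q -> q < 1 ->
  \sum_(l < n) q ^+ l <= (1 - q)^-1.
Proof.
move=> q0 q1; have q1' : 0 < 1 - q by lra.
rewrite -[leRHS]mul1r ler_pdivlMr// mulrC.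
suff -> : (1 - q) * \sum_(l < n) q ^+ l = 1 - q ^+ n by rewrite gerBl exprn_ge0.
elim: n => [|n IH]; first by rewrite big_ord0 mulr0 expr0 subrr.
by rewrite big_ord_recr/= mulrDr IH exprS; ring.
Qed.

Lemma exp_small q C e : 0 <= q -> q < 1 -> 0 < e ->
  exists n, forall m, (n <= m)%N -> C * q ^+ m <= e.
Proof.
move=> q0 q1 e0.
have /cvgrPdist_le cv : q ^+ n @[n --> \oo] --> (0 : R).
  by apply: cvg_expr; rewrite ger0_norm.
have c0 : 0 < e / (`|C| + 1) by rewrite divr_gt0// ltr_wpDl.
have [n _ H] := cv _ c0; exists n => m nm.
have := H m nm; rewrite sub0r normrN ger0_norm ?exprn_ge0// => h.
apply: (@le_trans _ _ (`|C| * (e / (`|C| + 1)))).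
  apply: (le_trans (ler_norm _)); rewrite normrM (ger0_norm (exprn_ge0 _ q0)).
  by rewrite ler_wpM2l.
by rewrite mulrA ler_pdivrMr ?ltr_wpDl// mulrC ler_pM2l// lerDl.
Qed.

(** Self-improvement: [n] applications of [step] give [S0 / 2 ^ n + 2 * c]. The starting value [S0]
    leaves no trace, so a merely finite Hoelder constant is upgraded to one that depends on the data
    alone. *)
Lemma halving_bound (I : Type) (P : I -> Prop) (F : I -> R) (S0 c : R) :
  0 <= S0 -> 0 <= c -> (forall i, P i -> F i <= S0) ->
  (forall S, 0 <= S -> (forall i, P i -> F i <= S) ->
     forall i, P i -> F i <= S / 2 + c) ->
  forall i, P i -> F i <= 2 * c.
Proof.
move=> S00 c0 H0 step i Pi.
have H n : forall i, P i -> F i <= S0 * 2^-1 ^+ n + 2 * c.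
  elim: n => [|n IH] j Pj; first by rewrite expr0; have := H0 j Pj; lra.
  have p : 0 <= S0 * 2^-1 ^+ n by rewrite mulr_ge0// exprn_ge0// invr_ge0.
  have := step _ _ IH j Pj; rewrite exprS => /(_ ltac:(lra)) h.
  apply: (le_trans h); lra.
apply/ler_addgt0Pr => e e0.
have [n /(_ n (leqnn _)) hn] := @exp_small 2^-1 S0 e ltac:(lra) ltac:(lra) e0.
by have := H n i Pi; lra.
Qed.

Lemma ler_exp_le1 q m n : 0 <= q -> q <= 1 -> (m <= n)%N -> q ^+ n <= q ^+ m.
Proof. by move=> q0 q1 mn; apply: ler_wiXn2l. Qed.

End RealFacts.

Section ZmodIdentities.
Variable W : zmodType.

Lemma subrACA (u v w t : W) : u - v - (w - t) = (u - w) - (v - t).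
Proof. by rewrite !opprD !opprK addrACA. Qed.

Lemma add_sub_split (p r s d1 d2 d3 : W) :
  p + d1 + (r + d2) - (p + s + d3) = (r - s) + (d1 + d2 - d3).
Proof.
rewrite (addrACA p d1) opprD (addrACA (p + r)); congr (_ + _).
by rewrite opprD addrACA subrr add0r.
Qed.

End ZmodIdentities.

Section Dyadic.
Variable R : realType.

Definition dt (k i : nat) : R := i%:R / 2 ^+ k.

Lemma dt0 k : dt k 0 = 0. Proof. by rewrite /dt mul0r. Qed.

Lemma dt_ge0 k i : 0 <= dt k i.
Proof. by rewrite /dt divr_ge0// exprn_ge0. Qed.

Lemma dt_double k i : dt k.+1 i.*2 = dt k i.
Proof.
rewrite /dt -mul2n natrM exprS invfM mulrACA divff ?mul1r//.
Qed.

Lemma dt_scale k n i : dt (k + n) (2 ^ n * i) = dt k i.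
Proof.
rewrite /dt natrM natrX exprD; field.
by rewrite !expf_neq0.
Qed.

Lemma le_dt k i j : (dt k i <= dt k j) = (i <= j)%N.
Proof. by rewrite /dt ler_pM2r ?invr_gt0 ?exprn_gt0// ler_nat. Qed.

Lemma lt_dt k i j : (dt k i < dt k j) = (i < j)%N.
Proof. by rewrite /dt ltr_pM2r ?invr_gt0 ?exprn_gt0// ltr_nat. Qed.

Lemma dtS k i : dt k i.+1 = dt k i + (2 ^+ k)^-1.
Proof. by rewrite /dt -addn1 natrD mulrDl mul1r. Qed.

(* The cells [2 ^ (N - k) * i <= j < 2 ^ (N - k) * i.+1] of level [N] are those
   contained in the cell [[dt k i, dt k i.+1]]; the index is junk if [N < k]. *)
Definition dsum (V : nmodType) (N k i : nat) (F : nat -> V) : V :=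
  \sum_(2 ^ (N - k) * i <= j < 2 ^ (N - k) * i.+1) F j.

Lemma dsum_id (V : nmodType) N i (F : nat -> V) : dsum N N i F = F i.
Proof. by rewrite /dsum subnn expn0 !mul1n big_nat1. Qed.

Lemma dsum_split (V : nmodType) N k i (F : nat -> V) : (k < N)%N ->
  dsum N k i F = dsum N k.+1 i.*2 F + dsum N k.+1 i.*2.+1 F.
Proof.
move=> kN; rewrite /dsum.
have -> : (N - k = (N - k.+1).+1)%N by lia.
rewrite expnS; set e := (2 ^ _)%N.
rewrite (_ : (2 * e * i = e * i.*2)%N); last by lia.
rewrite (_ : (2 * e * i.+1 = e * i.*2.+2)%N); last by lia.
by rewrite [LHS](@big_cat_nat _ _ _ (e * i.*2.+1)%N)//=; apply: leq_mul => //; lia.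
Qed.

Lemma big_nat_double (V : nmodType) p r (F : nat -> V) : (p <= r)%N ->
  \sum_(p.*2 <= j < r.*2) F j = \sum_(p <= j < r) (F j.*2 + F j.*2.+1).
Proof.
elim: r => [|r IH]; first by rewrite leqn0 => /eqP ->; rewrite !big_geq.
rewrite leq_eqVlt => /orP[/eqP <-|]; first by rewrite !big_geq.
rewrite ltnS => pr; rewrite doubleS big_nat_recr/=; last by lia.
by rewrite big_nat_recr/= ?leq_double// IH// big_nat_recr//= addrA.
Qed.

Lemma dsum_refine (V : nmodType) N k i (F : nat -> V) : (k <= N)%N ->
  dsum N.+1 k i F = dsum N k i (fun j => F j.*2 + F j.*2.+1).
Proof.
move=> kN; rewrite /dsum subSn// expnS -!mulnA !mul2n big_nat_double//.
by rewrite leq_mul2l leqnSn orbT.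
Qed.

Lemma dsumB (V : zmodType) N k i (F G : nat -> V) :
  dsum N k i (fun j => F j - G j) = dsum N k i F - dsum N k i G.
Proof. by rewrite /dsum sumrB. Qed.

Lemma dsumD (V : nmodType) N k i (F G : nat -> V) :
  dsum N k i (fun j => F j + G j) = dsum N k i F + dsum N k i G.
Proof. by rewrite /dsum big_split. Qed.

Definition descendant (k i L j : nat) :=
  (k <= L)%N && (2 ^ (L - k) * i <= j < 2 ^ (L - k) * i.+1)%N.

Lemma eq_dsum (V : nmodType) N k i (F G : nat -> V) : (k <= N)%N ->
  (forall j, descendant k i N j -> F j = G j) -> dsum N k i F = dsum N k i G.
Proof.
by move=> kN FG; apply: eq_big_nat => j hj; apply: FG; rewrite /descendant kN.
Qed.

Lemma descendant_dt k i L j : descendant k i L j ->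
  dt k i <= dt L j /\ dt L j.+1 <= dt k i.+1.
Proof.
move=> /and3P[kL h1 h2]; rewrite -(subnKC kL) -(dt_scale _ (L - k)%N i).
by rewrite -(dt_scale _ (L - k)%N i.+1) !le_dt.
Qed.

Lemma dsum_norm_le (V : normedModType R) N k i (F : nat -> V) (c : R) :
  (k <= N)%N ->
  (forall j, descendant k i N j -> `|F j| <= c) ->
  `|dsum N k i F| <= c * 2 ^+ (N - k).
Proof.
move=> kN H; rewrite /dsum; apply: (le_trans (ler_norm_sum _ _ _)).
apply: (@le_trans _ _ (\sum_(2 ^ (N - k) * i <= j < 2 ^ (N - k) * i.+1) c)).
  by apply: ler_sum_nat => j hj; apply: H; rewrite /descendant kN.
by rewrite sumr_const_nat mulnS addnK -(mulr_natr c) natrX.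
Qed.

Lemma descendant_child k i L j : descendant k i L j ->
  descendant k i L.+1 j.*2 /\ descendant k i L.+1 j.*2.+1.
Proof.
move=> /and3P[kL h1 h2]; rewrite /descendant (leqW kL) subSn// expnS.
by rewrite -!mulnA; split; apply/andP; split; lia.
Qed.

(** Refining level [L] into [L + 1] inside the cell creates [2 ^ (L - k)] defects of size
    [C * q ^+ L], in total [C * q ^+ k * (2 * q) ^+ (L - k)]: a convergent geometric series. The
    bound is free of [N], and [A] may depend on [N], since the applications put level-[N] sums into
    the germ. *)
Lemma dyadic_sewing (V : normedModType R) (A : nat -> nat -> V) (C q : R)
  (N k i : nat) : (k <= N)%N -> 0 <= C -> 0 <= q -> 2 * q < 1 ->
  (forall L j, (L < N)%N -> descendant k i L j ->
     `|A L.+1 j.*2 + A L.+1 j.*2.+1 - A L j| <= C * q ^+ L) ->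
  `|dsum N k i (A N) - A k i| <= C * q ^+ k * (1 - 2 * q)^-1.
Proof.
move=> kN C0 q0 q1 H.
suff H' n : (k + n <= N)%N -> `|dsum (k + n) k i (A (k + n)%N) - A k i|
    <= C * q ^+ k * \sum_(l < n) (2 * q) ^+ l.
  have := H' (N - k)%N; rewrite subnKC// => /(_ (leqnn _)) h.
  apply: (le_trans h); rewrite ler_wpM2l ?mulr_ge0 ?exprn_ge0//.
  by apply: geometric_partial_le => //; rewrite mulr_ge0.
elim: n => [_|n IH knN].
  by rewrite addn0 dsum_id subrr normr0 big_ord0 mulr0.
rewrite big_ord_recr/= mulrDr.
rewrite addnS dsum_refine ?leq_addr//.
set X := dsum _ _ _ _.
have -> : X - A k i = (X - dsum (k + n) k i (A (k + n)%N)) +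
  (dsum (k + n) k i (A (k + n)%N) - A k i) by rewrite addrA subrK.
rewrite addrC; apply: (le_trans (ler_normD _ _)); apply: lerD.
  by apply: IH; lia.
rewrite /X -dsumB.
apply: (le_trans (@dsum_norm_le _ _ _ _ _ (C * q ^+ (k + n)) _ _)).
- exact: leq_addr.
- by move=> j hj; apply: H => //; lia.
- by rewrite addKn exprMn exprD le_eqVlt; apply/orP; left; apply/eqP; ring.
Qed.

(** Truncations of the binary expansion lead from the left end of the cell to the point with at most
    one cell per level. Only cells ending no later than the point occur, so increments known up to a
    given time suffice. *)
Lemma dyadic_chain (V : normedModType R) (z : R -> V) (a S : R) (k0 l : nat) :
  0 < a -> a < 1 -> 0 <= S ->
  forall k i, descendant k0 l k i ->
  (forall L j, descendant k0 l L j -> dt L j.+1 <= dt k i ->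
     `|z (dt L j.+1) - z (dt L j)| <= S * a ^+ L) ->
  `|z (dt k i) - z (dt k0 l)| <= S * a ^+ k0 * (1 - a)^-1.
Proof.
move=> a0 a1 S0 k i di.
suff H n : forall i, (2 ^ n * l <= i < 2 ^ n * l.+1)%N ->
    (forall L j, descendant k0 l L j -> dt L j.+1 <= dt (k0 + n) i ->
     `|z (dt L j.+1) - z (dt L j)| <= S * a ^+ L) ->
    `|z (dt (k0 + n) i) - z (dt k0 l)| <= S * a ^+ k0 * \sum_(l < n) a ^+ l.
  case/andP: di => k0k hi; have := H (k - k0)%N i hi; rewrite subnKC// => h h'.
  apply: (le_trans (h h')); rewrite ler_wpM2l ?mulr_ge0 ?exprn_ge0 ?(ltW a0)//.
  by apply: geometric_partial_le => //; exact: ltW.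
elim: n => {k i di}[|n IH] i hi Hinc.
  have -> : i = l by lia.
  by rewrite addn0 subrr normr0 big_ord0 mulr0.
rewrite expnS in hi.
have hj : (2 ^ n * l <= i./2 < 2 ^ n * l.+1)%N by lia.
have E : dt (k0 + n) i./2 = dt (k0 + n.+1) i./2.*2 by rewrite addnS dt_double.
have le2 : dt (k0 + n) i./2 <= dt (k0 + n.+1) i by rewrite E le_dt; lia.
have IH' := IH _ hj (fun L j h1 h2 => Hinc L j h1 (le_trans h2 le2)).
rewrite big_ord_recr/= mulrDr.
have -> : z (dt (k0 + n.+1) i) - z (dt k0 l) =
   (z (dt (k0 + n) i./2) - z (dt k0 l)) +
   (z (dt (k0 + n.+1) i) - z (dt (k0 + n) i./2)) by rewrite [RHS]addrC subrKA.
apply: (le_trans (ler_normD _ _)); apply: lerD => //.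
(* An odd point lies one cell of level [k0 + n.+1] to the right of its parent; an even point
   coincides with it. *)
rewrite E; have [od|ev] := boolP (odd i).
  have -> : i = i./2.*2.+1 by lia.
  have -> : (i./2.*2.+1)./2.*2 = i./2.*2 by lia.
  apply: (@le_trans _ _ (S * a ^+ (k0 + n.+1))); last first.
    by rewrite -mulrA -exprD ler_wpM2l// ler_exp_le1 ?ltW//; lia.
  apply: Hinc; last by rewrite le_dt; lia.
  rewrite /descendant; apply/andP; split; first by lia.
  by rewrite addKn expnS; lia.
have -> : i./2.*2 = i by lia.
by rewrite subrr normr0 !mulr_ge0// exprn_ge0// ltW.
Qed.


Definition dfloor (k : nat) (s : R) : nat := Num.truncn (s * 2 ^+ k).

Lemma dfloor_itv k s : 0 <= s -> dt k (dfloor k s) <= s < dt k (dfloor k s).+1.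
Proof.
move=> s0; rewrite /dt ler_pdivrMr ?exprn_gt0// ltr_pdivlMr ?exprn_gt0//.
by apply: truncn_itv; rewrite mulr_ge0// exprn_ge0.
Qed.

Lemma dfloor_descendant k n s : 0 <= s ->
  descendant k (dfloor k s) (k + n) (dfloor (k + n) s).
Proof.
move=> s0; rewrite /descendant leq_addr addKn.
have /andP[h1 h2] := dfloor_itv k s0; have /andP[h3 h4] := dfloor_itv (k + n) s0.
rewrite -ltnS -(lt_dt (k + n)) dt_scale (le_lt_trans h1 h4)/=.
by rewrite -(lt_dt (k + n)) dt_scale (le_lt_trans h3 h2).
Qed.

Lemma inv2X_le e : 0 < e -> exists n, forall m, (n <= m)%N -> (2 ^+ m)^-1 <= e :> R.
Proof.
move=> e0; have [n h] := @exp_small R 2^-1 1 e ltac:(lra) ltac:(lra) e0.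
by exists n => m /h; rewrite mul1r exprVn.
Qed.

Definition ucont (V : normedModType R) (z : R -> V) (th : R) : Prop :=
  forall e, 0 < e -> exists2 dlt, 0 < dlt & forall s t, 0 <= s <= th ->
    0 <= t <= th -> `|t - s| <= dlt -> `|z t - z s| <= e.

Lemma dfloor_chain (V : normedModType R) (z : R -> V) (a S th s : R) (k : nat) :
  0 < a -> a < 1 -> 0 <= S -> ucont z th -> 0 <= s -> s <= th ->
  (forall k i, dt k i.+1 <= th ->
     `|z (dt k i.+1) - z (dt k i)| <= S * a ^+ k) ->
  `|z s - z (dt k (dfloor k s))| <= S * a ^+ k * (1 - a)^-1.
Proof.
move=> a0 a1 S0 uc s0 sth H; apply/ler_addgt0Pr => e e0.
have [dl d0 hd] := uc _ e0; have [n hn] := inv2X_le d0.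
have /andP[h1 h2] := dfloor_itv (k + n) s0; set i := dfloor (k + n) s in h1 h2.
have h3 : `|z s - z (dt (k + n) i)| <= e.
  have h4 := hn (k + n)%N (leq_addl _ _); apply: hd.
  - by rewrite dt_ge0 (le_trans h1).
  - by rewrite s0.
  - by rewrite ger0_norm ?subr_ge0//; move: h2; rewrite dtS; lra.
have -> : z s - z (dt k (dfloor k s)) =
    z (dt (k + n) i) - z (dt k (dfloor k s)) + (z s - z (dt (k + n) i)).
  by rewrite [RHS]addrC subrKA.
apply: (le_trans (ler_normD _ _)); apply: lerD => //.
apply: dyadic_chain => //; first exact: dfloor_descendant.
by move=> L j _ Lj; apply: H; apply: (le_trans Lj); exact: le_trans sth.
Qed.

(** At the level [k] where [t - s] lies between [2 ^- k.+1] and [2 ^- k] the two dyadic floors are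
    equal or adjacent. One cell and two chains give [1 + 2 * (1 - a)^-1]; the division by [a] comes
    from comparing [a ^+ k.+1] with the power [alpha] of [t - s]. *)
Lemma holder_of_dyadic (V : normedModType R) (z : R -> V) (alpha a S th s t : R) :
  0 < alpha -> a = 2 `^ (- alpha) -> a < 1 -> 0 <= S -> ucont z th ->
  0 <= s -> s < t -> t <= th -> t - s <= 1 ->
  (forall k i, dt k i.+1 <= th ->
     `|z (dt k i.+1) - z (dt k i)| <= S * a ^+ k) ->
  `|z t - z s| <= S * ((1 + 2 * (1 - a)^-1) / a) * (t - s) `^ alpha.
Proof.
move=> al0 aE a1 S0 uc s0 st tth ts1 H.
have a0 : 0 < a by rewrite aE powR_gt0.
have d0 : 0 < (t - s) / 2 by lra.
have [n /(_ n (leqnn _)) hn] := inv2X_le d0.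
have ex : exists k, (2 ^+ k.+1)^-1 < t - s.
  exists n; rewrite exprS invfM; set u := (2 ^+ n)^-1 in hn *.
  have u0 : 0 < u by rewrite invr_gt0 exprn_gt0.
  by move: hn u0; lra.
case: (ex_minnP ex) => k hk kmin.
have hk' : t - s <= (2 ^+ k)^-1.
  case: k hk kmin => [|k] hk kmin; first by rewrite expr0 invr1.
  by rewrite leNgt; apply/negP => /kmin; rewrite ltnn.
have t0 : 0 <= t by lra.
have cs := dfloor_chain k a0 a1 S0 uc s0 (ltW (lt_le_trans st tth)) H.
have ct := dfloor_chain k a0 a1 S0 uc t0 tth H.
have mid : `|z (dt k (dfloor k t)) - z (dt k (dfloor k s))| <= S * a ^+ k.
  have /andP[h1 h2] := dfloor_itv k s0; have /andP[h3 h4] := dfloor_itv k t0.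
  have l1 : (dfloor k s <= dfloor k t)%N.
    by rewrite -ltnS -(lt_dt k); exact: le_lt_trans h1 (lt_trans st h4).
  have l2 : (dfloor k t < (dfloor k s).+2)%N.
    rewrite -(lt_dt k) dtS; apply: (le_lt_trans h3); move: h2 hk'; lra.
  have [<-|E] : dfloor k s = dfloor k t \/ dfloor k t = (dfloor k s).+1.
    by move: l1 l2; move: (dfloor k s) (dfloor k t) => p r; clear; lia.
  - by rewrite subrr normr0 mulr_ge0// exprn_ge0// ltW.
  - by rewrite E; apply: H; rewrite -E; exact: le_trans tth.
have ak : a ^+ k <= (t - s) `^ alpha / a.
  rewrite ler_pdivlMr// -exprSr aE -powR_mulrn ?powR_ge0// powRAC powR_mulrn//.
  rewrite powRN -powR_inv1 ?powR_ge0//.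
  rewrite powRAC powR_inv1 ?exprn_ge0//.
  by apply: ge0_ler_powR; rewrite ?nnegrE ?ltW// ?invr_ge0 ?exprn_ge0//; lra.
have -> : z t - z s = (z t - z (dt k (dfloor k t))) +
   (z (dt k (dfloor k t)) - z (dt k (dfloor k s))) +
   - (z s - z (dt k (dfloor k s))).
  by rewrite subrKA opprB subrKA.
apply: (le_trans (ler_normD _ _)); rewrite normrN.
apply: (le_trans (lerD (le_trans (ler_normD _ _) (lerD ct mid)) cs)).
set A := (1 - a)^-1.
have A0 : 0 <= A by rewrite invr_ge0 subr_ge0 ltW.
have -> : S * a ^+ k * A + S * a ^+ k + S * a ^+ k * A
  = S * (1 + 2 * A) * a ^+ k by ring.
have -> : S * ((1 + 2 * A) / a) * (t - s) `^ alpha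
  = S * (1 + 2 * A) * ((t - s) `^ alpha / a) by rewrite -!mulrA (mulrC a^-1).
by rewrite ler_wpM2l// mulr_ge0// addr_ge0// mulr_ge0.
Qed.

Lemma sup_of_dyadic (V : normedModType R) (z : R -> V) (Z th s : R) :
  ucont z th -> 0 <= s -> s <= th ->
  (forall k i, dt k i <= th -> `|z (dt k i)| <= Z) -> `|z s| <= Z.
Proof.
move=> uc s0 sth H; apply/ler_addgt0Pr => e e0.
have [dl d0 hd] := uc _ e0; have [n hn] := inv2X_le d0.
have /andP[h1 h2] := dfloor_itv n s0; set i := dfloor n s in h1 h2.
rewrite -(subrK (z (dt n i)) (z s)) [leRHS]addrC.
apply: (le_trans (ler_normD _ _)); apply: lerD; last exact/H/(le_trans h1).
have h4 := hn n (leqnn _); apply: hd.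
- by rewrite dt_ge0 (le_trans h1).
- by rewrite s0.
- by rewrite ger0_norm ?subr_ge0//; move: h2; rewrite dtS; lra.
Qed.

End Dyadic.

(** * Stability of dyadic Young equations *)

Section Pathwise.
Variables (R : realType) (V : normedModType R) (a b gam M : R).
Hypotheses (b0 : 0 < b) (ba : b < a) (a1 : a < 1).
Hypotheses (gam0 : 0 < gam) (gam1 : gam <= 1) (bg : 2 * (b * a `^ gam) < 1).
Hypothesis M0 : 0 <= M.

(** [q] is the decay per level of the sewing defect of the noise: regularity [eta] in time and
    [gam * alpha] along the path. [Cq] is the constant of the sewing lemma. As [gam <= 1], [q] also
    dominates the rate [b * a] of the Young term. *)
Variables (q Cq : R).
Hypotheses (qE : q = b * a `^ gam) (CqE : Cq = (1 - 2 * q)^-1).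

(* [Phi k i v] stands for [fbar v] applied to the increment of the driving path
   over the cell [[dt k i, dt k i.+1]]; [b] is [2 ^ (- eta)] and [a] is
   [2 ^ (- alpha)], so that [C * b ^+ k] is an [eta]-Hoelder bound. *)
Definition young_driver (Phi : nat -> nat -> V -> V) (th : R) : Prop :=
  forall k i, dt R k i.+1 <= th ->
  [/\ forall v, Phi k i v = Phi k.+1 i.*2 v + Phi k.+1 i.*2.+1 v,
      forall v, `|Phi k i v| <= M * b ^+ k,
      forall v w, `|Phi k i v - Phi k i w| <= M * b ^+ k * `|v - w| &
      forall v w v' w', `|Phi k i v' - Phi k i w' - (Phi k i v - Phi k i w)|
        <= M * b ^+ k * (`|v' - w' - (v - w)| +
                         `|v - w| * (`|v' - v| + `|w' - w|))].

(** One constant serves the Riemann sums of every level [N >= k], so no limit in [N] has to exist.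
    The points are restricted to [net k], in the application a finite grid, because the bound comes
    from a union bound. *)
Definition small_noise (psi : nat -> nat -> V -> V) (net : nat -> V -> Prop)
    (eps th : R) : Prop :=
  forall N k i, (k <= N)%N -> dt R k i.+1 <= th ->
  (forall z, net k z -> `|dsum N k i (psi N ^~ z)| <= eps * b ^+ k) /\
  (forall z z', net k z -> net k z' ->
     `|dsum N k i (psi N ^~ z) - dsum N k i (psi N ^~ z')|
       <= eps * b ^+ k * `|z - z'| `^ gam).

(** The equation is kept only as a limit of dyadic sums, with no rate in [N]. The noise is evaluated
    at the rounded path, as it is controlled on the net alone; [psi = 0] with [pi = id] expresses
    the limit equation. *)
Definition approx_sol (Phi psi : nat -> nat -> V -> V) (pi : nat -> V -> V)
    (y : R -> V) (th : R) : Prop :=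
  forall k i, dt R k i.+1 <= th -> forall e, 0 < e ->
  exists N0, forall N, (N0 <= N)%N ->
    `|dsum N k i (fun j => Phi N j (y (dt R N j)) + psi N j (pi N (y (dt R N j))))
      - (y (dt R k i.+1) - y (dt R k i))| <= e.

Definition rounds_into (net : nat -> V -> Prop) (pi : nat -> V -> V)
    (y : R -> V) (th : R) : Prop :=
  (forall k z, net k z -> net k.+1 z) /\
  forall k i, dt R k i <= th -> net k (pi k (y (dt R k i))) /\
    `|pi k (y (dt R k i)) - y (dt R k i)| <= a ^+ k.

Let a0 : 0 < a. Proof. exact: lt_trans ba. Qed.
Let g_ge0 : 0 <= a `^ gam. Proof. exact: powR_ge0. Qed.
Let g_le1 : a `^ gam <= 1.
Proof.
have := @ge0_ler_powR _ gam (ltW gam0) a 1.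
by rewrite powR1 !nnegrE; apply; rewrite ?ltW.
Qed.
Let a_le_g : a <= a `^ gam.
Proof.
rewrite -{1}(powRr1 (ltW a0)); apply: ger_powR => //; apply/andP; split => //.
exact: ltW.
Qed.
Let q0 : 0 <= q. Proof. by rewrite qE mulr_ge0// ltW. Qed.
Let q_le_b : q <= b. Proof. by rewrite qE ler_piMr// ltW. Qed.
Let Cq_ge1 : 1 <= Cq.
Proof.
rewrite CqE; have p : 0 < 1 - 2 * q by rewrite subr_gt0 qE.
by rewrite invf_ge1//; have := q0; lra.
Qed.

Let expq_le k : q ^+ k <= b ^+ k.
Proof. by apply: lerXn2r; rewrite ?nnegrE// ltW. Qed.

Let rho : 0 <= b / a /\ b / a < 1.
Proof. by split; [rewrite divr_ge0 ?ltW | rewrite ltr_pdivrMr ?mul1r]. Qed.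

(** The surplus [eta - alpha] of the driver becomes the factor [(b / a) ^+ k0] on all levels from
    [k0] on. A large [k0] plays the part of a short time interval and absorbs the terms proportional
    to the unknown constant. *)
Let expb_le k0 k : (k0 <= k)%N -> b ^+ k <= a ^+ k * (b / a) ^+ k0.
Proof.
move=> h; have -> : b ^+ k = a ^+ k * (b / a) ^+ k.
  by rewrite -exprMn mulrC divfK// gt_eqF.
by rewrite ler_wpM2l ?exprn_ge0 ?(ltW a0)// ler_exp_le1//; case: rho => // ? /ltW.
Qed.

Lemma limit_norm_le (u : nat -> V) (l : V) (c : R) (k : nat) :
  (forall e, 0 < e -> exists N0, forall N, (N0 <= N)%N -> `|u N - l| <= e) ->
  (forall N, (k <= N)%N -> `|u N| <= c) -> `|l| <= c.
Proof.
move=> lim H; apply/ler_addgt0Pr => e e0; have [N0 h] := lim _ e0.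
have h1 := h (maxn N0 k) (leq_maxl _ _); have h2 := H (maxn N0 k) (leq_maxr _ _).
have -> : l = u (maxn N0 k) - (u (maxn N0 k) - l) by rewrite subKr.
by apply: (le_trans (ler_normB _ _)); apply: lerD.
Qed.

(* The defect of the germ [D_n] evaluated at the rounded path, needed for
   sewing: it compares grid points of two successive levels. *)
Lemma noise_coherence psi net pi y eps th N L j S : 0 <= eps -> 0 <= S ->
  small_noise psi net eps th -> rounds_into net pi y th ->
  (L < N)%N -> dt R L j.+1 <= th ->
  `|y (dt R L.+1 j.*2.+1) - y (dt R L.+1 j.*2)| <= S * a ^+ L.+1 ->
  `|dsum N L.+1 j.*2 (psi N ^~ (pi L.+1 (y (dt R L.+1 j.*2))))
    + dsum N L.+1 j.*2.+1 (psi N ^~ (pi L.+1 (y (dt R L.+1 j.*2.+1))))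
    - dsum N L j (psi N ^~ (pi L (y (dt R L j))))| <= 2 * eps * (S + 2) * q ^+ L.
Proof.
move=> e0 S0 Hpsi [nst Hpi] LN jth Hinc.
have t2 : dt R L.+1 j.*2.+2 <= th by rewrite -doubleS dt_double.
have t1 : dt R L.+1 j.*2.+1 <= th by apply: le_trans t2; rewrite le_dt.
have t0 : dt R L j <= th by apply: le_trans jth; rewrite le_dt.
have t0' : dt R L.+1 j.*2 <= th by rewrite dt_double.
have [n0 d0] := Hpi _ _ t0; have [n1 d1] := Hpi _ _ t1; have [n2 d2] := Hpi _ _ t0'.
have aL : a ^+ L.+1 <= a ^+ L by rewrite ler_exp_le1// ltW.
have aL0 : 0 <= a ^+ L by rewrite exprn_ge0// ltW.
(* The net points to be compared differ by at most one path increment and two rounding errors,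
   whence [S + 2]. As [S + 2 >= 1], its power [gam] is bounded by itself. *)
have E : forall i z z', dt R L.+1 i.+1 <= th -> net L.+1 z -> net L.+1 z' ->
    `|z - z'| <= (S + 2) * a ^+ L ->
    `|dsum N L.+1 i (psi N ^~ z) - dsum N L.+1 i (psi N ^~ z')|
      <= eps * (S + 2) * q ^+ L.
  move=> i z z' ti nz nz' dz; have [_ h] := Hpsi N L.+1 i LN ti.
  apply: (le_trans (h _ _ nz nz')).
  have -> : eps * (S + 2) * q ^+ L = eps * b ^+ L * ((S + 2) * (a `^ gam) ^+ L).
    by rewrite qE exprMn; ring.
  apply: ler_pM; rewrite ?mulr_ge0 ?exprn_ge0 ?powR_ge0 ?(ltW b0)//.
    by rewrite ler_wpM2l// ler_exp_le1 ?(ltW b0)//; have := ba; have := a1; lra.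
  apply: (@le_trans _ _ (((S + 2) * a ^+ L) `^ gam)).
    have p : 0 <= (S + 2) * a ^+ L by rewrite mulr_ge0//; lra.
    exact: (ge0_ler_powR (ltW gam0)) (normr_ge0 _) p dz.
  rewrite powRM ?exprn_ge0 ?(ltW a0)//; last by lra.
  have -> : (a ^+ L) `^ gam = (a `^ gam) ^+ L.
    by rewrite -powR_mulrn ?(ltW a0)// powRAC powR_mulrn ?powR_ge0.
  apply: ler_wpM2r; first by rewrite exprn_ge0.
  have S1 : 1 <= S + 2 by lra.
  by rewrite -{2}(powRr1 (le_trans ler01 S1)); apply: ler_powR.
rewrite (dsum_split j _ LN) dt_double; rewrite dt_double in d2 n2 Hinc.
set y0 := y _ in d0 d2 n0 n2 Hinc *; set y1 := y _ in d1 n1 Hinc *.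
set A1 := dsum _ _ _ _; set A2 := dsum _ _ _ _.
set A3 := dsum _ _ _ _; set A4 := dsum _ _ _ _.
have -> : A1 + A2 - (A3 + A4) = (A1 - A3) + (A2 - A4).
  by rewrite opprD addrACA.
apply: (le_trans (ler_normD _ _)).
have -> : 2 * eps * (S + 2) * q ^+ L
  = eps * (S + 2) * q ^+ L + eps * (S + 2) * q ^+ L by ring.
apply: lerD; apply: E => //; try exact: nst.
- apply: (le_trans (ler_distD y0 _ _)); rewrite (distrC y0).
  by move: d0 d2; set n := a ^+ L.+1 in aL *; nra.
- apply: (le_trans (ler_distD y1 _ _)).
  apply: (@le_trans _ _ (a ^+ L.+1 + (S * a ^+ L.+1 + a ^+ L))).
    rewrite lerD//; apply: (le_trans (ler_distD y0 _ _)).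
    by rewrite lerD// distrC.
  by set n := a ^+ L.+1 in aL *; nra.
Qed.

Let q_le1 : q <= 1.
Proof. by apply: (le_trans q_le_b); exact: ltW (lt_trans ba a1). Qed.

Let abq L : b ^+ L.+1 * a ^+ L.+1 <= q ^+ L.
Proof.
rewrite -exprMn; apply: (@le_trans _ _ (q ^+ L.+1)).
  apply: lerXn2r; rewrite ?nnegrE ?mulr_ge0 ?(ltW b0) ?(ltW a0)//.
  by rewrite qE ler_wpM2l// ltW.
exact: ler_exp_le1.
Qed.

Let q1 : 2 * q < 1. Proof. by rewrite qE. Qed.

Lemma descendant_le k i L j th : descendant k i L j -> dt R k i.+1 <= th ->
  dt R L j.+1 <= th.
Proof. by move=> /(descendant_dt R)[_ h] /(le_trans h). Qed.

Lemma dt_mid L j th : dt R L j.+1 <= th ->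
  dt R L.+1 j.*2.+1 <= th /\ dt R L.+1 j.*2.+2 <= th.
Proof.
move=> h; have h2 : dt R L.+1 j.*2.+2 <= th by rewrite -doubleS dt_double.
by split => //; apply: le_trans h2; rewrite le_dt.
Qed.

(** Sewing on a cell of level [k >= k0] returns [b ^+ k] times an affine function of the current
    constant [S]. The condition on [k0] makes its slope at most one half relative to [a ^+ k], and
    halving yields a constant without [S0]. *)
Lemma apriori_increments Phi psi net pi y eps th k0 S0 :
  0 <= eps -> eps <= 1 -> young_driver Phi th -> small_noise psi net eps th ->
  rounds_into net pi y th -> approx_sol Phi psi pi y th ->
  (b / a) ^+ k0 * ((M + 2) * Cq) <= 2^-1 -> 0 <= S0 ->
  (forall k i, (k0 <= k)%N -> dt R k i.+1 <= th ->
     `|y (dt R k i.+1) - y (dt R k i)| <= S0 * a ^+ k) ->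
  forall k i, (k0 <= k)%N -> dt R k i.+1 <= th ->
     `|y (dt R k i.+1) - y (dt R k i)| <= 2 * (M + 1 + 4 * Cq) * a ^+ k.
Proof.
move=> e0 e1 HPhi Hpsi Hpi Hsol hk0 S00 H0.
pose P (p : nat * nat) := (k0 <= p.1)%N /\ dt R p.1 p.2.+1 <= th.
pose F (p : nat * nat) :=
  `|y (dt R p.1 p.2.+1) - y (dt R p.1 p.2)| / a ^+ p.1.
have ak k : 0 < a ^+ k by rewrite exprn_gt0.
suff H : forall p, P p -> F p <= 2 * (M + 1 + 4 * Cq).
  by move=> k i k0k it; have := H (k, i) (conj k0k it); rewrite /F ler_pdivrMr.
have C0 : 0 <= Cq by apply: le_trans Cq_ge1.
apply: (halving_bound S00).
- by have := C0; have := M0; lra.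
- by move=> [k i] [/= k0k it]; rewrite /F/= ler_pdivrMr//; exact: H0.
move=> S S_ge0 HS [k i] [/= k0k it]; rewrite /F/= ler_pdivrMr//.
have {}HS L j : (k0 <= L)%N -> dt R L j.+1 <= th ->
    `|y (dt R L j.+1) - y (dt R L j)| <= S * a ^+ L.
  by move=> h1 h2; have := HS (L, j) (conj h1 h2); rewrite /F/= ler_pdivrMr.
apply: (limit_norm_le (k := k) (Hsol _ _ it)) => N kN.
(* The germ carries the noise already summed at level [N]; for [L = N] it is the summand of
   [approx_sol]. *)
pose A L j := Phi L j (y (dt R L j)) +
  dsum N L j (psi N ^~ (pi L (y (dt R L j)))).
have -> : dsum N k i (fun j => Phi N j (y (dt R N j)) +
    psi N j (pi N (y (dt R N j)))) = dsum N k i (A N).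
  by apply: eq_dsum => // j _; rewrite /A dsum_id.
set C := M * S + 2 * eps * (S + 2).
have CC : 0 <= C by rewrite addr_ge0 ?mulr_ge0//; lra.
have sew : `|dsum N k i (A N) - A k i| <= C * q ^+ k * (1 - 2 * q)^-1.
  apply: dyadic_sewing => // L j LN dj.
  have jt := descendant_le dj it; have [t1 t2] := dt_mid jt.
  have k0L : (k0 <= L.+1)%N by case/andP: dj => kL _; exact: leqW (leq_trans k0k kL).
  have hD := noise_coherence e0 S_ge0 Hpsi Hpi LN jt (HS _ _ k0L t1).
  (* Additivity of [Phi] in the cell cancels the left half: the Young defect is the right half
     evaluated at two successive points of the path. *)
  have [_ _ lip _] := HPhi _ _ t2; have [add _ _ _] := HPhi _ _ jt.
  rewrite /A (add (y (dt R L j))).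
  set P1 := Phi _ _ _; set D1 := dsum N L.+1 j.*2 _; set P2 := Phi _ _ _.
  set D2 := dsum N L.+1 j.*2.+1 _; set D3 := dsum N L _ _.
  have -> : P1 + D1 + (P2 + D2) - (Phi L.+1 j.*2 (y (dt R L j)) +
      Phi L.+1 j.*2.+1 (y (dt R L j)) + D3)
     = (P2 - Phi L.+1 j.*2.+1 (y (dt R L.+1 j.*2))) + (D1 + D2 - D3).
    rewrite /P1 dt_double; set P0 := Phi _ _ _; set P3 := Phi _ _ _.
    exact: add_sub_split.
  apply: (le_trans (ler_normD _ _)); rewrite /C mulrDl; apply: lerD => //.
  apply: (le_trans (lip _ _)); apply: (@le_trans _ _ (M * b ^+ L.+1 * (S * a ^+ L.+1))).
    by rewrite ler_wpM2l ?HS ?mulr_ge0 ?exprn_ge0// ltW.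
  by rewrite mulrACA ler_wpM2l ?mulr_ge0.
have hA : `|A k i| <= M * b ^+ k + eps * b ^+ k.
  apply: (le_trans (ler_normD _ _)); apply: lerD.
    by have [_ h _ _] := HPhi _ _ it.
  have [h _] := Hpsi _ _ _ kN it; apply: h.
  apply: (Hpi.2 _ _ _).1; apply: le_trans it; by rewrite le_dt.
have -> : dsum N k i (A N) = A k i + (dsum N k i (A N) - A k i).
  by rewrite [RHS]addrC subrK.
apply: (le_trans (ler_normD _ _)).
apply: (le_trans (lerD hA sew)); rewrite -CqE.
have bk := expb_le k0k; have qk := expq_le k.
set r := (b / a) ^+ k0 in hk0 bk; set ak' := a ^+ k in bk *.
have r0 : 0 <= r by rewrite /r exprn_ge0//; case: rho.
have r1 : r <= 1 by rewrite /r exprn_ile1//; case: rho => // ? /ltW.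
apply: (@le_trans _ _ (b ^+ k * (M + eps + C * Cq))).
  have -> : b ^+ k * (M + eps + C * Cq) =
    M * b ^+ k + eps * b ^+ k + b ^+ k * (C * Cq) by ring.
  by rewrite lerD2l mulrAC [leLHS]mulrC ler_wpM2r// mulr_ge0.
apply: (@le_trans _ _ (ak' * r * (M + eps + C * Cq))).
  by rewrite ler_wpM2r// !addr_ge0// mulr_ge0.
rewrite -mulrA mulrC; rewrite ler_wpM2r// ?(ltW (ak k))//.
have hC : M + eps + C * Cq <= (M + 2) * Cq * S + (M + 1 + 4 * Cq).
  rewrite /C; have := C0; have := M0.
  have := mulr_ge0 C0 S_ge0; set W := Cq * S.
  have -> : (M * S + 2 * eps * (S + 2)) * Cq = M * W + 2 * (eps * W) + 4 * (eps * Cq).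
    by rewrite /W; ring.
  have -> : (M + 2) * Cq * S = M * W + 2 * W by rewrite /W; ring.
  move=> W0 M0' C0'; have := ler_wpM2r W0 e1; have := ler_wpM2r C0' e1; lra.
apply: (le_trans (ler_wpM2l r0 hC)); rewrite mulrDr; apply: lerD.
  by rewrite mulrA (mulrC S) ler_wpM2r.
by rewrite ler_piMl// !addr_ge0// ?mulr_ge0.
Qed.

Let dyadic_chain1 (z : R -> V) (S : R) (k0 l k i : nat) : 0 <= S ->
  descendant k0 l k i ->
  (forall L j, descendant k0 l L j -> dt R L j.+1 <= dt R k i ->
     `|z (dt R L j.+1) - z (dt R L j)| <= S * a ^+ L) ->
  `|z (dt R k i) - z (dt R k0 l)| <= S * (1 - a)^-1.
Proof.
move=> S0 dk H; apply: (le_trans (dyadic_chain a0 a1 S0 dk H)).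
rewrite ler_wpM2r ?invr_ge0 ?subr_ge0 ?(ltW a1)// ler_piMr//.
by rewrite exprn_ile1// ltW.
Qed.

Let A := (1 - a)^-1.
Let A0 : 0 <= A. Proof. by rewrite invr_ge0 subr_ge0 ltW. Qed.

(** The scheme of [apriori_increments] for [z = y - x] on one cell of level [k0], with the
    four-point bound of [Phi] in place of the Lipschitz bound. Inside the cell chaining gives
    [|z| <= z0 + S * A]; [D1] collects the coefficients of [S], and [D2] those of [z0] and [eps]. *)
Lemma increment_diff_le Phi psi net pi x y eps th k0 l C0 z0 D1 D2 :
  0 <= eps -> young_driver Phi th -> small_noise psi net eps th ->
  rounds_into net pi y th -> approx_sol Phi psi pi y th ->
  approx_sol Phi (fun _ _ _ => 0) (fun _ => id) x th ->
  0 <= C0 ->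
  (forall k i, (k0 <= k)%N -> dt R k i.+1 <= th ->
     `|x (dt R k i.+1) - x (dt R k i)| <= C0 * a ^+ k) ->
  (forall k i, (k0 <= k)%N -> dt R k i.+1 <= th ->
     `|y (dt R k i.+1) - y (dt R k i)| <= C0 * a ^+ k) ->
  `|y (dt R k0 l) - x (dt R k0 l)| <= z0 ->
  D1 = (M + 2 * M * C0 * Cq) * A + M * Cq ->
  D2 = M + 2 * M * C0 * Cq + (1 + 2 * (C0 + 2) * Cq) ->
  (b / a) ^+ k0 * D1 <= 2^-1 ->
  forall k i, descendant k0 l k i -> dt R k i.+1 <= th ->
     `|(y (dt R k i.+1) - x (dt R k i.+1)) - (y (dt R k i) - x (dt R k i))|
        <= 2 * (D2 * (z0 + eps)) * a ^+ k.
Proof.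
move=> e0 HPhi Hpsi Hpi Hy Hx C00 incx incy hz0 D1E D2E hk0.
pose z t := y t - x t.
pose P (p : nat * nat) := descendant k0 l p.1 p.2 /\ dt R p.1 p.2.+1 <= th.
pose F (p : nat * nat) :=
  `|z (dt R p.1 p.2.+1) - z (dt R p.1 p.2)| / a ^+ p.1.
have ak k : 0 < a ^+ k by rewrite exprn_gt0.
have z00 : 0 <= z0 by apply: le_trans hz0.
have Cq0 : 0 <= Cq by apply: le_trans Cq_ge1.
have D20 : 0 <= D2 by rewrite D2E !addr_ge0 ?mulr_ge0 ?addr_ge0.
suff H : forall p, P p -> F p <= 2 * (D2 * (z0 + eps)).
  by move=> k i k0k it; have := H (k, i) (conj k0k it); rewrite /F ler_pdivrMr.
have distz t s : z t - z s = (y t - y s) - (x t - x s).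
  by rewrite /z subrACA.
apply: (@halving_bound _ _ _ _ (2 * C0)) => //.
- by rewrite mulr_ge0.
- by rewrite mulr_ge0// addr_ge0.
- move=> [k i] [/= dk it]; rewrite /F/= ler_pdivrMr//.
  have k0k : (k0 <= k)%N by case/andP: dk.
  rewrite distz; apply: (le_trans (ler_normB _ _)).
  by rewrite -mulrA mulr_natl mulr2n lerD ?incx ?incy.
move=> S S0 HS [k i] [/= dk it]; rewrite /F/= ler_pdivrMr//.
have {}HS L j : descendant k0 l L j -> dt R L j.+1 <= th ->
    `|z (dt R L j.+1) - z (dt R L j)| <= S * a ^+ L.
  by move=> h1 h2; have := HS (L, j) (conj h1 h2); rewrite /F/= ler_pdivrMr.
set Z := z0 + S * A.
have Z0 : 0 <= Z by rewrite addr_ge0// mulr_ge0.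
have zle L j : descendant k0 l L j -> dt R L j <= th -> `|z (dt R L j)| <= Z.
  move=> dj jt; rewrite -(subrK (z (dt R k0 l)) (z (dt R L j))) /Z [leRHS]addrC.
  apply: (le_trans (ler_normD _ _)); apply: lerD => //.
  apply: dyadic_chain1 => // L' j' dj' tj'; apply: HS => //.
  exact: le_trans jt.
have k0k : (k0 <= k)%N by case/andP: dk.
have desc L j : descendant k i L j -> descendant k0 l L j.
  move=> /and3P[kL h1 h2]; case/and3P: dk => _ h3 h4; apply/and3P.
  rewrite (leq_trans k0k kL) -(subnK kL) -addnBA// expnD -!mulnA; split => //.
    by apply: leq_trans h1; rewrite leq_mul2l h3 orbT.
  by apply: (leq_trans h2); rewrite leq_mul2l h4 orbT.
pose u N := dsum N k i (fun j => Phi N j (y (dt R N j)) + psi N j (pi N (y (dt R N j))))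
   - dsum N k i (fun j => Phi N j (x (dt R N j)) + 0).
apply: (@limit_norm_le u _ _ k).
  move=> e e1; have e2 : 0 < e / 2 by lra.
  have [N1 h1] := Hy _ _ it _ e2; have [N2 h2] := Hx _ _ it _ e2.
  exists (maxn N1 N2) => N; rewrite geq_max => /andP[N1N N2N].
  have {}h1 := h1 _ N1N; have {}h2 := h2 _ N2N.
  rewrite distz /u.
  rewrite subrACA.
  by apply: (le_trans (ler_normB _ _)); rewrite /= in h2; lra.
move=> N kN.
pose G L j := (Phi L j (y (dt R L j)) - Phi L j (x (dt R L j))) +
  dsum N L j (psi N ^~ (pi L (y (dt R L j)))).
have -> : u N = dsum N k i (G N).
  rewrite /u -dsumB; apply: eq_dsum => // j _.
  by rewrite /G dsum_id addr0 addrAC.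
(* In the four-point bound [S] measures the increment of [z], and [2 * C0 * Z] is the size of [z]
   times the motions of [x] and [y]. *)
set C := M * (S + 2 * C0 * Z) + 2 * eps * (C0 + 2).
have CC : 0 <= C by rewrite addr_ge0 ?mulr_ge0 ?addr_ge0 ?mulr_ge0.
have sew : `|dsum N k i (G N) - G k i| <= C * q ^+ k * (1 - 2 * q)^-1.
  apply: dyadic_sewing => // L j LN dj.
  have jt := descendant_le dj it; have [t1 t2] := dt_mid jt.
  have dj0 := desc _ _ dj; have [dj1 dj2] := descendant_child dj0.
  have k0L : (k0 <= L.+1)%N by case/andP: dj1.
  have hD := noise_coherence e0 C00 Hpsi Hpi LN jt (incy _ _ k0L t1).
  have [_ _ _ four] := HPhi _ _ t2; have [add _ _ _] := HPhi _ _ jt.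
  rewrite /G (add (y (dt R L j))) (add (x (dt R L j))).
  rewrite [in X in _ - (X + _)]opprD [in X in _ - (X + _)]addrACA.
  rewrite -[in X in _ - X](dt_double R L j).
  rewrite add_sub_split.
  apply: (le_trans (ler_normD _ _)); rewrite /C mulrDl; apply: lerD; last first.
    by move: hD; rewrite dt_double.
  apply: (le_trans (four _ _ _ _)).
  have t0 : dt R L.+1 j.*2 <= th by apply: le_trans t1; rewrite le_dt.
  have b1 := HS _ _ dj1 t1; have b2 := zle _ _ dj1 t0.
  have b3 := incy _ _ k0L t1; have b4 := incx _ _ k0L t1.
  apply: (@le_trans _ _ (M * b ^+ L.+1 * ((S + 2 * C0 * Z) * a ^+ L.+1))).
    rewrite ler_wpM2l ?mulr_ge0 ?exprn_ge0 ?(ltW b0)// mulrDl lerD//.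
    apply: (@le_trans _ _ (Z * (C0 * a ^+ L.+1 + C0 * a ^+ L.+1))).
      by apply: ler_pM => //; rewrite ?addr_ge0// lerD.
    by rewrite le_eqVlt; apply/orP; left; apply/eqP; ring.
  by rewrite mulrACA ler_wpM2l ?mulr_ge0// addr_ge0// !mulr_ge0.
have it0 : dt R k i <= th by apply: le_trans it; rewrite le_dt.
have hG : `|G k i| <= M * b ^+ k * Z + eps * b ^+ k.
  apply: (le_trans (ler_normD _ _)); apply: lerD.
    have [_ _ h _] := HPhi _ _ it; apply: (le_trans (h _ _)).
    by rewrite ler_wpM2l ?mulr_ge0 ?exprn_ge0 ?(ltW b0)//; exact: zle.
  have [h _] := Hpsi _ _ _ kN it; apply: h.
  by apply: (Hpi.2 _ _ _).1.
have -> : dsum N k i (G N) = G k i + (dsum N k i (G N) - G k i).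
  by rewrite [RHS]addrC subrK.
apply: (le_trans (ler_normD _ _)).
apply: (le_trans (lerD hG sew)); rewrite -CqE.
have bk := expb_le k0k; have qk := expq_le k.
set r := (b / a) ^+ k0 in hk0 bk; set ak' := a ^+ k in bk *.
have r0 : 0 <= r by rewrite /r exprn_ge0//; case: rho.
have r1 : r <= 1 by rewrite /r exprn_ile1//; case: rho => // ? /ltW.
apply: (@le_trans _ _ (b ^+ k * (M * Z + eps + C * Cq))).
  have -> : b ^+ k * (M * Z + eps + C * Cq) =
    M * b ^+ k * Z + eps * b ^+ k + b ^+ k * (C * Cq) by ring.
  by rewrite lerD2l mulrAC [leLHS]mulrC ler_wpM2r// mulr_ge0.
apply: (@le_trans _ _ (ak' * r * (M * Z + eps + C * Cq))).
  by rewrite ler_wpM2r// !addr_ge0// mulr_ge0.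
rewrite -mulrA mulrC; rewrite ler_wpM2r// ?(ltW (ak k))//.
have hC : M * Z + eps + C * Cq <= D1 * S + D2 * (z0 + eps).
  have -> : M * Z + eps + C * Cq = D1 * S +
     ((M + 2 * M * C0 * Cq) * z0 + (1 + 2 * (C0 + 2) * Cq) * eps).
    by rewrite /C /Z D1E; ring.
  rewrite lerD2l D2E; set u1 := M + _; set u2 := 1 + _.
  have u10 : 0 <= u1 * eps by rewrite !mulr_ge0// addr_ge0// !mulr_ge0.
  have u20 : 0 <= u2 * z0 by rewrite !mulr_ge0// addr_ge0// !mulr_ge0// addr_ge0.
  have -> : (u1 + u2) * (z0 + eps) = u1 * z0 + u2 * eps + (u1 * eps + u2 * z0) by ring.
  by rewrite lerDl addr_ge0.
apply: (le_trans (ler_wpM2l r0 hC)); rewrite mulrDr; apply: lerD.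
  by rewrite mulrA (mulrC S) ler_wpM2r.
by rewrite ler_piMl// mulr_ge0// addr_ge0.
Qed.

Lemma descendant_div k0 k i : (k0 <= k)%N -> descendant k0 (i %/ 2 ^ (k - k0)) k i.
Proof.
move=> h; rewrite /descendant h /= mulnC leq_trunc_div/= mulnC.
by rewrite ltn_ceil// expn_gt0.
Qed.

(** Discrete Gronwall: each cell of level [k0] multiplies [|z| + eps] by at most [1 + D], and [L]
    such cells cover the horizon. *)
Lemma diff_iterate (z : R -> V) (eps th D : R) (k0 L : nat) :
  0 <= eps -> 0 <= D -> z 0 = 0 -> th <= dt R k0 L ->
  (forall l z0, `|z (dt R k0 l)| <= z0 ->
   forall k i, descendant k0 l k i -> dt R k i.+1 <= th ->
     `|z (dt R k i.+1) - z (dt R k i)| <= D * (z0 + eps) * a ^+ k) ->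
  (forall k i, (k0 <= k)%N -> dt R k i.+1 <= th ->
     `|z (dt R k i.+1) - z (dt R k i)| <= D * (1 + D) ^+ L * eps * a ^+ k) /\
  (forall k i, (k0 <= k)%N -> dt R k i <= th ->
     `|z (dt R k i)| <= (1 + D * A) * (1 + D) ^+ L * eps).
Proof.
move=> e0 D0 z0 thL H.
have D1 : 1 <= 1 + D by rewrite lerDl.
have block l : dt R k0 l <= th -> `|z (dt R k0 l)| + eps <= (1 + D) ^+ l * eps.
  elim: l => [_|l IH lt]; first by rewrite dt0 z0 normr0 add0r expr0 mul1r.
  have lt' : dt R k0 l <= th by apply: le_trans lt; rewrite le_dt.
  have {}IH := IH lt'.
  have dl : descendant k0 l k0 l by rewrite /descendant leqnn subnn !mul1n leqnn/=.
  have h := H _ _ (lexx _) _ _ dl lt.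
  have h' : `|z (dt R k0 l.+1)| <= `|z (dt R k0 l)| + D * (`|z (dt R k0 l)| + eps).
    rewrite -[X in `|X| <= _](subrK (z (dt R k0 l))) [leRHS]addrC.
    apply: (le_trans (ler_normD _ _)); rewrite lerD2r; apply: (le_trans h).
    by rewrite ler_piMr ?mulr_ge0 ?addr_ge0// exprn_ile1 ?ltW.
  have h2 : (1 + D) * (`|z (dt R k0 l)| + eps) <= (1 + D) * ((1 + D) ^+ l * eps).
    by rewrite ler_wpM2l// (le_trans ler01).
  by rewrite exprS -mulrA; apply: le_trans h2; move: h'; lra.
have blockL k i : (k0 <= k)%N -> dt R k i <= th ->
    exists l, [/\ descendant k0 l k i, dt R k0 l <= th &
      `|z (dt R k0 l)| + eps <= (1 + D) ^+ L * eps].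
  move=> k0k it; exists (i %/ 2 ^ (k - k0))%N.
  have dl := descendant_div i k0k.
  have lt : dt R k0 (i %/ 2 ^ (k - k0)) <= th.
    by have [h _] := descendant_dt R dl; exact: le_trans it.
  split => //; apply: (le_trans (block _ lt)).
  rewrite ler_wpM2r// ler_weXn2l//.
  by have := le_trans lt thL; rewrite le_dt.
split=> k i k0k it.
  have it0 : dt R k i <= th by apply: le_trans it; rewrite le_dt.
  have [l [dl lt hl]] := blockL _ _ k0k it0.
  apply: (le_trans (H _ _ (lexx _) _ _ dl it)).
  by rewrite ler_wpM2r ?exprn_ge0 ?(ltW a0)// -mulrA ler_wpM2l.
have [l [dl lt hl]] := blockL _ _ k0k it.
have S0 : 0 <= D * (`|z (dt R k0 l)| + eps) by rewrite mulr_ge0// addr_ge0.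
have h : `|z (dt R k i) - z (dt R k0 l)| <= D * (`|z (dt R k0 l)| + eps) * A.
  apply: dyadic_chain1 => // L' j dj tj; apply: (H _ _ (lexx _)) => //.
  exact: le_trans it.
rewrite -[X in `|X| <= _](subrK (z (dt R k0 l))).
apply: (le_trans (ler_normD _ _)).
have h2 : (1 + D * A) * (`|z (dt R k0 l)| + eps) <= (1 + D * A) * ((1 + D) ^+ L * eps).
  by rewrite ler_wpM2l// addr_ge0// mulr_ge0.
rewrite -mulrA; apply: le_trans h2; apply: (le_trans (lerD h (lexx _))).
set w := `|z _|; have -> : (1 + D * A) * (w + eps) = D * (w + eps) * A + w + eps by ring.
by rewrite lerDl.
Qed.

Lemma young_driverW Phi th th' : th' <= th -> young_driver Phi th ->
  young_driver Phi th'.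
Proof. by move=> h H k i it; apply: H; exact: le_trans h. Qed.

Lemma small_noiseW psi net eps th th' : th' <= th -> small_noise psi net eps th ->
  small_noise psi net eps th'.
Proof. by move=> h H N k i kN it; apply: H => //; exact: le_trans h. Qed.

Lemma approx_solW Phi psi pi y th th' : th' <= th -> approx_sol Phi psi pi y th ->
  approx_sol Phi psi pi y th'.
Proof. by move=> h H k i it; apply: H; exact: le_trans h. Qed.

Definition dyadic_holder (y : R -> V) (th : R) : Prop :=
  exists2 S0, 0 <= S0 & forall k i, dt R k i.+1 <= th ->
     `|y (dt R k i.+1) - y (dt R k i)| <= S0 * a ^+ k.

(** [D] precedes the driver, the noise and the paths; this is the uniformity in [n] and in the
    sample. The end time [th] stays free in the second half because the path is at first known to
    stay in the box of the grids only up to some time. *)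
Lemma pathwise_stability (n0 : nat) : exists2 D : R, 0 <= D &
  (forall Phi x, young_driver Phi n0%:R -> dyadic_holder x n0%:R ->
     approx_sol Phi (fun _ _ _ => 0) (fun _ => id) x n0%:R ->
     forall k i, dt R k i <= n0%:R -> `|x (dt R k i) - x 0| <= D) /\
  (forall Phi psi net pi x y eps th, 0 <= eps -> eps <= 1 -> th <= n0%:R ->
     young_driver Phi th -> small_noise psi net eps th ->
     rounds_into net pi y th -> approx_sol Phi psi pi y th ->
     approx_sol Phi (fun _ _ _ => 0) (fun _ => id) x th ->
     dyadic_holder x th -> dyadic_holder y th -> x 0 = y 0 ->
     (forall k i, dt R k i.+1 <= th ->
       `|(y (dt R k i.+1) - x (dt R k i.+1)) - (y (dt R k i) - x (dt R k i))|
          <= D * eps * a ^+ k) /\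
     (forall k i, dt R k i <= th -> `|y (dt R k i) - x (dt R k i)| <= D * eps)).
Proof.
have Cq0 : 0 <= Cq by apply: le_trans Cq_ge1.
have [C0 C0E] : exists C0, C0 = 2 * (M + 1 + 4 * Cq) by eexists.
have C00 : 0 <= C0 by rewrite C0E mulr_ge0// !addr_ge0// mulr_ge0.
have [D1 D1E] : exists D1, D1 = (M + 2 * M * C0 * Cq) * A + M * Cq by eexists.
have [D2 D2E] : exists D2, D2 = M + 2 * M * C0 * Cq + (1 + 2 * (C0 + 2) * Cq) by eexists.
have D20 : 0 <= D2 by rewrite D2E !addr_ge0 ?mulr_ge0 ?addr_ge0.
have h2 : 0 < (2^-1 : R) by rewrite invr_gt0.
have [k1 hk1] := exp_small ((M + 2) * Cq) rho.1 rho.2 h2.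
have [k2 hk2] := exp_small D1 rho.1 rho.2 h2.
pose k0 := maxn k1 k2.
have hk01 : (b / a) ^+ k0 * ((M + 2) * Cq) <= 2^-1.
  by rewrite mulrC hk1// leq_maxl.
have hk02 : (b / a) ^+ k0 * D1 <= 2^-1 by rewrite mulrC hk2// leq_maxr.
pose L := (n0 * 2 ^ k0)%N.
have thL : n0%:R = dt R k0 L.
  by rewrite /dt /L natrM natrX mulfK// expf_neq0.
have toBig k i : exists2 k' , (k0 <= k')%N & exists i', dt R k' i' = dt R k i.
  exists (k + k0)%N; first exact: leq_addl.
  by exists (2 ^ k0 * i)%N; rewrite dt_scale.
have [E EE] : exists E, E = (1 + 2 * D2) ^+ L by eexists.
have E0 : 0 <= E by rewrite EE exprn_ge0// addr_ge0// mulr_ge0.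
have [Z ZE] : exists Z, Z = (1 + 2 * D2 * A) * E by eexists.
have Z0 : 0 <= Z by rewrite ZE !mulr_ge0// addr_ge0// !mulr_ge0.
have aV : 1 <= a ^- k0.
  by rewrite -exprVn exprn_ege1// invf_ge1// ltW.
have triv Phi x th : young_driver Phi th -> dyadic_holder x th ->
    approx_sol Phi (fun _ _ _ => 0) (fun _ => id) x th ->
    forall k i, (k0 <= k)%N -> dt R k i.+1 <= th ->
      `|x (dt R k i.+1) - x (dt R k i)| <= C0 * a ^+ k.
  move=> HPhi [S0 S00 HS] Hx; rewrite C0E.
  (* The limit equation is the case of zero noise, with the whole space as net and no rounding. *)
  apply: (@apriori_increments Phi (fun _ _ _ => 0) (fun _ _ => True) (fun _ => id)
    x 0 th k0 S0) => //.
  - by move=> N k i kN it; rewrite /dsum !big1// subrr normr0 !mul0r; split.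
  - by split=> // k i it; split=> //; rewrite subrr normr0 exprn_ge0// ltW.
  - by move=> k i _; exact: HS.
exists (Z * (2 * a ^- k0) + 2 * D2 * E + (1 + C0 * A) * (1 + C0) ^+ L).
  by rewrite !addr_ge0// !mulr_ge0 ?exprn_ge0 ?addr_ge0 ?mulr_ge0// ?(le_trans ler01 aV).
have aV0 : 0 <= a ^- k0 by exact: le_trans aV.
have X0 : 0 <= (1 + C0 * A) * (1 + C0) ^+ L.
  by rewrite mulr_ge0 ?exprn_ge0 ?addr_ge0 ?mulr_ge0.
have Y0 : 0 <= 2 * D2 * E by rewrite !mulr_ge0.
split.
  move=> Phi x HPhi hx Hx k i it.
  have [k' k0k' [i' Ei]] := toBig k i; rewrite -Ei in it *.
  have inc := triv _ _ _ HPhi hx Hx.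
  (* The increments of [x] are at most [C0 * a ^+ k], which fulfils the hypothesis of the iteration
     with [eps = 1]; its conclusion bounds the range of [x]. *)
  have [|_ h] := @diff_iterate (fun t => x t - x 0) 1 n0%:R C0 k0 L ler01 C00
    (subrr _) ltac:(by rewrite thL).
    move=> l z0 hz0 k2' i2 dl it2; rewrite /= subrACA subrr subr0.
    apply: (le_trans (inc _ _ _ it2)); first by case/andP: dl.
    rewrite ler_wpM2r ?exprn_ge0 ?(ltW a0)// ler_peMr// lerDr.
    exact: le_trans hz0.
  have := h _ _ k0k' it; rewrite mulr1 => h'; apply: (le_trans h').
  by rewrite lerDr addr_ge0// !mulr_ge0.
move=> Phi psi net pi x y eps th e0 e1 thn HPhi Hpsi Hpi Hy Hx hx hy xy0.
have incx := triv _ _ _ HPhi hx Hx.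
have incy k i : (k0 <= k)%N -> dt R k i.+1 <= th ->
      `|y (dt R k i.+1) - y (dt R k i)| <= C0 * a ^+ k.
  case: hy => S0 S00 HS; rewrite C0E; move: k i.
  by apply: (@apriori_increments Phi psi net pi y eps th k0 S0) => // k' i' _; exact: HS.
have [||||r1 r2] := @diff_iterate (fun t => y t - x t) eps th (2 * D2) k0 L e0.
- by rewrite mulr_ge0.
- by rewrite xy0 subrr.
- by rewrite -thL.
- move=> l z0 hz0 k i dl it.
  by rewrite /= -(mulrA 2); apply: (increment_diff_le e0 HPhi Hpsi Hpi Hy Hx C00 incx incy hz0 D1E D2E hk02).
have r2' k i : dt R k i <= th -> `|y (dt R k i) - x (dt R k i)| <= Z * eps.
  move=> it; have [k' k0k' [i' Ei]] := toBig k i; rewrite -Ei in it *.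
  by rewrite ZE EE; exact: r2.
split=> k i it; last first.
  apply: (le_trans (r2' _ _ it)); rewrite ler_wpM2r//.
  rewrite -addrA ler_wpDr ?addr_ge0//.
  by rewrite ler_peMr//; move: aV; lra.
(* On levels below [k0] the increment is at most twice the supremum, and [a ^- k0] in the constant
   compensates the factor [a ^+ k]. *)
have [k0k|/ltnW kk0] := leqP k0 k.
  apply: (le_trans (r1 _ _ k0k it)); rewrite -EE.
  rewrite ler_wpM2r ?exprn_ge0 ?(ltW a0)// ler_wpM2r// -addrA addrCA.
  by rewrite lerDl addr_ge0// !mulr_ge0.
have it0 : dt R k i <= th by apply: le_trans it; rewrite le_dt.
apply: (le_trans (ler_normB _ _)).
apply: (le_trans (lerD (r2' _ _ it) (r2' _ _ it0))).
have ak : 1 <= a ^- k0 * a ^+ k.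
  have -> : (1 : R) = a ^- k0 * a ^+ k0 by rewrite mulVf// expf_neq0// gt_eqF.
  by rewrite ler_wpM2l// ler_exp_le1// ltW.
have ZZ : Z * eps + Z * eps <= Z * (2 * a ^- k0) * eps * a ^+ k.
  have -> : Z * (2 * a ^- k0) * eps * a ^+ k
    = (Z * eps + Z * eps) * (a ^- k0 * a ^+ k) by ring.
  by rewrite ler_peMr// addr_ge0// mulr_ge0.
apply: (le_trans ZZ); rewrite ler_wpM2r ?exprn_ge0 ?(ltW a0)// ler_wpM2r//.
by rewrite -addrA lerDl addr_ge0.
Qed.
(** Rounded points are known to lie in the net only for [|v| <= K], so the noise bound is void until
    the path is confined. In the margin [2], one unit pays for the distance [D * eps <= 1] to [x],
    the other for the motion of [y] over one short cell. *)
Lemma pathwise_conclusion (n0 : nat) : exists2 D : R, 0 <= D &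
  forall Phi psi net pi x y eps (K : R), 0 <= eps -> eps <= 1 -> D * eps <= 1 ->
  young_driver Phi n0%:R -> small_noise psi net eps n0%:R ->
  (forall k z, net k z -> net k.+1 z) ->
  (forall k v, `|v| <= K -> net k (pi k v)) ->
  (forall k v, `|pi k v - v| <= a ^+ k) ->
  approx_sol Phi psi pi y n0%:R ->
  approx_sol Phi (fun _ _ _ => 0) (fun _ => id) x n0%:R ->
  dyadic_holder x n0%:R -> dyadic_holder y n0%:R -> x 0 = y 0 ->
  `|x 0| + D + 2 <= K -> ucont y n0%:R ->
  (forall k i, dt R k i.+1 <= n0%:R ->
     `|(y (dt R k i.+1) - x (dt R k i.+1)) - (y (dt R k i) - x (dt R k i))|
        <= D * eps * a ^+ k) /\
  (forall k i, dt R k i <= n0%:R -> `|y (dt R k i) - x (dt R k i)| <= D * eps).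
Proof.
have [D D0 [Hx Hz]] := pathwise_stability n0; exists D => //.
move=> Phi psi net pi x y eps K e0 e1 De HPhi Hpsi nst Hnet Hpi soly solx hx hy
  xy0 hK uc.
have [dl d0 hd] := uc 1 ltr01; have [k1 hk1] := inv2X_le d0.
have hxW th : th <= n0%:R -> forall w, dyadic_holder w n0%:R -> dyadic_holder w th.
  by move=> h w [S0 S00 HS]; exists S0 => // k i it; apply: HS; exact: le_trans h.
have use th : th <= n0%:R ->
    (forall k i, dt R k i <= th -> `|y (dt R k i)| <= K) -> _ :=
  fun h box => Hz Phi psi net pi x y eps th e0 e1 h (young_driverW h HPhi)
    (small_noiseW h Hpsi)
    (conj nst (fun k i it => conj (Hnet k _ (box k i it)) (Hpi k _)))
    (approx_solW h soly) (approx_solW h solx) (hxW _ h _ hx) (hxW _ h _ hy) xy0.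
have bx k i : dt R k i <= n0%:R -> `|x (dt R k i)| <= K - 2.
  move=> it; have := Hx Phi x HPhi hx solx _ _ it => h.
  rewrite -(subrK (x 0) (x _)); apply: (le_trans (ler_normD _ _)).
  by move: h hK; lra.
(* The path cannot leave the box: it moves by at most 1 over a cell of level
   [k1], and up to the start of the cell it is within 1 of [x]. *)
have box p : dt R k1 p <= n0%:R ->
    forall k i, dt R k i <= dt R k1 p -> `|y (dt R k i)| <= K.
  elim: p => [_|p IH pn] k i it.
    have -> : dt R k i = 0.
      by apply/le_anti; rewrite dt_ge0 andbT -(dt0 R k1).
    by rewrite -xy0; move: hK D0; lra.
  have pn' : dt R k1 p <= n0%:R by apply: le_trans pn; rewrite le_dt.
  have {}IH := IH pn'.
  have [le|lt] := leP (dt R k i) (dt R k1 p); first exact: IH.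
  have [_ /(_ k1 p (lexx _)) hz] := use _ pn' IH.
  have hy1 : `|y (dt R k i) - y (dt R k1 p)| <= 1.
    apply: hd; rewrite ?dt_ge0//=; first by exact: le_trans pn.
    rewrite ger0_norm ?subr_ge0 ?(ltW lt)//; have h := hk1 _ (leqnn _).
    by rewrite lerBlDl (le_trans it)// dtS lerD2l.
  have hx1 := bx _ _ pn'.
  rewrite -(subrK (y (dt R k1 p)) (y (dt R k i))).
  apply: (le_trans (ler_normD _ _)).
  have h3 : `|y (dt R k1 p)| <= `|y (dt R k1 p) - x (dt R k1 p)| + `|x (dt R k1 p)|.
    by rewrite -{1}(subrK (x (dt R k1 p)) (y (dt R k1 p))) ler_normD.
  by move: hy1 h3 hz hx1 De; lra.
apply: use => // k i it.
have E : n0%:R = dt R k1 (n0 * 2 ^ k1) by rewrite /dt natrM natrX mulfK// expf_neq0.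
by apply: (box (n0 * 2 ^ k1)%N); rewrite -E.
Qed.

End Pathwise.

(** * Gaussian tails and union bounds *)

Section GaussTail.
Variable R : realType.

Lemma expRN_le_pow (p : nat) (u : R) : (0 < p)%N -> 0 < u ->
  expR (- u) <= (p%:R / u) ^+ p.
Proof.
move=> p0 u0; have pR : 0 < p%:R :> R by rewrite ltr0n.
have h : (u / p%:R) ^+ p <= expR u.
  have -> : expR u = expR (u / p%:R) ^+ p.
    by rewrite -expRM_natr divfK// gt_eqF.
  apply: lerXn2r; rewrite ?nnegrE ?expR_ge0 ?divr_ge0 ?ltW//.
  apply: (le_lt_trans _ (expR_gt1Dx _)); first by rewrite lerDr.
  by rewrite mulf_neq0// ?invr_eq0 gt_eqF.
rewrite expRN -[leRHS]invrK lef_pV2 ?posrE ?expR_gt0 ?invr_gt0 ?exprn_gt0 ?divr_gt0//.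
by rewrite -exprVn invf_div.
Qed.

Lemma measurable_gt_norm (l : R) : measurable [set x : R | l < `|x|].
Proof.
have -> : [set x : R | l < `|x|] = (fun x : R => `|x|) @^-1` `]l, +oo[.
  by apply/seteqP; split=> x /=; rewrite in_itv/= andbT.
by rewrite -[X in measurable X]setTI; exact: normr_measurable.
Qed.

(** Half of the Gaussian exponent is spent on the threshold; the other half is the density of
    doubled variance, whose normalization differs by [sqrt 2]. Integrating then uses total mass one
    and nothing else. *)
Lemma normal_pdf_tail (s l x : R) : 0 < s -> 0 <= l -> l < `|x| ->
  normal_pdf 0 s x <=
    Num.sqrt 2 * expR (- (l ^+ 2 / (4 * s ^+ 2))) * normal_pdf 0 (Num.sqrt 2 * s) x.
Proof.
move=> s0 l0 lx; have q0 : 0 < Num.sqrt 2 :> R by rewrite sqrtr_gt0.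
have sne : s != 0 by rewrite gt_eqF.
have s2 : Num.sqrt 2 * s != 0 by rewrite mulf_neq0 ?gt_eqF.
rewrite !normal_pdfE//= /normal_peak /normal_fun.
rewrite !subr0 exprMn sqr_sqrtr//.
set W := (s ^+ 2 * pi *+ 2); have W0 : 0 < W by rewrite pmulrn_rgt0// mulr_gt0 ?exprn_gt0 ?pi_gt0.
have -> : (2 * s ^+ 2 * pi *+ 2) = 2 * W by rewrite /W; ring.
rewrite sqrtrM//; set E1 := expR (- (l ^+ 2 / _)); set E2 := expR (- x ^+ 2 / (2 * _ *+ 2)).
have -> : Num.sqrt 2 * E1 * ((Num.sqrt 2 * Num.sqrt W)^-1 * E2) = (Num.sqrt W)^-1 * (E1 * E2).
  by field; rewrite !gt_eqF ?sqrtr_gt0.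
rewrite {}/E1 {}/E2.
rewrite ler_wpM2l ?invr_ge0 ?sqrtr_ge0// -expRD ler_expR.
have -> : - x ^+ 2 / (s ^+ 2 *+ 2) = - (x ^+ 2 / (4 * s ^+ 2)) + - x ^+ 2 / (2 * s ^+ 2 *+ 2).
  by field.
rewrite lerD2r lerN2 ler_wpM2r ?invr_ge0 ?mulr_ge0 ?(ltW s0)//.
by rewrite -(real_normK (num_real x)) lerXn2r ?nnegrE ?(ltW lx).
Qed.

(** The exponential is traded for a power of free order [p]. The result is monotone in [v] and
    covers the Dirac case [v = 0], and a large [p] beats counts that grow geometrically with the
    level. *)
Lemma gauss_law_tail (p : nat) (v l : R) : (0 < p)%N -> 0 <= v -> 0 < l ->
  (gauss_law v [set x | (l < `|x|)%R] <= (2 * (4 * p%:R) ^+ p * (v / l ^+ 2) ^+ p)%:E)%E.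
Proof.
move=> p0 v0 l0; rewrite /gauss_law; case: eqP => [->|/eqP vne].
  rewrite diracE mul0r expr0n (negbTE (lt0n_neq0 p0)) mulr0.
  rewrite memNset//=; rewrite normr0; apply/negP; rewrite -leNgt; exact: ltW.
have v1 : 0 < v by rewrite lt_neqAle eq_sym vne.
have s0 : 0 < Num.sqrt v by rewrite sqrtr_gt0.
set s := Num.sqrt v in s0 *.
have ss : s ^+ 2 = v by rewrite sqr_sqrtr.
have mA := measurable_gt_norm l.
set c := Num.sqrt 2 * expR (- (l ^+ 2 / (4 * s ^+ 2))).
have c0 : 0 <= c by rewrite mulr_ge0 ?sqrtr_ge0 ?expR_ge0.
have mpdf u (D : set R) : measurable D -> measurable_fun D (fun x => (normal_pdf 0 u x)%:E).
  by move=> mD; apply/measurable_EFinP; apply: measurable_funTS; exact: measurable_normal_pdf.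
rewrite /normal_prob.
apply: (@le_trans _ _ (\int[lebesgue_measure]_(x in [set x : R | (l < `|x|)%R])
   (c%:E * (normal_pdf 0 (Num.sqrt 2 * s) x)%:E)))%E.
  apply: ge0_le_integral => //=.
  - by move=> x _; rewrite lee_fin normal_pdf_ge0.
  - exact: mpdf.
  - by apply: measurable_funeM; exact: mpdf.
  - move=> x lx; rewrite -EFinM lee_fin; apply: normal_pdf_tail => //; exact: ltW.
rewrite ge0_integralZl//=; [|exact: mpdf|by move=> x _; rewrite lee_fin normal_pdf_ge0].
apply: (@le_trans _ _ (c%:E * 1)%E).
  rewrite lee_wpmul2l ?lee_fin// -[leRHS](integral_normal_pdf 0 (Num.sqrt 2 * s)).
  apply: ge0_subset_integral => //=; first exact: mpdf.
  by move=> x _; rewrite lee_fin normal_pdf_ge0.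
rewrite mule1 lee_fin /c ss -mulrA.
apply: ler_pM; rewrite ?sqrtr_ge0 ?expR_ge0//.
  by rewrite -(@ler_pXn2r _ 2) ?nnegrE ?sqrtr_ge0// sqr_sqrtr// -natrX ler_nat.
have u0 : 0 < l ^+ 2 / (4 * v) by rewrite divr_gt0 ?exprn_gt0 ?mulr_gt0.
apply: (le_trans (expRN_le_pow p0 u0)).
rewrite -exprMn le_eqVlt; apply/orP; left; apply/eqP; congr (_ ^+ _); field.
by rewrite !gt_eqF.
Qed.
End GaussTail.

Section UnionBounds.
Variables (R : realType) (d0 : measure_display) (Omega : measurableType d0).
Variable P : probability Omega R.

Lemma prob_bigcup_geometric (E : nat -> set Omega) (c rho : R) :
  (forall m, measurable (E m)) -> 0 <= c -> 0 <= rho -> rho < 1 ->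
  (forall m, (P (E m) <= (c * rho ^+ m)%:E)%E) ->
  (P (\bigcup_m E m) <= (c * (1 - rho)^-1)%:E)%E.
Proof.
move=> mE c0 r0 r1 H.
have mU : measurable (\bigcup_m E m) by exact: bigcup_measurable.
apply: (le_trans (generalized_Boole_inequality P mE mU)).
apply: lime_le; first exact: is_cvg_nneseries.
apply: nearW => n; apply: (@le_trans _ _ (\sum_(0 <= i < n) (c * rho ^+ i)%:E)%E).
  by apply: lee_sum => i _; exact: H.
rewrite sumEFin lee_fin -mulr_sumr ler_wpM2l// big_mkord.
exact: geometric_partial_le.
Qed.

Lemma prob_setU_le (A B : set Omega) : measurable A -> measurable B ->
  (P (A `|` B) <= P A + P B)%E.
Proof. by move=> mA mB; exact: measureU2. Qed.

Lemma bigcup_fin_measurable (I : finType) (E : I -> set Omega) :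
  (forall i, measurable (E i)) -> measurable (\bigcup_i E i).
Proof. by move=> mE; apply: fin_bigcup_measurable => //; exact: finite_finset. Qed.

Lemma prob_bigcup_fin (I : finType) (E : I -> set Omega) (c : R) :
  (forall i, measurable (E i)) ->
  (forall i, (P (E i) <= c%:E)%E) -> (P (\bigcup_i E i) <= (#|I|%:R * c)%:E)%E.
Proof.
move=> mE H.
suff h (s : seq I) : measurable (\big[setU/set0]_(i <- s) E i) /\
    (P (\big[setU/set0]_(i <- s) E i) <= ((size s)%:R * c)%:E)%E.
  have -> : \bigcup_i E i = \big[setU/set0]_(i <- enum I) E i.
    apply/seteqP; split => w.
      by move=> [i _ Ei]; rewrite -bigcup_seq; exists i => //=; rewrite mem_enum.
    by rewrite -bigcup_seq => -[i _ Ei]; exists i.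
  by rewrite cardE; case: (h (enum I)).
elim: s => [|i s [ms IH]]; first by rewrite big_nil measure0 mul0r; split.
rewrite big_cons; split; first exact: measurableU.
apply: (le_trans (prob_setU_le (mE i) ms)).
by rewrite /= -addn1 natrD mulrDl mul1r addrC EFinD leeD.
Qed.

End UnionBounds.

(** * Gaussian linear combinations of one coordinate of [B] *)

Section FBm.
Variables (R : realType) (d0 : measure_display) (Omega : measurableType d0).
Variables (P : probability Omega R) (H : R) (m : nat) (B : R -> Omega -> 'cV[R]_m).
Hypothesis fB : is_fBm P H B.
Variable c : 'I_m.

Definition lincomb (s : seq (R * R)) (w : Omega) : R :=
  \sum_(u <- s) u.2 * B u.1 w c 0.

Definition linvar (s : seq (R * R)) : R :=
  \sum_(u <- s) \sum_(v <- s) u.2 * v.2 * fbm_cov H u.1 v.1.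

Lemma measurable_lincomb s : measurable_fun setT (lincomb s).
Proof.
have [mB _ _] := fB.
rewrite /lincomb; apply: measurable_sum => u.
by apply: measurable_funM => //; exact: mB.
Qed.

Lemma lincomb_law s A : all (fun u => 0 <= u.1) s -> measurable A ->
  P [set w | lincomb s w \in A] = gauss_law (linvar s) A.
Proof.
move=> hs mA; have [_ _ law] := fB.
have := law [seq (c, u.1, u.2) | u <- s]; rewrite all_map => /(_ hs A mA).
have -> : [set w | \sum_(u <- [seq (c, u.1, u.2) | u <- s]) u.2 * B u.1.2 w u.1.1 0 \in A]
  = [set w | lincomb s w \in A].
  by apply/seteqP; split => w /=; rewrite /lincomb big_map.
move=> ->; congr (gauss_law _ A); rewrite /linvar big_map; apply: eq_bigr => u _.
by rewrite big_map; apply: eq_bigr => v _ /=; rewrite eqxx mulr1.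
Qed.

(* A negative value would make the law [normal_prob 0 0], i.e. uniform on
   [0, 1]; but [X] and [- X] have the same law. *)
Lemma linvar_ge0 s : all (fun u => 0 <= u.1) s -> 0 <= linvar s.
Proof.
move=> hs; rewrite leNgt; apply/negP => v0.
pose s' := [seq (u.1, - u.2) | u <- s].
have hs' : all (fun u => 0 <= u.1) s' by rewrite all_map.
have vE : linvar s' = linvar s.
  rewrite /linvar big_map; apply: eq_bigr => u _; rewrite big_map.
  by apply: eq_bigr => v _ /=; rewrite mulrNN.
have lE w : lincomb s' w = - lincomb s w.
  by rewrite /lincomb big_map -sumrN; apply: eq_bigr => u _ /=; rewrite mulNr.
pose A : set R := `]0, +oo[%classic.
have mA : measurable A by exact: measurable_itv.
have gA : gauss_law (linvar s) A = 1%E.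
  rewrite /gauss_law lt_eqF// ler0_sqrtr ?ltW// /normal_prob /normal_pdf eqxx.
  rewrite integral_indic//.
  have -> : `[0%R, 1%R] `&` A = `]0%R, 1%R]%classic.
    apply/seteqP; split => x; rewrite /A /= !in_itv/= ?andbT.
      by move=> [/andP[_ ->] ->].
    by move=> /andP[x0 x1]; rewrite x1 (ltW x0) x0.
  apply: etrans; first exact: (lebesgue_measure_itv `]0%R, 1%R]).
  by rewrite /= lte_fin ltr01 oppr0 adde0.
have p1 := lincomb_law hs mA; have p2 := lincomb_law hs' mA.
rewrite gA in p1; rewrite vE gA in p2.
have mX (r : seq (R * R)) : measurable [set w | lincomb r w \in A].
  have -> : [set w | lincomb r w \in A] = lincomb r @^-1` A.
    by apply/seteqP; split => w /=; rewrite inE.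
  by rewrite -[X in measurable X]setTI; exact: measurable_lincomb.
have dis : [set w | lincomb s w \in A] `&` [set w | lincomb s' w \in A] = set0.
  apply/seteqP; split => w //=; rewrite !inE /A /= !in_itv/= !andbT lE => -[h1 h2].
  by move: h1 h2; lra.
have := probability_le1 P (measurableU _ _ (mX s) (mX s')).
have -> : (P ([set w | lincomb s w \in A] `|` [set w | lincomb s' w \in A]) =
    P [set w | lincomb s w \in A] + P [set w | lincomb s' w \in A])%E.
  exact: measureU.
by rewrite p1 p2 -EFinD lee_fin; lra.
Qed.

Lemma lincomb_tail_measurable s (l : R) : measurable [set w | l < `|lincomb s w|].
Proof.
have -> : [set w | l < `|lincomb s w|] = lincomb s @^-1` [set x | l < `|x|].
  by [].
by rewrite -[X in measurable X]setTI; apply: measurable_lincomb => //; exact: measurable_gt_norm.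
Qed.

Lemma lincomb_tail (p : nat) s (v l : R) : (0 < p)%N ->
  all (fun u => 0 <= u.1) s -> linvar s <= v -> 0 < l ->
  (P [set w | (l < `|lincomb s w|)%R]
     <= (2 * (4 * p%:R) ^+ p * (v / l ^+ 2) ^+ p)%:E)%E.
Proof.
move=> p0 hs hv l0; have := linvar_ge0 hs => v0.
have -> : [set w | (l < `|lincomb s w|)%R] =
   [set w | lincomb s w \in [set x : R | (l < `|x|)%R]].
  by apply/seteqP; split => w /=; rewrite inE.
rewrite lincomb_law//; last exact: measurable_gt_norm.
apply: (le_trans (gauss_law_tail p0 v0 l0)); rewrite lee_fin.
rewrite ler_wpM2l ?mulr_ge0 ?exprn_ge0 ?mulr_ge0//.
rewrite lerXn2r ?nnegrE ?divr_ge0 ?exprn_ge0 ?(ltW l0)//; first exact: le_trans hv.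
by rewrite ler_wpM2r// invr_ge0 exprn_ge0// ltW.
Qed.

End FBm.

(** * Variance of Haar increments of fractional Brownian motion *)

Section FiniteDifferences.
Variable R : realType.

Fixpoint fdiff (k : nat) (f : R -> R) (x : R) : R :=
  if k is k'.+1 then fdiff k' f (x + 1) - fdiff k' f x else f x.

Lemma is_derive_fdiff k (c x : R) : 0 < x ->
  is_derive x 1 (fdiff k (fun y => y `^ c)) (c * fdiff k (fun y => y `^ (c - 1)) x).
Proof.
elim: k c x => [|k IH] c x x0 /=; first exact: is_derive1_powR.
rewrite mulrBr; apply: is_deriveB; last exact: IH.
have h := IH c (x + 1) ltac:(lra).
have sh := is_derive_shift x 1 (1 : R).
by have := @is_derive1_comp _ _ (shift (1 : R)) _ _ _ h sh; rewrite mulr1.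
Qed.

(* Each difference costs one derivative, by the mean value theorem. *)
Lemma fdiff_powR_sign k (c s x : R) : 0 < x -> 0 <= s * \prod_(i < k) (c - i%:R) ->
  0 <= s * fdiff k (fun y => y `^ c) x.
Proof.
elim: k c s x => [|k IH] c s x x0.
  by rewrite big_ord0 mulr1 /= => s0; rewrite mulr_ge0// powR_ge0.
rewrite big_ord_recl/= subr0 => hs.
have [|||z] := @MVT_segment R (fdiff k (fun y => y `^ c))
   (fun y => c * fdiff k (fun y => y `^ (c - 1)) y) x (x + 1).
- by lra.
- by move=> y; rewrite in_itv/= => /andP[xy _]; apply: is_derive_fdiff; lra.
- apply: derivable_within_continuous => y; rewrite in_itv/= => /andP[xy _].
  by have [] := @is_derive_fdiff k c y ltac:(lra).
rewrite in_itv/= => /andP[xz _] ->; rewrite addrAC subrr add0r mulr1 mulrA.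
apply: IH; first by lra.
rewrite -mulrA; move: hs; congr (0 <= s * (c * _)).
by apply: eq_bigr => i _; rewrite /bump leq0n natrD opprD addrA.
Qed.

Variable c : R.
Hypotheses (c1 : 1 < c) (c2 : c < 2).

Let w (r : R) := `|r| `^ c.
(** For [c = 2 * H], minus half of this fourth central difference is the covariance of two second
    differences of fractional Brownian motion with unit step at distance [r]. *)
Definition cdiff4 (r : R) : R :=
  w (r + 2) - 4 * w (r + 1) + 6 * w r - 4 * w (r - 1) + w (r - 2).

Lemma cdiff4_even r : cdiff4 (- r) = cdiff4 r.
Proof.
rewrite /cdiff4 /w -(normrN (- r + 2)) -(normrN (- r + 1)) -(normrN (- r)).
rewrite -(normrN (- r - 1)) -(normrN (- r - 2)) !opprD !opprK; ring.
Qed.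

Let f3 := fdiff 3 (fun y => y `^ c).

(** The fourth forward difference is nonnegative because [c * (c - 1) * (c - 2) * (c - 3)] is.
    Adding the one based at [x + 1] produces an exact difference of [f3] with step [2], the spacing
    of the second differences. *)
Lemma cdiff4_telescope x : 0 < x -> 0 <= cdiff4 (x + 2) <= f3 (x + 2) - f3 x.
Proof.
move=> x0.
have s4 y : 0 < y -> 0 <= fdiff 4 (fun y => y `^ c) y.
  move=> y0; rewrite -[leRHS]mul1r; apply: fdiff_powR_sign => //.
  rewrite !big_ord_recl big_ord0 /bump/=.
  have -> : 1 * ((c - 0) * ((c - 1) * ((c - 2) * ((c - 3) * 1)))) =
    c * (c - 1) * ((2 - c) * (3 - c)) by ring.
  by rewrite !mulr_ge0//; move: c1 c2; lra.
have E : cdiff4 (x + 2) = fdiff 4 (fun y => y `^ c) x.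
  rewrite /cdiff4 /w /=.
  rewrite (_ : x + 2 + 2 = x + 1 + 1 + 1 + 1); last by ring.
  rewrite (_ : x + 2 + 1 = x + 1 + 1 + 1); last by ring.
  rewrite (_ : x + 2 - 1 = x + 1); last by ring.
  rewrite (_ : x + 2 - 2 = x); last by ring.
  rewrite (_ : x + 2 = x + 1 + 1); last by ring.
  have p0 := ltW x0; have p1 : 0 <= x + 1 by lra.
  have p2 : 0 <= x + 1 + 1 by lra.
  have p3 : 0 <= x + 1 + 1 + 1 by lra.
  have p4 : 0 <= x + 1 + 1 + 1 + 1 by lra.
  by rewrite !ger0_norm//; ring.
rewrite E s4//=.
have := s4 (x + 1) ltac:(lra); rewrite /f3 /=.
rewrite (_ : x + 2 = x + 1 + 1); last by ring.
by lra.
Qed.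

Lemma f3_le0 x : 0 < x -> f3 x <= 0.
Proof.
move=> x0; rewrite -oppr_ge0 -mulN1r; apply: fdiff_powR_sign => //.
rewrite !big_ord_recl big_ord0 /bump/= mulr1 subr0.
have -> : -1 * (c * ((c - 1) * (c - 2))) = c * ((c - 1) * (2 - c)) by ring.
by rewrite !mulr_ge0//; move: c1 c2; lra.
Qed.

(** The terms telescope and [f3 <= 0] disposes of the far end, so no decay rate of [cdiff4] is
    estimated. The values at [0] and [2] stand apart because the telescoping starts from a positive
    argument. *)
Lemma cdiff4_summable : exists2 C : R, 0 <= C &
  forall n, \sum_(i < n) `|cdiff4 (i.*2)%:R| <= C.
Proof.
exists (`|cdiff4 0| + `|cdiff4 2| - f3 2).
  by have := @f3_le0 2 ltac:(lra); have := normr_ge0 (cdiff4 0);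
     have := normr_ge0 (cdiff4 2); lra.
have H n : \sum_(i < n.+2) `|cdiff4 (i.*2)%:R| <=
    `|cdiff4 0| + `|cdiff4 2| - f3 2 + f3 (n.+1.*2)%:R.
  elim: n => [|n IH].
    by rewrite !big_ord_recl big_ord0 /= addr0 subrK.
  rewrite big_ord_recr/=.
  have x0 : 0 < (n.+1.*2)%:R :> R by rewrite ltr0n.
  have E k : (k.+1.*2)%:R = (k.*2)%:R + 2 :> R by rewrite doubleS -addn2 natrD.
  have /andP[h1 h2] := cdiff4_telescope x0.
  rewrite (E n.+1) ger0_norm//; move: IH h2.
  by lra.
move=> n; apply: (@le_trans _ _ (\sum_(i < n.+2) `|cdiff4 (i.*2)%:R|)).
  by rewrite !big_ord_recr/= -addrA lerDl addr_ge0.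
apply: (le_trans (H n)); have := @f3_le0 (n.+1.*2)%:R; rewrite ltr0n => /(_ isT).
lra.
Qed.

Lemma cdiff4_row_sum : exists2 C : R, 0 <= C & forall p r j, (p <= j < r)%N ->
  \sum_(p <= l < r) `|cdiff4 ((j.*2)%:R - (l.*2)%:R)| <= C.
Proof.
have [C C0 H] := cdiff4_summable; exists (2 * C); first by rewrite mulr_ge0.
move=> p r j /andP[pj jr]; rewrite (big_cat_nat (n := j))//=; last exact: ltnW.
rewrite mulr_natl mulr2n; apply: lerD.
  rewrite big_nat_rev/=.
  apply: (le_trans _ (H (j - p).+1)).
  rewrite big_ord_recl/= -[leLHS]add0r lerD// -(big_mkord xpredT
    (fun i => `|cdiff4 (bump 0 i).*2%:R|)) -{1}(add0n p) big_addn.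
  apply: ler_sum_nat => i /andP[_ hi]; rewrite /bump/= add1n.
  rewrite le_eqVlt; apply/orP; left; apply/eqP; congr (`|cdiff4 _|).
  apply/eqP; rewrite subr_eq -natrD; apply/eqP; congr (_%:R).
  by move: pj hi; clear; lia.
apply: (le_trans _ (H (r - j)%N)).
rewrite -(big_mkord xpredT (fun i => `|cdiff4 i.*2%:R|)) -{1}(add0n j) big_addn.
apply: ler_sum_nat => i _; rewrite -cdiff4_even opprB.
rewrite le_eqVlt; apply/orP; left; apply/eqP; congr (`|cdiff4 _|).
by apply/eqP; rewrite subr_eq -natrD; apply/eqP; congr (_%:R); clear; lia.
Qed.

End FiniteDifferences.

Section HaarVariance.
Variables (R : realType) (H : R).
Hypotheses (H1 : 1 / 2 < H) (H2 : H < 1).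

(** Up to sign, [a j] times the second difference of [B] over cell [j] of level [N]: the change in a
    Riemann sum when that cell is halved. *)
Definition haar_block (N : nat) (a : nat -> R) (j : nat) : seq (R * R) :=
  [:: (dt R N.+1 j.*2, - a j); (dt R N.+1 j.*2.+1, 2 * a j);
      (dt R N.+1 j.*2.+2, - a j)].

Definition haar_seq (N p r : nat) (a : nat -> R) : seq (R * R) :=
  flatten [seq haar_block N a j | j <- index_iota p r].

Lemma haar_seq_ge0 N p r a : all (fun u => 0 <= u.1) (haar_seq N p r a).
Proof.
apply/allP => u /flatten_mapP[j _]; rewrite !inE.
by case/or3P => /eqP -> /=; exact: dt_ge0.
Qed.

Lemma dist_dt_powR N i j : `|dt R N i - dt R N j| `^ (2 * H) =
  (2 ^+ N)^-1 `^ (2 * H) * `|j%:R - i%:R| `^ (2 * H).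
Proof.
rewrite distrC /dt -mulrBl normrM (ger0_norm (_ : 0 <= (2 ^+ N)^-1)); last first.
  by rewrite invr_ge0 exprn_ge0.
by rewrite powRM ?invr_ge0 ?exprn_ge0// mulrC.
Qed.

Lemma haar_cov N a j l :
  \sum_(u <- haar_block N a j) \sum_(v <- haar_block N a l)
    u.2 * v.2 * fbm_cov H u.1 v.1 =
  - (a j * a l * (2 ^+ N.+1)^-1 `^ (2 * H)
     * cdiff4 (2 * H) ((j.*2)%:R - (l.*2)%:R) / 2).
Proof.
rewrite /haar_block !big_cons !big_nil /= /fbm_cov.
rewrite !dist_dt_powR /cdiff4.
set X := (j.*2)%:R; set Y := (l.*2)%:R.
have eX1 : (j.*2.+1)%:R = X + 1 :> R by rewrite -natr1.
have eX2 : (j.*2.+2)%:R = X + 2 :> R by rewrite -addn2 natrD.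
have eY1 : (l.*2.+1)%:R = Y + 1 :> R by rewrite -natr1.
have eY2 : (l.*2.+2)%:R = Y + 2 :> R by rewrite -addn2 natrD.
rewrite eX1 eX2 eY1 eY2.
rewrite (_ : X + 1 - (Y + 1) = X - Y); last by ring.
rewrite (_ : X + 2 - (Y + 2) = X - Y); last by ring.
rewrite (_ : X - (Y + 1) = X - Y - 1); last by ring.
rewrite (_ : X - (Y + 2) = X - Y - 2); last by ring.
rewrite (_ : X + 1 - Y = X - Y + 1); last by ring.
rewrite (_ : X + 2 - Y = X - Y + 2); last by ring.
rewrite (_ : X + 1 - (Y + 2) = X - Y - 1); last by ring.
rewrite (_ : X + 2 - (Y + 1) = X - Y + 1); last by ring.
move: (`|X - Y| `^ _) (`|X - Y + 1| `^ _) (`|X - Y + 2| `^ _) => w0 w1 w2.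
move: (`|X - Y - 1| `^ _) (`|X - Y - 2| `^ _) => w3 w4.
move: (dt R N.+1 j.*2 `^ _) (dt R N.+1 j.*2.+1 `^ _) (dt R N.+1 j.*2.+2 `^ _) => x0 x1 x2.
move: (dt R N.+1 l.*2 `^ _) (dt R N.+1 l.*2.+1 `^ _) (dt R N.+1 l.*2.+2 `^ _) => y0 y1 y2.
move: ((2 ^+ N.+1)^-1 `^ _) => h.
by field.
Qed.

(** The absolute row sums of the covariance matrix are bounded, so the variance grows like the
    number of blocks and not like its square. *)
Lemma haar_linvar_le : exists2 C : R, 0 <= C & forall N p r a (amax : R),
  (p <= r)%N -> 0 <= amax -> (forall j, (p <= j < r)%N -> `|a j| <= amax) ->
  linvar H (haar_seq N p r a) <=
    C * amax ^+ 2 * (2 ^+ N.+1)^-1 `^ (2 * H) * (r - p)%:R.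
Proof.
have c1 : 1 < 2 * H by move: H1; lra.
have c2 : 2 * H < 2 by move: H2; lra.
have [C C0 row] := cdiff4_row_sum c1 c2; exists C => // N p r a amax pr am0 Ha.
set h := (2 ^+ N.+1)^-1 `^ _; have h0 : 0 <= h by exact: powR_ge0.
have -> : linvar H (haar_seq N p r a) =
  \sum_(p <= j < r) \sum_(p <= l < r)
    - (a j * a l * h * cdiff4 (2 * H) ((j.*2)%:R - (l.*2)%:R) / 2).
  rewrite /linvar /haar_seq big_flatten big_map; apply: eq_bigr => j _.
  under eq_bigr do rewrite big_flatten big_map.
  by rewrite exchange_big; apply: eq_bigr => l _; exact: haar_cov.
apply: (@le_trans _ _ (\sum_(p <= j < r) (C * amax ^+ 2 * h))); last first.
  by rewrite sumr_const_nat mulr_natr.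
apply: ler_sum_nat => j hj.
apply: (@le_trans _ _ (\sum_(p <= l < r) (amax ^+ 2 * h *
     `|cdiff4 (2 * H) ((j.*2)%:R - (l.*2)%:R)|))).
  apply: ler_sum_nat => l hl; apply: (le_trans (ler_norm _)).
  rewrite normrN !normrM (ger0_norm h0) expr2.
  rewrite (ger0_norm (_ : 0 <= 2^-1)) ?invr_ge0//.
  apply: (@le_trans _ _ (`|a j| * `|a l| * h *
     `|cdiff4 (2 * H) ((j.*2)%:R - (l.*2)%:R)|)).
    rewrite ler_piMr ?mulr_ge0//; lra.
  rewrite ler_wpM2r// ler_wpM2r// ler_pM// ?Ha//.
rewrite -mulr_sumr; apply: (@le_trans _ _ (amax ^+ 2 * h * C)).
  by rewrite ler_wpM2l ?mulr_ge0 ?exprn_ge0// row.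
by rewrite mulrC mulrA.
Qed.

End HaarVariance.

(** * Riemann sums of Wiener integrals, all levels at once *)

Section RiemannSumEvent.
Variables (R : realType) (d0 : measure_display) (Omega : measurableType d0).
Variables (P : probability Omega R) (H : R) (m : nat) (B : R -> Omega -> 'cV[R]_m).
Hypotheses (H1 : 1 / 2 < H) (H2 : H < 1).
Hypothesis fB : is_fBm P H B.
Variables (tau theta : R).
Hypotheses (tau0 : 0 < tau) (thetaE : theta = 2 * tau * 2 `^ (- H)).
Hypotheses (theta1 : theta < 1) (theta2 : 2 * theta ^+ 2 < 1).

Let etaH : R := 2 `^ (- H).
Let eta0 : 0 < etaH. Proof. by rewrite powR_gt0. Qed.
Let theta0 : 0 < theta. Proof. by rewrite thetaE !mulr_gt0. Qed.

(** A Riemann sum for the Wiener integral of the derivative of [G] against one coordinate of [B].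
    The integrand is averaged over each cell, so that only the primitive [G] enters. *)
Definition rsum (c : 'I_m) (G : R -> R) (N k i : nat) (w : Omega) : R :=
  dsum N k i (fun j => (G (dt R N j.+1) - G (dt R N j)) * 2 ^+ N
                       * (B (dt R N j.+1) w c 0 - B (dt R N j) w c 0)).

Lemma scale_powR N : (2 ^+ N)^-1 `^ (2 * H) = (etaH ^+ 2) ^+ N.
Proof.
rewrite /etaH -exprM -powR_mulrn ?powR_ge0// -powRrM natrM.
rewrite -powR_inv1 ?exprn_ge0// -powRrM -powR_mulrn// -powRrM.
by congr (_ `^ _); ring.
Qed.

(** The slope on a cell is the mean of the slopes on its halves. What remains is half the difference
    of these two, a second difference of [G], times a second difference of [B]. *)
Lemma rsum_step c (G : R -> R) N k i w : (k <= N)%N ->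
  rsum c G N.+1 k i w - rsum c G N k i w =
  lincomb B c (haar_seq N (2 ^ (N - k) * i) (2 ^ (N - k) * i.+1)
    (fun j => (2 * G (dt R N.+1 j.*2.+1) - G (dt R N.+1 j.*2)
                 - G (dt R N.+1 j.*2.+2)) * 2 ^+ N)) w.
Proof.
move=> kN; rewrite /rsum dsum_refine// -dsumB /lincomb /haar_seq big_flatten big_map.
apply: eq_bigr => j _; rewrite /haar_block !big_cons big_nil /=.
have -> : dt R N j = dt R N.+1 j.*2 by rewrite dt_double.
have -> : dt R N j.+1 = dt R N.+1 j.*2.+2 by rewrite -doubleS dt_double.
rewrite exprS.
move: (G _) (G _) (G _) (B _ w c 0) (B _ w c 0) (B _ w c 0) (2 ^+ N) => g0 g1 g2 x0 x1 x2 e.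
by ring.
Qed.


Lemma rsum_base c (G : R -> R) k i w :
  rsum c G k k i w = lincomb B c
    [:: (dt R k i.+1, (G (dt R k i.+1) - G (dt R k i)) * 2 ^+ k);
        (dt R k i, - ((G (dt R k i.+1) - G (dt R k i)) * 2 ^+ k))] w.
Proof. by rewrite /rsum dsum_id /lincomb !big_cons big_nil /=; ring. Qed.

Lemma increment_linvar (t s x : R) :
  linvar H [:: (t, x); (s, - x)] = x ^+ 2 * `|t - s| `^ (2 * H).
Proof.
have Hne : 2 * H != 0 by move: H1; lra.
rewrite /linvar !big_cons !big_nil /= /fbm_cov !subrr !normr0 !powR0// (distrC s t).
by field.
Qed.

Let expM2 n : (2 * tau) ^+ n * etaH ^+ n = theta ^+ n.
Proof. by rewrite -exprMn thetaE. Qed.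

(** The term of level [k] has standard deviation at most [L * theta ^+ k]. The correction of level
    [k + n] has variance smaller by the factor [(2 * theta ^+ 2) ^+ n], up to a constant: there are
    [2 ^ n] blocks, each contributing two powers of [theta] per level. A geometric union bound over
    [n] then controls all [N] by one event. *)
Lemma rsum_event (p : nat) : (0 < p)%N -> exists2 Cst : R, 0 <= Cst &
  forall (c : 'I_m) (G : R -> R) k i (L l : R), 0 <= L -> 0 < l ->
  (forall N j, descendant k i N j ->
     `|G (dt R N j.+1) - G (dt R N j)| <= L * tau ^+ N) ->
  exists E : set Omega, [/\ measurable E,
    (P E <= (Cst * ((L * theta ^+ k / l) ^+ 2) ^+ p)%:E)%E &
    forall w, ~ E w -> forall N, (k <= N)%N -> `|rsum c G N k i w| <= l].
Proof.
move=> p0; have [C C0 HC] := haar_linvar_le H1 H2.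
pose r0 := 2 * theta ^+ 2.
have r00 : 0 < r0 by rewrite mulr_gt0// exprn_gt0.
(* With [s] the fourth root of [r0] the thresholds shrink like [s ^+ n], and the ratio of variance
   to squared threshold still decays like [(s ^+ 2) ^+ n]. *)
have [s [s0 s1 s4]] : exists s : R, [/\ 0 < s, s < 1 & r0 = s ^+ 2 * s ^+ 2].
  exists (Num.sqrt (Num.sqrt r0)); split; first by rewrite !sqrtr_gt0.
    by rewrite -sqrtr1 ltr_sqrt// -sqrtr1 ltr_sqrt.
  by rewrite sqr_sqrtr ?sqrtr_ge0// -expr2 sqr_sqrtr// ltW.
(* The thresholds [l * c0 * s ^+ n] then add up to [l / 2]; the base term has the other half. *)
have [c0 c0E] : exists c0, c0 = (1 - s) / 2 by eexists.
have c00 : 0 < c0 by rewrite c0E; lra.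
pose Kp : R := 2 * (4 * p%:R) ^+ p.
have Kp0 : 0 <= Kp by rewrite mulr_ge0// exprn_ge0// mulr_ge0.
exists (Kp * 4 ^+ p + Kp * (C / c0 ^+ 2) ^+ p * (1 - s ^+ 2)^-1).
  rewrite addr_ge0 ?mulr_ge0 ?exprn_ge0 ?divr_ge0 ?exprn_ge0 ?(ltW c00)//.
  by rewrite invr_ge0 subr_ge0 exprn_ile1// ltW.
move=> c G k i L l L0 l0 HG.
pose Q := (L * theta ^+ k / l) ^+ 2.
have Q0 : 0 <= Q by rewrite exprn_even_ge0.
pose s0q := [:: (dt R k i.+1, (G (dt R k i.+1) - G (dt R k i)) * 2 ^+ k);
        (dt R k i, - ((G (dt R k i.+1) - G (dt R k i)) * 2 ^+ k))].
pose sq n := haar_seq (k + n) (2 ^ (k + n - k) * i) (2 ^ (k + n - k) * i.+1)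
    (fun j => (2 * G (dt R (k + n).+1 j.*2.+1) - G (dt R (k + n).+1 j.*2)
                 - G (dt R (k + n).+1 j.*2.+2)) * 2 ^+ (k + n)).
pose E0 := [set w | l / 2 < `|lincomb B c s0q w|].
pose En n := [set w | l * c0 * s ^+ n < `|lincomb B c (sq n) w|].
have mE0 : measurable E0 by exact: (lincomb_tail_measurable fB).
have mEn n : measurable (En n) by exact: (lincomb_tail_measurable fB).
exists (E0 `|` \bigcup_n En n); split.
- by apply: measurableU => //; exact: bigcup_measurable.
- apply: (le_trans (prob_setU_le P mE0 (bigcup_measurable (fun n _ => mEn n)))).
  rewrite mulrDl EFinD; apply: leeD.
    have v0 : linvar H s0q <= L ^+ 2 * (theta ^+ k) ^+ 2.
      rewrite increment_linvar dist_dt_powR scale_powR -(natr1 i) opprD addrA subrr sub0r.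
      rewrite normrN1 powR1 mulr1.
      have dk : descendant k i k i by rewrite /descendant leqnn subnn !mul1n leqnn/=.
      have x1 : `|(G (dt R k i.+1) - G (dt R k i)) * 2 ^+ k| <= L * (2 * tau) ^+ k.
        rewrite normrM (ger0_norm (exprn_ge0 k (ler0n _ 2))) mulrC exprMn mulrCA.
        by rewrite ler_wpM2l ?exprn_ge0// HG.
      apply: (@le_trans _ _ ((L * (2 * tau) ^+ k) ^+ 2 * (etaH ^+ 2) ^+ k)).
        rewrite ler_wpM2r ?exprn_ge0 ?(ltW eta0)//.
        rewrite -(real_normK (num_real (_ * _))) lerXn2r ?nnegrE//.
        by rewrite mulr_ge0// exprn_ge0// mulr_ge0// ltW.
      by rewrite -expM2 -exprM mulnC exprM; rewrite le_eqVlt; apply/orP; left; apply/eqP; ring.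
    have l2 : 0 < l / 2 by lra.
    have hs : all (fun u => 0 <= u.1) s0q by rewrite /= !dt_ge0.
    apply: (le_trans (lincomb_tail fB c p0 hs v0 l2)).
    have -> : L ^+ 2 * (theta ^+ k) ^+ 2 / (l / 2) ^+ 2 = 4 * Q.
      by rewrite /Q; field; rewrite gt_eqF.
    by rewrite lee_fin -/Kp (exprMn p 4) mulrA.
  have HEn n : (P (En n) <= (Kp * (C / c0 ^+ 2) ^+ p * Q ^+ p * (s ^+ 2) ^+ n)%:E)%E.
    set N := (k + n)%N.
    have am0 : 0 <= L * (2 * tau) ^+ N.+1.
      by rewrite mulr_ge0// exprn_ge0// mulr_ge0// ltW.
    have vn : linvar H (sq n) <= C * L ^+ 2 * (theta ^+ k) ^+ 2 * r0 ^+ n.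
      have pr : (2 ^ (N - k) * i <= 2 ^ (N - k) * i.+1)%N by rewrite leq_mul2l leqnSn orbT.
      apply: (le_trans (HC N _ _ _ _ pr am0 _)).
        move=> j hj.
        have dj : descendant k i N j by rewrite /descendant leq_addr.
        have [d1 d2] := descendant_child dj.
        have g1 := HG _ _ d1; have g2 := HG _ _ d2.
        rewrite normrM (ger0_norm (exprn_ge0 N (ler0n _ 2))).
        apply: (@le_trans _ _ ((L * tau ^+ N.+1 + L * tau ^+ N.+1) * 2 ^+ N)).
          rewrite ler_wpM2r ?exprn_ge0//.
          have -> : forall x y z : R, 2 * x - y - z = (x - y) - (z - x) by move=> *; ring.
          by apply: (le_trans (ler_normB _ _)); exact: lerD.
        by rewrite exprMn (exprS 2 N) le_eqVlt; apply/orP; left; apply/eqP; ring.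
      rewrite scale_powR mulnS addnK addKn natrX.
      have -> : C * (L * (2 * tau) ^+ N.+1) ^+ 2 * (etaH ^+ 2) ^+ N.+1 * 2 ^+ n =
         C * L ^+ 2 * (theta ^+ N.+1) ^+ 2 * 2 ^+ n.
        by rewrite -expM2 -(exprM etaH) mulnC exprM; ring.
      have -> : C * L ^+ 2 * (theta ^+ k) ^+ 2 * r0 ^+ n =
         C * L ^+ 2 * (theta ^+ N) ^+ 2 * 2 ^+ n.
        rewrite /r0 /N exprMn exprD -(exprM theta 2 n) mulnC exprM; ring.
      rewrite ler_wpM2r ?exprn_ge0// ler_wpM2l ?mulr_ge0 ?exprn_ge0//.
      rewrite lerXn2r ?nnegrE ?exprn_ge0 ?(ltW theta0)//.
      by apply: ler_exp_le1 => //; exact: ltW.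
    have ln : 0 < l * c0 * s ^+ n by rewrite !mulr_gt0// exprn_gt0.
    have hs := haar_seq_ge0 N (2 ^ (N - k) * i) (2 ^ (N - k) * i.+1)
      (fun j => (2 * G (dt R N.+1 j.*2.+1) - G (dt R N.+1 j.*2)
                 - G (dt R N.+1 j.*2.+2)) * 2 ^+ N).
    apply: (le_trans (lincomb_tail fB c p0 hs vn ln)).
    rewrite lee_fin -/Kp.
    have -> : C * L ^+ 2 * (theta ^+ k) ^+ 2 * r0 ^+ n / (l * c0 * s ^+ n) ^+ 2 =
       C / c0 ^+ 2 * Q * (s ^+ 2) ^+ n.
      rewrite s4 exprMn /Q -(exprM s 2 n) mulnC exprM.
      by field; rewrite expf_neq0 ?gt_eqF.
    have X0 : 0 <= C / c0 ^+ 2 by rewrite divr_ge0// exprn_ge0// ltW.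
    rewrite -!(mulrA Kp) ler_wpM2l// exprMn (exprMn p (C / _)).
    rewrite ler_wpM2l ?mulr_ge0 ?(exprn_ge0 p X0) ?(exprn_ge0 p Q0)//.
    have sn0 : 0 <= (s ^+ 2) ^+ n by rewrite !exprn_ge0// ltW.
    have sn1 : (s ^+ 2) ^+ n <= 1 by rewrite !exprn_ile1 ?exprn_ge0 ?ltW// exprn_ile1 ?ltW.
    by apply: (le_trans (ler_exp_le1 sn0 sn1 p0)); rewrite expr1.
  have sq1 : s ^+ 2 < 1 by rewrite exprn_ilt1// ltW.
  have W0 : 0 <= Kp * (C / c0 ^+ 2) ^+ p * Q ^+ p.
    have X0 : 0 <= C / c0 ^+ 2 by rewrite divr_ge0// exprn_ge0// ltW.
    by rewrite !mulr_ge0// ?(exprn_ge0 p X0) ?(exprn_ge0 p Q0).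
  have sq0 : 0 <= s ^+ 2 by rewrite exprn_ge0// ltW.
  apply: (le_trans (prob_bigcup_geometric mEn W0 sq0 sq1 HEn)).
  by rewrite lee_fin mulrAC.
move=> w nE.
have n0 : `|rsum c G k k i w| <= l / 2.
  by rewrite rsum_base leNgt; apply/negP => h; apply: nE; left.
have nn n : `|rsum c G (k + n).+1 k i w - rsum c G (k + n) k i w| <= l * c0 * s ^+ n.
  rewrite rsum_step ?leq_addr// leNgt; apply/negP => h; apply: nE; right.
  by exists n.
have Hn n : `|rsum c G (k + n) k i w| <= l / 2 + l * c0 * \sum_(j < n) s ^+ j.
  elim: n => [|n IH]; first by rewrite addn0 big_ord0 mulr0 addr0.
  rewrite big_ord_recr/= mulrDr addrA addnS.
  rewrite -(subrK (rsum c G (k + n) k i w) (rsum c G (k + n).+1 k i w)) addrC.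
  by apply: (le_trans (ler_normD _ _)); exact: lerD.
move=> N kN; rewrite -(subnKC kN); apply: (le_trans (Hn _)).
have g := @geometric_partial_le R s (N - k) (ltW s0) s1.
have lc : 0 <= l * c0 by rewrite mulr_ge0// ltW.
have := ler_wpM2l lc g; rewrite {2}c0E.
have -> : l * ((1 - s) / 2) * (1 - s)^-1 = l / 2.
  by field; move: s1; lra.
lra.
Qed.

End RiemannSumEvent.

(** * Functions of class BC2 and primitives in time *)

Section MatrixNorm.
Variable R : realType.

Lemma mx_entry_le (p r : nat) (A : 'M[R]_(p, r)) i j : `|A i j| <= `|A|.
Proof.
rewrite [leRHS](_ : _ = mx_norm A)// mx_normrE.
exact: (le_bigmax 0 (fun ij : 'I_p * 'I_r => `|A ij.1 ij.2|) (i, j)).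
Qed.

Lemma mx_norm_leP (p r : nat) (A : 'M[R]_(p, r)) (c : R) : 0 <= c ->
  (forall i j, `|A i j| <= c) -> `|A| <= c.
Proof.
move=> c0 H; rewrite [leLHS](_ : _ = mx_norm A)// mx_normrE.
by apply: bigmax_le => // -[i j] _; exact: H.
Qed.

Lemma mulmx_norm_le (p r s : nat) (A : 'M[R]_(p, r)) (v : 'M[R]_(r, s)) :
  `|A *m v| <= r%:R * `|A| * `|v|.
Proof.
apply: mx_norm_leP => [|i j]; first by rewrite !mulr_ge0.
rewrite mxE; apply: (le_trans (ler_norm_sum _ _ _)).
apply: (@le_trans _ _ (\sum_(k < r) `|A| * `|v|)).
  by apply: ler_sum => k _; rewrite normrM ler_pM// mx_entry_le.
by rewrite sumr_const card_ord -[leLHS]mulr_natl mulrA.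
Qed.

Lemma entryZ (p r : nat) a (A : 'M[R]_(p, r)) i j : (a *: A) i j = a * A i j.
Proof. by rewrite mxE. Qed.

Lemma entryB (p r : nat) (A C : 'M[R]_(p, r)) i j : (A - C) i j = A i j - C i j.
Proof. by rewrite !mxE. Qed.

Lemma norm_mx0row (r : nat) (A : 'M[R]_(0, r)) : `|A| = 0.
Proof. by rewrite (flatmx0 A) normr0. Qed.

End MatrixNorm.

Section BC2.
Variable R : realType.

Lemma derive_partials (d p r : nat) (h : 'cV[R]_d -> 'M[R]_(p, r)) x v :
  differentiable h x ->
  derive h x v = \sum_(l < d) v l 0 *: derive h x (pdir R l).
Proof.
move=> dh; rewrite deriveE// {1}(matrix_sum_delta v) linear_sum.
apply: eq_bigr => l _; rewrite big_ord1 linearZ/= deriveE//.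
Qed.

Lemma is_derive_line (d p r : nat) (h : 'cV[R]_d -> 'M[R]_(p, r)) x v (s : R) i j :
  differentiable h (x + s *: v) ->
  is_derive s 1 (fun s => h (x + s *: v) i j) (derive h (x + s *: v) v i j).
Proof.
move=> dh.
have dv : derivable h (x + s *: v) v by exact: diff_derivable.
have cv := continuous_cvg _ (@coord_continuous R p r i j _) dv.
set Q := fun t : R => t^-1 *: (((fun s => h (x + s *: v) i j) \o shift s) (t *: 1)
   - h (x + s *: v) i j).
have QE : Q = (fun M : 'M[R]_(p, r) => M i j) \o
   (fun t : R => t^-1 *: ((h \o shift (x + s *: v)) (t *: v) - h (x + s *: v))).
  apply/funext => t; rewrite /Q /= !mxE; congr (_ * (h _ i j - _)).
  by rewrite [t *: 1]mulr1 scalerDl addrCA.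
have cQ : Q t @[t --> 0^'] --> derive h (x + s *: v) v i j.
  by rewrite QE; exact: cv.
by split; [exact: cvgP cQ | exact: cvg_lim cQ].
Qed.

(** The mean value theorem is applied to the difference along the two segments, so both derivatives
    are taken at the same parameter [s]; this is what a four-point estimate requires. The theorem is
    scalar, hence the entry [i j]. *)
Lemma line_mean_value (d p r : nat) (h : 'cV[R]_d -> 'M[R]_(p, r)) x v x' v' i j :
  (forall x, differentiable h x) ->
  exists2 s : R, 0 <= s <= 1 &
    h (x + v) i j - h (x' + v') i j - (h x i j - h x' i j) =
    \sum_(l < d) (v l 0 * derive h (x + s *: v) (pdir R l) i j
                  - v' l 0 * derive h (x' + s *: v') (pdir R l) i j).
Proof.
move=> dh.
pose f s := h (x + s *: v) i j - h (x' + s *: v') i j.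
pose df s := derive h (x + s *: v) v i j - derive h (x' + s *: v') v' i j.
have fd (s : R) : is_derive s 1 f (df s).
  by apply: is_deriveB; exact: is_derive_line.
have [|s] := @MVT_segment R f df 0 1 ler01 (fun s _ => fd s).
  by apply: derivable_within_continuous => s _; have [] := fd s.
rewrite in_itv/= => s01; rewrite /f /df !scale1r !scale0r !addr0 subr0 mulr1 => E.
exists s => //; rewrite E.
rewrite (derive_partials v (dh _)) (derive_partials v' (dh _)) !summxE -sumrB.
by apply: eq_bigr => l _; congr (_ - _); exact: entryZ.
Qed.

Lemma lipschitz_of_partials (d p r : nat) (h : 'cV[R]_d -> 'M[R]_(p, r)) (C : R) :
  0 <= C -> (forall x, differentiable h x) ->
  (forall l x, `|derive h x (pdir R l)| <= C) ->
  forall x y, `|h y - h x| <= d%:R * C * `|y - x|.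
Proof.
move=> C0 dh H x y; apply: mx_norm_leP => [|i j]; first by rewrite !mulr_ge0.
have [s _] := line_mean_value x (y - x) 0 0 i j dh.
rewrite addr0 subrKC; have -> : forall a b c : R, a - b - (c - b) = a - c.
  by move=> a b c; ring.
rewrite !mxE => ->; apply: (le_trans (ler_norm_sum _ _ _)).
apply: (@le_trans _ _ (\sum_(l < d) C * `|y - x|)).
  apply: ler_sum => l _; rewrite [X in _ - X * _]mxE mul0r subr0 normrM mulrC.
  by rewrite ler_pM ?mx_entry_le// (le_trans (mx_entry_le _ _ _)).
by rewrite sumr_const card_ord -[leLHS]mulr_natl mulrA.
Qed.

Lemma isBC2_bounds (d k : nat) (h : 'cV[R]_d -> 'M[R]_(d, k)) : isBC2 h ->
  exists2 L : R, 0 <= L & [/\ forall x, `|h x| <= L,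
    forall x y, `|h x - h y| <= L * `|x - y| &
    forall v w v' w', `|h v' - h w' - (h v - h w)| <=
      L * (`|v' - w' - (v - w)| + `|v - w| * (`|v' - v| + `|w' - w|))].
Proof.
move=> [dh [dh2 [_ [C0 HC]]]].
(* For [d = 0] the bounds of [isBC2], quantified over coordinate directions, are vacuous, but
   matrices without rows vanish. *)
case: d h dh dh2 HC => [|d] h dh dh2 HC.
  by exists 0 => //; split=> *; rewrite norm_mx0row ?mul0r.
pose C := `|C0|; have CC : 0 <= C by exact: normr_ge0.
have hb x : `|h x| <= C.
  by have [h1 _ _] := HC x ord0 ord0; apply: (le_trans h1); exact: ler_norm.
have h1b l x : `|derive h x (pdir R l)| <= C.
  by have [_ h1 _] := HC x l ord0; apply: (le_trans h1); exact: ler_norm.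
have h2b l l' x : `|derive (fun z => derive h z (pdir R l)) x (pdir R l')| <= C.
  by have [_ _ h1] := HC x l l'; apply: (le_trans h1); exact: ler_norm.
have lip1 := lipschitz_of_partials CC dh h1b.
have lip2 l := lipschitz_of_partials CC (dh2 l) (h2b l).
set n : R := d.+1%:R.
have n0 : 0 <= n by exact: ler0n.
exists (C + n * C + n * (n * C)); first by rewrite !addr_ge0 ?mulr_ge0.
have nC : 0 <= n * C by rewrite mulr_ge0.
have nnC : 0 <= n * (n * C) by rewrite mulr_ge0.
split.
- by move=> x; apply: (le_trans (hb x)); rewrite -addrA lerDl addr_ge0.
- move=> x y; apply: (le_trans (lip1 y x)); rewrite ler_wpM2r//; move: CC nnC; lra.
move=> x0 y0 x1 y1.
set z0 := x0 - y0; set z1 := x1 - y1.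
set D := `|x1 - x0| + `|y1 - y0|.
have D0 : 0 <= D by rewrite addr_ge0.
apply: mx_norm_leP => [|i j].
  by rewrite mulr_ge0 ?addr_ge0// mulr_ge0.
have [s /andP[s0 s1]] := line_mean_value y1 z1 y0 z0 i j dh.
rewrite !subrKC => E.
have -> : (h x1 - h y1 - (h x0 - h y0)) i j = h x1 i j - h x0 i j - (h y1 i j - h y0 i j).
  by rewrite !mxE; ring.
rewrite E; apply: (le_trans (ler_norm_sum _ _ _)).
apply: (@le_trans _ _ (\sum_(l < d.+1) (`|z1 - z0| * C + `|z0| * (n * C * D)))).
  apply: ler_sum => l _.
  set A1 := derive _ _ _; set A0 := derive _ _ _.
  have alg (u1 u0 a1 a0 : R) : u1 * a1 - u0 * a0 = (u1 - u0) * a1 + u0 * (a1 - a0).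
    by ring.
  rewrite alg -(entryB z1 z0) -(entryB A1 A0).
  apply: (le_trans (ler_normD _ _)); rewrite !normrM; apply: lerD.
    by apply: ler_pM => //; [exact: mx_entry_le | exact: le_trans (mx_entry_le _ _ _) (h1b _ _)].
  apply: ler_pM => //; first exact: mx_entry_le.
  apply: (le_trans (mx_entry_le _ _ _)).
  apply: (le_trans (lip2 l _ _)); rewrite ler_wpM2l//.
  (* At the common parameter the two points differ by a convex combination of [x1 - x0] and
     [y1 - y0], hence by at most [D]. *)
  have -> : y1 + s *: z1 - (y0 + s *: z0) = s *: (x1 - x0) + (1 - s) *: (y1 - y0).
    apply/matrixP => a b; rewrite !mxE; ring.
  apply: (le_trans (ler_normD _ _)); rewrite !normrZ !ger0_norm ?subr_ge0//.
  by rewrite lerD// ler_piMl//; lra.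
rewrite sumr_const card_ord -[leLHS]mulr_natl -/n.
have e1 : 0 <= `|z1 - z0| * (C + n * (n * C)) by rewrite mulr_ge0// addr_ge0.
have e2 : 0 <= `|z0| * D * (C + n * C) by rewrite !mulr_ge0// addr_ge0.
by move: e1 e2; lra.
Qed.

End BC2.

Section TimeRegularity.
Variable R : realType.

Lemma powR_le1 (x z : R) : 0 <= x -> x <= 1 -> 0 <= z -> x `^ z <= 1.
Proof.
move=> x0 x1 z0; have := @ge0_ler_powR _ z z0 x 1.
by rewrite powR1 !nnegrE; apply.
Qed.

(** [Cz2] bounds each [f t] separately and compares times at distance at most one. Unit steps from
    time [0], each adding the Hoelder constant to the derivative bound, give a spatial Lipschitz
    constant uniform on [[0, n]]. *)
Lemma Cz2_unif (zeta : R) (d k : nat) (f : R -> 'cV[R]_d -> 'M[R]_(d, k)) (n : nat) :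
  0 < zeta -> Cz2 zeta f -> exists2 L : R, 0 <= L &
    (forall s t x, 0 <= s -> 0 <= t -> `|t - s| <= 1 ->
       `|f t x - f s x| <= L * `|t - s| `^ zeta) /\
    (forall t x y, 0 <= t -> t <= n%:R -> `|f t x - f t y| <= L * `|x - y|).
Proof.
move=> z0 [bc [C1 HC]].
case: d f bc HC => [|d] f bc HC.
  by exists 0 => //; split=> *; rewrite norm_mx0row mul0r.
pose C := `|C1|; have CC : 0 <= C by exact: normr_ge0.
have [_ [_ [_ [C2 H2]]]] := bc 0 (lexx _).
pose D := `|C2|; have D0 : 0 <= D by exact: normr_ge0.
have hp (t s : R) : C1 * `|t - s| `^ zeta <= C * `|t - s| `^ zeta.
  by rewrite ler_wpM2r ?powR_ge0// ler_norm.
have step j : forall t x i, 0 <= t -> t <= j%:R ->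
    `|derive (f t) x (pdir R i)| <= D + j%:R * C.
  elim: j => [|j IH] t x i t0 tj.
    have -> : t = 0 by apply/le_anti; rewrite t0 andbT.
    have [_ h _] := H2 x i ord0; rewrite mul0r addr0.
    by apply: (le_trans h); exact: ler_norm.
  have [tj'|jt] := leP t j%:R.
    apply: (le_trans (IH t x i t0 tj')); rewrite lerD2l ler_wpM2r//.
    by rewrite ler_nat.
  have ts : `|t - j%:R| <= 1.
    rewrite ger0_norm ?subr_ge0 ?(ltW jt)//; move: tj; rewrite -natr1; lra.
  have [_ h _] := HC _ _ (ler0n _ j) t0 ts x i ord0.
  have hj := IH j%:R x i (ler0n _ _) (lexx _).
  rewrite -(subrK (derive (f j%:R) x (pdir R i)) (derive (f t) x (pdir R i))).
  apply: (le_trans (ler_normD _ _)); rewrite -natr1 mulrDl mul1r addrA [leRHS]addrC.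
  apply: lerD => //; apply: (le_trans h); apply: (le_trans (hp _ _)).
  by rewrite ler_piMr// powR_le1// ltW.
have E0 : 0 <= D + n%:R * C by rewrite addr_ge0// mulr_ge0.
exists (C + d.+1%:R * (D + n%:R * C)); first by rewrite addr_ge0// mulr_ge0.
split.
  move=> s t x s0 t0 ts; have [h _ _] := HC _ _ s0 t0 ts x ord0 ord0.
  apply: (le_trans h); apply: (le_trans (hp _ _)).
  by rewrite ler_wpM2r ?powR_ge0// lerDl mulr_ge0.
move=> t x y t0 tn; have [dh _] := bc t t0.
have := lipschitz_of_partials E0 dh (fun l x => step n t x l t0 tn) y x => h.
by apply: (le_trans h); rewrite ler_wpM2r// lerDr.
Qed.

Lemma integral_increment (u : R -> R) (L zeta s t : R) : 0 < zeta -> 0 <= L ->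
  (forall s t, 0 <= s -> 0 <= t -> `|t - s| <= 1 ->
     `|u t - u s| <= L * `|t - s| `^ zeta) ->
  0 <= s -> s < t -> t - s <= 1 ->
  `|Rintegral lebesgue_measure `[0, t] u - Rintegral lebesgue_measure `[0, s] u
    - (t - s) * u s| <= L * (t - s) `^ zeta * (t - s).
Proof.
move=> z0 L0 Hu s0 st ts1.
(* Freezing [u] at its value in [0] for negative times gives a function continuous on the whole
   line, hence integrable on segments. *)
pose v r := u (Num.max r 0).
have vE r : 0 <= r -> v r = u r by move=> r0; rewrite /v max_l.
have Hv r q : `|r - q| <= 1 -> `|v r - v q| <= L * `|r - q| `^ zeta.
  move=> rq; have lem : `|Num.max r 0 - Num.max q 0| <= `|r - q|.
    have [r0|r0] := leP 0 r; have [q0|q0] := leP 0 q.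
    - by [].
    - by rewrite subr0 !ger0_norm//; lra.
    - by rewrite sub0r normrN (distrC r) !ger0_norm//; lra.
    - by rewrite subrr normr0.
  apply: (le_trans (Hu _ _ _ _ (le_trans lem rq))).
  - by rewrite le_max lexx orbT.
  - by rewrite le_max lexx orbT.
  - by rewrite ler_wpM2l// ge0_ler_powR// ?nnegrE// ltW.
have cv : continuous v.
  move=> r; apply/cvgrPdist_le => e e0.
  pose dl := Num.min 1 ((e / (L + 1)) `^ zeta^-1).
  have e1 : 0 < e / (L + 1) by rewrite divr_gt0// ltr_wpDl.
  have dl0 : 0 < dl by rewrite lt_min ltr01/= powR_gt0.
  have : nbhs r (ball r dl) by exact: nbhsx_ballx.
  apply: filterS => q; rewrite -ball_normE /= => hq.
  have q1 : `|r - q| <= 1 by rewrite ltW// (lt_le_trans hq)// ge_min lexx.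
  apply: (le_trans (Hv _ _ q1)).
  have pz : `|r - q| `^ zeta <= e / (L + 1).
    have -> : e / (L + 1) = (e / (L + 1)) `^ zeta^-1 `^ zeta.
      by rewrite -powRrM mulVf ?gt_eqF// powRr1// ltW.
    apply: ge0_ler_powR; rewrite ?nnegrE ?powR_ge0 ?(ltW z0)//.
    by apply: ltW; apply: (lt_le_trans hq); rewrite ge_min lexx orbT.
  apply: (le_trans (ler_wpM2l L0 pz)).
  rewrite mulrCA ler_piMr ?(ltW e0)// ler_pdivrMr ?ltr_wpDl// mul1r lerDl//.
have iv a b : lebesgue_measure.-integrable `[a, b] (EFin \o v).
  apply: continuous_compact_integrable; first exact: segment_compact.
  exact: continuous_subspaceT.
have E r : Rintegral lebesgue_measure `[0, r] u = Rintegral lebesgue_measure `[0, r] v.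
  apply: eq_Rintegral => q; rewrite inE/= in_itv/= => /andP[q0 _].
  exact/esym/vE.
have b1 : (BLeft 0 <= BRight s)%O by rewrite bnd_simp.
have b2 : (BRight s <= BRight t)%O by rewrite bnd_simp ltW.
rewrite !E (Rintegral_itvB (iv 0 t) b1 b2).
have iv2 : lebesgue_measure.-integrable `]s, t] (EFin \o v).
  apply: (integrableS _ _ _ (iv s t)) => //.
  by apply: subset_itv; rewrite bnd_simp.
have mst : lebesgue_measure `]s, t] = (t - s)%:E.
  apply: etrans; first exact: (lebesgue_measure_itv `]s, t]).
  by rewrite /= lte_fin st EFinB.
have icst (x : R) : lebesgue_measure.-integrable `]s, t] (EFin \o (fun _ : R => x)).
  have ic : lebesgue_measure.-integrable `[s, t] (EFin \o (fun _ : R => x)).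
    apply: continuous_compact_integrable; first exact: segment_compact.
    by apply: continuous_subspaceT => y; exact: cvg_cst.
  apply: (integrableS _ _ _ ic) => //.
  by apply: subset_itv; rewrite bnd_simp.
have -> : (t - s) * u s = Rintegral lebesgue_measure `]s, t] (fun _ => u s).
  by rewrite Rintegral_cst//= mst/= mulrC.
rewrite -RintegralB//.
have ib : lebesgue_measure.-integrable `]s, t] (EFin \o (fun x => v x - u s)).
  have := integrableB _ iv2 (icst (u s)); apply => //.
apply: (le_trans (le_normr_Rintegral _ ib)) => //.
have -> : L * (t - s) `^ zeta * (t - s) =
    Rintegral lebesgue_measure `]s, t] (fun _ => L * (t - s) `^ zeta).
  by rewrite Rintegral_cst//= mst/=.
apply: le_Rintegral => //.
  have := integrable_abse ib; by [].
move=> x /=; rewrite in_itv/= => /andP[sx xt].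
rewrite -(vE s)//; apply: (le_trans (Hv _ _ _)).
  rewrite ger0_norm ?subr_ge0 ?(ltW sx)//; lra.
rewrite ler_wpM2l// ge0_ler_powR ?nnegrE ?(ltW z0)// ?subr_ge0 ?(ltW st)//.
by rewrite ger0_norm ?subr_ge0 ?(ltW sx)// lerD2r.
Qed.

Lemma negnorm_cvg0 (kappa gamma : R) (d k : nat)
    (f : nat -> R -> 'cV[R]_d -> 'M[R]_(d, k)) (dl : R) : 0 < dl ->
  (fun n => negnorm kappa gamma (f n)) @ \oo --> 0%E ->
  exists n1, forall n, (n1 <= n)%N -> exists K, [/\ 0 <= K, K <= dl &
    forall s t (x y : 'cV[R]_d), 0 <= s -> 0 <= t -> `|t - s| <= 1 ->
      `|fhat (f n) t x - fhat (f n) s x| <= K * `|t - s| `^ (1 - kappa) /\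
      `|fhat (f n) t x - fhat (f n) s x - fhat (f n) t y + fhat (f n) s y|
         <= K * `|t - s| `^ (1 - kappa) * `|x - y| `^ gamma].
Proof.
move=> dl0 /fine_cvgP[fin /cvgrPdist_lt /(_ _ dl0) near0].
have [n1 _ Hn] := filterI fin near0; exists n1 => n /Hn[fn].
rewrite sub0r normrN => h.
have : (negnorm kappa gamma (f n) < dl%:E)%E.
  by rewrite -(fineK fn) lte_fin; apply: le_lt_trans h; exact: ler_norm.
move=> /ereal_inf_lt[_ [K [K0 HK] <-]]; rewrite lte_fin => Kdl.
by exists K; split => //; exact: ltW.
Qed.

End TimeRegularity.

(** * Riemann sums, drivers and noise *)

Section DyadicRiemannSums.
Variable R : realType.

Let dpart (N s n : nat) : seq R := [seq dt R N j.+1 | j <- iota s n].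

Lemma zip_dpart N s n : zip (dt R N s :: dpart N s n) (dpart N s n) =
  [seq (dt R N j, dt R N j.+1) | j <- iota s n].
Proof. by elim: n s => //= n IH s; rewrite -IH. Qed.

Lemma dpart_is_part N s n : is_part (dt R N s) (dt R N (s + n)) (dpart N s n).
Proof.
rewrite /is_part; elim: n s => [|n IH] s /=; first by rewrite addn0 eqxx.
by rewrite lt_dt ltnSn/= -addSnnS; exact: IH.
Qed.

Lemma young_int_dyadic (d q : nat) (y : R -> 'M[R]_(d, q)) (bp : R -> 'cV[R]_q)
    k i I : young_int y bp 0 (dt R k i) I ->
  forall e, 0 < e -> exists N0, forall N, (N0 <= N)%N -> (k <= N)%N ->
  `|\sum_(0 <= j < 2 ^ (N - k) * i) y (dt R N j) *m (bp (dt R N j.+1) - bp (dt R N j))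
    - I| <= e.
Proof.
move=> HI e e0; have [dl d0 H] := HI _ e0.
have d2 : 0 < dl / 2 by rewrite divr_gt0.
have [N0 hN0] := inv2X_le d2; exists N0 => N N0N kN.
have ip := dpart_is_part N 0 (2 ^ (N - k) * i).
rewrite add0n dt0 -{1}(subnKC kN) dt_scale in ip.
have me : mesh 0 (dpart N 0 (2 ^ (N - k) * i)) < dl.
  apply: (@le_lt_trans _ _ (dl / 2)); last by lra.
  rewrite /mesh -(dt0 R N) zip_dpart big_map.
  apply: bigmax_le => [|j _]; first by rewrite dt0 ltW.
  by rewrite /= dtS addrAC subrr add0r hN0.
have := H _ ip me; rewrite /RSsum -{1}(dt0 R N) zip_dpart big_map => h.
by rewrite /index_iota subn0; exact: ltW.
Qed.

(** Solutions provide integrals from [0] only. The integral over a dyadic cell is recovered by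
    subtracting Riemann sums over nested dyadic partitions. *)
Lemma young_int_dsum (d q : nat) (y : R -> 'M[R]_(d, q)) (bp : R -> 'cV[R]_q)
    k i I I' : young_int y bp 0 (dt R k i) I -> young_int y bp 0 (dt R k i.+1) I' ->
  forall e, 0 < e -> exists N0, forall N, (N0 <= N)%N ->
  `|dsum N k i (fun j => y (dt R N j) *m (bp (dt R N j.+1) - bp (dt R N j)))
    - (I' - I)| <= e.
Proof.
move=> HI HI' e e0; have e2 : 0 < e / 2 by rewrite divr_gt0.
have [N1 h1] := young_int_dyadic HI e2; have [N2 h2] := young_int_dyadic HI' e2.
exists (maxn k (maxn N1 N2)) => N; rewrite !geq_max => /and3P[kN N1N N2N].
have {}h1 := h1 _ N1N kN; have {}h2 := h2 _ N2N kN.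
pose F j := y (dt R N j) *m (bp (dt R N j.+1) - bp (dt R N j)).
change (`|dsum N k i F - (I' - I)| <= e).
have -> : dsum N k i F = \sum_(0 <= j < 2 ^ (N - k) * i.+1) F j
   - \sum_(0 <= j < 2 ^ (N - k) * i) F j.
  rewrite /dsum [X in _ = X - _](@big_cat_nat _ _ _ (2 ^ (N - k) * i))//=.
    by rewrite addrAC subrr add0r.
  by rewrite leq_mul2l leqnSn orbT.
rewrite subrACA; apply: (le_trans (ler_normB _ _)); lra.
Qed.

Lemma holder_dyadic (d : nat) (y : R -> 'cV[R]_d) (alpha a : R) (n : nat) :
  0 < alpha -> a = 2 `^ (- alpha) -> loc_holder alpha y ->
  dyadic_holder a y n%:R.
Proof.
(* The horizon [n.+1] is positive even for [n = 0]. *)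
move=> al0 aE Hy; have [C HC] := Hy n.+1%:R (ltr0Sn _ _).
exists `|C| => // k i it.
have i0 : 0 <= dt R k i <= n.+1%:R.
  rewrite dt_ge0/=; apply: (@le_trans _ _ (dt R k i.+1)); first by rewrite le_dt.
  by apply: (le_trans it); rewrite ler_nat.
have i1 : 0 <= dt R k i.+1 <= n.+1%:R.
  by rewrite dt_ge0/=; apply: (le_trans it); rewrite ler_nat.
apply: (le_trans (HC _ _ i0 i1)).
rewrite dtS addrAC subrr add0r ger0_norm ?invr_ge0 ?exprn_ge0//.
have -> : (2 ^+ k)^-1 `^ alpha = a ^+ k.
  rewrite aE -[RHS]powR_mulrn ?powR_ge0// -powRrM -powR_inv1 ?exprn_ge0//.
  rewrite -powR_mulrn// -!powRrM; congr (_ `^ _); ring.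
by rewrite ler_wpM2r ?ler_norm// exprn_ge0// aE powR_ge0.
Qed.

Lemma holder_ucont (d : nat) (y : R -> 'cV[R]_d) (alpha : R) (n : nat) :
  0 < alpha -> loc_holder alpha y -> ucont y n%:R.
Proof.
move=> al0 Hy; have [C HC] := Hy n.+1%:R (ltr0Sn _ _) => e e0.
have e1 : 0 < e / (`|C| + 1) by rewrite divr_gt0// ltr_wpDl.
exists ((e / (`|C| + 1)) `^ alpha^-1); first by rewrite powR_gt0.
have nn : n%:R <= n.+1%:R :> R by rewrite ler_nat.
move=> s t /andP[s0 sn] /andP[t0 tn] st.
have hs : 0 <= s <= n.+1%:R by rewrite s0 (le_trans sn nn).
have ht : 0 <= t <= n.+1%:R by rewrite t0 (le_trans tn nn).
apply: (le_trans (HC _ _ hs ht)).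
have pz : `|t - s| `^ alpha <= e / (`|C| + 1).
  have -> : e / (`|C| + 1) = (e / (`|C| + 1)) `^ alpha^-1 `^ alpha.
    by rewrite -powRrM mulVf ?gt_eqF// powRr1// ltW.
  by apply: ge0_ler_powR; rewrite ?nnegrE ?powR_ge0 ?(ltW al0).
apply: (@le_trans _ _ (`|C| * `|t - s| `^ alpha)).
  by rewrite ler_wpM2r ?powR_ge0// ler_norm.
apply: (le_trans (ler_wpM2l (normr_ge0 _) pz)).
by rewrite mulrCA ler_piMr ?(ltW e0)// ler_pdivrMr ?ltr_wpDl// mul1r lerDl.
Qed.

Lemma ucontB (V : normedModType R) (y x : R -> V) (th : R) :
  ucont y th -> ucont x th -> ucont (fun t => y t - x t) th.
Proof.
move=> uy ux e e0; have e2 : 0 < e / 2 by rewrite divr_gt0.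
have [d1 d10 h1] := uy _ e2; have [d2 d20 h2] := ux _ e2.
exists (Num.min d1 d2); first by rewrite lt_min d10.
move=> s t hs ht; rewrite le_min => /andP[l1 l2].
have {}h1 := h1 _ _ hs ht l1; have {}h2 := h2 _ _ hs ht l2.
by rewrite subrACA; apply: (le_trans (ler_normB _ _)); lra.
Qed.

Lemma hnorm_le (alpha T C1 C2 : R) (d : nat) (z : R -> 'cV[R]_d) :
  (forall t, 0 <= t -> t <= T -> `|z t| <= C1) ->
  (forall s t, 0 <= s -> s < t -> t <= T -> `|z t - z s| <= C2 * (t - s) `^ alpha) ->
  (hnorm alpha T z <= (C1 + C2)%:E)%E.
Proof.
move=> h1 h2; rewrite /hnorm EFinD; apply: leeD; apply: ge_ereal_sup => x.
  by move=> [t]; rewrite /= in_itv/= => /andP[t0 tT] <-; rewrite lee_fin h1.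
move=> [_ [s [t [s0 st tT ->]]] <-]; rewrite lee_fin ler_pdivrMr ?h2//.
by rewrite powR_gt0// subr_gt0.
Qed.

End DyadicRiemannSums.

Section Drivers.
Variables (R : realType) (d q : nat) (b : R).
Hypothesis b0 : 0 < b.

Definition driver_part (fb : 'cV[R]_d -> 'M[R]_(d, q)) (bp : R -> 'cV[R]_q)
    (k i : nat) (v : 'cV[R]_d) : 'cV[R]_d :=
  fb v *m (bp (dt R k i.+1) - bp (dt R k i)).

Lemma driver_part_young fb bp (L Mb : R) (n0 : nat) : 0 <= L -> 0 <= Mb ->
  (forall x, `|fb x| <= L) ->
  (forall x y, `|fb x - fb y| <= L * `|x - y|) ->
  (forall v w v' w', `|fb v' - fb w' - (fb v - fb w)| <=
      L * (`|v' - w' - (v - w)| + `|v - w| * (`|v' - v| + `|w' - w|))) ->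
  (forall k i, dt R k i.+1 <= n0%:R ->
     `|bp (dt R k i.+1) - bp (dt R k i)| <= Mb * b ^+ k) ->
  young_driver b (q%:R * L * Mb) (driver_part fb bp) n0%:R.
Proof.
move=> L0 M0 f1 f2 f3 Hb k i it; have hb := Hb _ _ it.
have bk : 0 <= b ^+ k by rewrite exprn_ge0// ltW.
have mul (A : 'M[R]_(d, q)) X : 0 <= X -> `|A| <= L * X ->
    `|A *m (bp (dt R k i.+1) - bp (dt R k i))| <= q%:R * L * Mb * b ^+ k * X.
  move=> X0 hA; apply: (le_trans (mulmx_norm_le _ _)).
  have -> : q%:R * L * Mb * b ^+ k * X = q%:R * (L * X) * (Mb * b ^+ k) by ring.
  by apply: ler_pM => //; rewrite ler_wpM2l.
split.
- move=> v; rewrite /driver_part -mulmxDr.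
  have e1 : dt R k.+1 i.*2 = dt R k i by rewrite dt_double.
  have e2 : dt R k.+1 i.*2.+2 = dt R k i.+1 by rewrite -doubleS dt_double.
  by congr (_ *m _); rewrite e1 e2 [RHS]addrC subrKA.
- move=> v; have := @mul (fb v) 1 ler01; rewrite !mulr1; apply; exact: f1.
- move=> v w; rewrite /driver_part -mulmxBl; apply: mul => //.
- move=> v w v' w'; rewrite /driver_part -!mulmxBl; apply: mul => //.
Qed.

(* The averaged coefficient: [2 ^ N] times the increment of the primitive
   [fhat] is the mean of the coefficient over a dyadic cell. *)
Definition noise_part (F : R -> 'cV[R]_d -> 'M[R]_(d, q)) (bp : R -> 'cV[R]_q)
    (N j : nat) (z : 'cV[R]_d) : 'cV[R]_d :=
  (F (dt R N j.+1) z - F (dt R N j) z) *m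
    (2 ^+ N *: (bp (dt R N j.+1) - bp (dt R N j))).

(** On a cell of level [N], replacing [f - fb] at the path by its time average at the rounded point
    costs a multiple of [s ^+ N], where [s] is the dyadic ratio of [zeta], times the driver
    increment [b ^+ N]. Summed over at most [2 ^ N] cells this vanishes because [zeta + eta > 1].
    The constants of [f] influence [N0] alone. *)
Lemma approx_part (zeta : R) (f : R -> 'cV[R]_d -> 'M[R]_(d, q)) fb bp
    (pi : nat -> 'cV[R]_d -> 'cV[R]_d) (y : R -> 'cV[R]_d) (Lb Mb : R) (n0 : nat) :
  0 < zeta -> zeta <= 1 -> 2 * (2 `^ (- zeta) * b) < 1 -> 0 <= Lb -> 0 <= Mb ->
  Cz2 zeta f -> (forall x y, `|fb x - fb y| <= Lb * `|x - y|) ->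
  (forall k i, dt R k i.+1 <= n0%:R ->
     `|bp (dt R k i.+1) - bp (dt R k i)| <= Mb * b ^+ k) ->
  (forall k v, `|pi k v - v| <= (2 ^+ k)^-1) ->
  forall k i, dt R k i.+1 <= n0%:R -> forall e, 0 < e ->
  exists N0, forall N, (N0 <= N)%N ->
  `|dsum N k i (fun j => driver_part fb bp N j (y (dt R N j))
        + noise_part (fhat (fun t z => f t z - fb z)) bp N j (pi N (y (dt R N j))))
    - dsum N k i (fun j => f (dt R N j) (y (dt R N j)) *m
                           (bp (dt R N j.+1) - bp (dt R N j)))| <= e.
Proof.
move=> z0 z1 sb1 Lb0 M0 Hf Hfb Hb Hpi k i it e e0.
have [L L0 [Ht Hx]] := Cz2_unif n0 z0 Hf.
set s := 2 `^ (- zeta) in sb1.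
have s0 : 0 < s by rewrite powR_gt0.
have sN N : (2 ^+ N)^-1 `^ zeta = s ^+ N.
  rewrite /s -[RHS]powR_mulrn ?powR_ge0// -powRrM -powR_inv1 ?exprn_ge0//.
  rewrite -powR_mulrn// -!powRrM; congr (_ `^ _); ring.
have hs N : (2 ^+ N)^-1 <= s ^+ N :> R.
  rewrite -sN -{1}[(2 ^+ N)^-1]powRr1 ?invr_ge0 ?exprn_ge0//.
  apply: ger_powR => //; rewrite invr_gt0 exprn_gt0//=.
  by rewrite invf_le1 ?exprn_gt0// exprn_ege1// ler1n.
pose C := q%:R * (2 * L + Lb) * Mb.
have [N0 hN0] := @exp_small R (2 * (s * b)) C e
  (mulr_ge0 (ler0n _ 2) (mulr_ge0 (ltW s0) (ltW b0))) sb1 e0.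
exists (maxn k N0) => N; rewrite geq_max => /andP[kN N0N].
rewrite -dsumB.
apply: (@le_trans _ _ (C * (s ^+ N * b ^+ N) * 2 ^+ (N - k))); last first.
  apply: le_trans (hN0 _ N0N); rewrite exprMn exprMn -mulrA ler_wpM2l//.
    by rewrite !mulr_ge0// addr_ge0// mulr_ge0.
  rewrite mulrC ler_wpM2r ?mulr_ge0 ?exprn_ge0 ?(ltW s0) ?(ltW b0)//.
  by rewrite ler_weXn2l ?leq_subr// ler1n.
apply: dsum_norm_le => // j dj.
have jt : dt R N j.+1 <= n0%:R by have [_ h] := descendant_dt R dj; exact: le_trans it.
have jt0 : dt R N j <= n0%:R by apply: le_trans jt; rewrite le_dt.
set t := dt R N j; set t' := dt R N j.+1; set v := y t; set z := pi N v.
have hz : `|z - v| <= (2 ^+ N)^-1 by exact: Hpi.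
have tt : t' - t = (2 ^+ N)^-1 by rewrite /t' /t dtS addrAC subrr add0r.
have t0 : 0 <= t by exact: dt_ge0.
set Db := bp t' - bp t.
have -> : driver_part fb bp N j v
    + noise_part (fhat (fun t z => f t z - fb z)) bp N j z - f t v *m Db =
   (2 ^+ N *: (fhat (fun t z => f t z - fb z) t' z - fhat (fun t z => f t z - fb z) t z)
     - (f t v - fb v)) *m Db.
  rewrite /driver_part /noise_part -/t -/t' -/Db -scalemxAr scalemxAl.
  by rewrite -mulmxDl -mulmxBl; congr (_ *m _); rewrite opprB [X in X - _]addrC addrA addrAC.
apply: (le_trans (mulmx_norm_le _ _)).
have -> : C * (s ^+ N * b ^+ N) = q%:R * ((2 * L + Lb) * s ^+ N) * (Mb * b ^+ N).
  by rewrite /C; ring.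
apply: ler_pM => //; last exact: Hb.
rewrite ler_wpM2l//.
have W : `|2 ^+ N *: (fhat (fun t z => f t z - fb z) t' z - fhat (fun t z => f t z - fb z) t z)
     - (f t z - fb z)| <= L * s ^+ N.
  apply: mx_norm_leP => [|r c]; first by rewrite mulr_ge0// exprn_ge0// ltW.
  rewrite entryB entryZ entryB /fhat !mxE.
  have Hu s1 t1 : 0 <= s1 -> 0 <= t1 -> `|t1 - s1| <= 1 ->
      `|(f t1 z - fb z) r c - (f s1 z - fb z) r c| <= L * `|t1 - s1| `^ zeta.
    move=> s10 t10 h; apply: le_trans (Ht _ _ z s10 t10 h).
    apply: le_trans (mx_entry_le _ r c); rewrite !mxE.
    by rewrite le_eqVlt; apply/orP; left; apply/eqP; congr `|_|; ring.
  have st : t < t' by rewrite lt_dt.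
  have ts1 : t' - t <= 1.
    by rewrite tt invf_le1 ?exprn_gt0// exprn_ege1// ler1n.
  have := integral_increment z0 L0 Hu t0 st ts1; rewrite tt sN.
  set I1 := Rintegral _ _ _; set I2 := Rintegral _ _ _ => h.
  have p2 : 0 < 2 ^+ N :> R by rewrite exprn_gt0.
  have -> : 2 ^+ N * (I1 - I2) - (f t z r c - fb z r c) =
    2 ^+ N * (I1 - I2 - (2 ^+ N)^-1 * (f t z - fb z) r c).
    by rewrite entryB [RHS]mulrBr mulrA divff ?mul1r// gt_eqF.
  rewrite normrM (gtr0_norm p2).
  by apply: (le_trans (ler_wpM2l (ltW p2) h)); rewrite mulrCA divff ?mulr1// gt_eqF.
apply: (le_trans (ler_distD (f t z - fb z) _ _)).
have -> : (2 * L + Lb) * s ^+ N = L * s ^+ N + (L * s ^+ N + Lb * s ^+ N) by ring.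
apply: lerD => //; rewrite subrACA; apply: (le_trans (ler_normB _ _)).
have hz' := le_trans hz (hs N).
apply: lerD; first by apply: (le_trans (Hx _ _ _ t0 jt0)); rewrite ler_wpM2l.
by apply: (le_trans (Hfb _ _)); rewrite ler_wpM2l.
Qed.

End Drivers.

(** * Exceptional events *)

Section Grid.
Variables (R : realType) (d K0 : nat).

Definition grid_index (k : nat) : finType := {ffun 'I_d -> 'I_(2 * K0 * 2 ^ k).+1}.

Definition grid_pt k (u : grid_index k) : 'cV[R]_d :=
  \col_r ((u r)%:R / 2 ^+ k - K0%:R).

Definition in_grid k (z : 'cV[R]_d) : Prop := exists u : grid_index k, z = grid_pt u.

(** There is no truncation to the box: the rounding error is at most [2 ^- k] everywhere, and the
    rounded point is claimed to be in the grid only for [v] in the box. *)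
Definition dround k (v : 'cV[R]_d) : 'cV[R]_d :=
  \col_r ((Num.floor (v r 0 * 2 ^+ k))%:~R / 2 ^+ k).

Lemma in_gridS k z : in_grid k z -> in_grid k.+1 z.
Proof.
move=> [u ->].
have hu r : ((u r).*2 < (2 * K0 * 2 ^ k.+1).+1)%N.
  have := ltn_ord (u r); move: (nat_of_ord (u r)) => x; rewrite expnS.
  by move: (2 ^ k)%N => e; clear; lia.
exists [ffun r => Ordinal (hu r)]; apply/matrixP => r c; rewrite !mxE ffunE /=.
by congr (_ - _); rewrite -[LHS](dt_double R k).
Qed.

Lemma dround_dist k v : `|dround k v - v| <= (2 ^+ k)^-1.
Proof.
have p2 : 0 < 2 ^+ k :> R by rewrite exprn_gt0.
apply: mx_norm_leP => [|r c]; first by rewrite invr_ge0 ltW.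
rewrite entryB !mxE (ord1 c).
have h1 := floor_le (v r 0 * 2 ^+ k); have h2 := floorD1_gt (v r 0 * 2 ^+ k).
set x := v r 0 in h1 h2 *; set n := Num.floor _ in h1 h2 *.
rewrite intrD in h2.
rewrite distrC ger0_norm ?subr_ge0 ?ler_pdivrMr//.
have -> : x - n%:~R / 2 ^+ k = (x * 2 ^+ k - n%:~R) / 2 ^+ k.
  by field; rewrite gt_eqF.
rewrite -[leRHS]mul1r ler_wpM2r ?invr_ge0 ?(ltW p2)//.
by move: h2; lra.
Qed.

Lemma dround_in_grid k v : `|v| <= K0%:R -> in_grid k (dround k v).
Proof.
move=> vK; have p2 : 0 < 2 ^+ k :> R by rewrite exprn_gt0.
have E2 : (2 ^+ k : R) = (2 ^ k)%:R by rewrite natrX.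
have bd r : exists n : nat, (n < (2 * K0 * 2 ^ k).+1)%N /\
    n%:R = (Num.floor (v r 0 * 2 ^+ k))%:~R + (K0 * 2 ^ k)%:R :> R.
  have /ler_normlP[l1 l2] : `|v r 0| <= K0%:R by exact: le_trans (mx_entry_le _ _ _) vK.
  have f1 : (- (K0 * 2 ^ k)%:Z <= Num.floor (v r 0 * 2 ^+ k))%R.
    rewrite floor_ge_int rmorphN /= -pmulrn natrM E2 -mulNr.
    by rewrite ler_wpM2r//; lra.
  have f2 : (Num.floor (v r 0 * 2 ^+ k) <= (K0 * 2 ^ k)%:Z)%R.
    rewrite -(ler_int R); apply: (le_trans (floor_le _)).
    by rewrite -pmulrn natrM E2 ler_wpM2r.
  exists (absz (Num.floor (v r 0 * 2 ^+ k) + (K0 * 2 ^ k)%:Z)); split.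
    by move: f1 f2; move: (Num.floor _) (2 ^ k)%N => x e; clear; nia.
  rewrite [LHS]pmulrn gez0_abs ?intrD//.
  by move: f1; move: (Num.floor _) (K0 * 2 ^ k)%N => x e; clear; lia.
pose n r := sval (cid (bd r)).
have hn r := (svalP (cid (bd r))).1; have en r := (svalP (cid (bd r))).2.
exists [ffun r => Ordinal (hn r)]; apply/matrixP => r c; rewrite !mxE ffunE /= en.
by rewrite natrM -E2; field; rewrite gt_eqF.
Qed.

Lemma card_grid_index k : (#|grid_index k| <= ((2 * K0).+1 * 2 ^ k) ^ d)%N.
Proof.
rewrite card_ffun !card_ord; case: d => [|d']; first by rewrite !expn0.
rewrite leq_exp2r//; have := expn_gt0 2 k; rewrite orTb.
by move: (2 ^ k)%N => e; clear; nia.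
Qed.

End Grid.

Section Events.
Variables (R : realType) (d0 : measure_display) (Omega : measurableType d0).
Variable P : probability Omega R.

(** The order [p] of the Gaussian tail is taken so large that the probabilities at level [k] decay
    faster than the number [nu ^+ k] of events grows. *)
Lemma choose_power (nu r : R) : 0 <= r -> r < 1 ->
  exists2 p, (0 < p)%N & nu * (r ^+ 2) ^+ p <= 2^-1.
Proof.
move=> r0 r1.
have r2 : r ^+ 2 < 1 by rewrite exprn_ilt1.
have [n h] := @exp_small R (r ^+ 2) nu 2^-1 (exprn_ge0 _ r0) r2 ltac:(lra).
by exists n.+1 => //; apply: h.
Qed.

Lemma family_event (I : nat -> finType) (E : forall k, I k -> set Omega)
    (C1 C2 nu rho : R) : 0 <= C1 -> 0 <= C2 -> 0 <= nu -> 0 <= rho ->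
  nu * rho <= 2^-1 ->
  (forall k i, measurable (E k i)) ->
  (forall k, #|I k|%:R <= C1 * nu ^+ k) ->
  (forall k i, (P (E k i) <= (C2 * rho ^+ k)%:E)%E) ->
  exists A, [/\ measurable A, (P A <= (2 * (C1 * C2))%:E)%E &
    forall w, ~ A w -> forall k i, ~ E k i w].
Proof.
move=> C10 C20 nu0 rho0 nr mE cI pE.
pose U k := \bigcup_i E k i.
have mU k : measurable (U k) by exact: bigcup_fin_measurable.
exists (\bigcup_k U k); split; first exact: bigcup_measurable.
  have nr0 : 0 <= nu * rho by rewrite mulr_ge0.
  have h k : (P (U k) <= (C1 * C2 * 2^-1 ^+ k)%:E)%E.
    apply: (le_trans (prob_bigcup_fin (mE k) (pE k))); rewrite lee_fin.
    have c0 : 0 <= C2 * rho ^+ k by rewrite mulr_ge0// exprn_ge0.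
    apply: (le_trans (ler_wpM2r c0 (cI k))).
    rewrite mulrACA -exprMn ler_wpM2l ?mulr_ge0//.
    by rewrite lerXn2r ?nnegrE// invr_ge0.
  have := prob_bigcup_geometric mU (mulr_ge0 C10 C20) _ _ h.
  have -> : (1 - 2^-1)^-1 = 2 :> R by field.
  by rewrite mulrC; apply; rewrite ?invr_ge0// invf_lt1// ltr1n.
by move=> w nA k i Ei; apply: nA; exists k => //; exists i.
Qed.

Variables (H : R) (m : nat) (B : R -> Omega -> 'cV[R]_m).
Hypotheses (H1 : 1 / 2 < H) (H2 : H < 1).
Hypothesis fB : is_fBm P H B.

Lemma powR2_ltr (x y : R) : x < y -> 2 `^ x < 2 `^ y :> R.
Proof.
move=> xy; rewrite /powR pnatr_eq0/= ltr_expR ltr_pM2r//.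
by rewrite ln_gt0// ltr1n.
Qed.

Lemma powR2_lt1 (x : R) : x < 0 -> 2 `^ x < 1 :> R.
Proof. by move=> /powR2_ltr; rewrite powRr0. Qed.

Lemma dt_lt_ord k i (n0 : nat) : dt R k i.+1 <= n0%:R -> (i < n0 * 2 ^ k)%N.
Proof.
have -> : n0%:R = dt R k (n0 * 2 ^ k) by rewrite /dt natrM natrX mulfK// expf_neq0.
by rewrite le_dt.
Qed.

(** For [G = id] the slope is one and [theta] is the dyadic ratio of [H]; at [N = k] the Riemann sum
    is the increment of [B], so the noise estimate also yields the Hoelder bound of [B]. *)
Lemma fbm_increment_event (b : R) (n0 : nat) (dl : R) : 0 < dl ->
  2 `^ (- H) < b -> exists2 M : R, 0 <= M & exists A,
  [/\ measurable A, (P A <= dl%:E)%E &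
    forall w, ~ A w -> forall k i, dt R k i.+1 <= n0%:R ->
      `|B (dt R k i.+1) w - B (dt R k i) w| <= M * b ^+ k].
Proof.
move=> dl0 Hb; set th := 2 `^ (- H).
have th0 : 0 < th by rewrite powR_gt0.
have b0 : 0 < b by exact: lt_trans Hb.
have tau0 : 0 < 2^-1 :> R by rewrite invr_gt0.
have thE : th = 2 * 2^-1 * 2 `^ (- H) by rewrite divff// mul1r.
have th1 : th < 1 by apply: powR2_lt1; move: H1; lra.
have th2 : 2 * th ^+ 2 < 1.
  rewrite -powR_mulrn ?powR_ge0// -powRrM -{1}(powRr1 (ler0n _ 2)) -powRD; last first.
    by rewrite pnatr_eq0 implybT.
  by apply: powR2_lt1; move: H1; lra.
have r0 : 0 <= th / b by rewrite divr_ge0 ?ltW.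
have r1 : th / b < 1 by rewrite ltr_pdivrMr// mul1r.
have [p p0 hp] := choose_power 2 r0 r1.
pose rho := ((th / b) ^+ 2) ^+ p.
have rho0 : 0 <= rho by rewrite !exprn_ge0.
pose C1 : R := (n0 * m)%:R.
have C10 : 0 <= C1 by exact: ler0n.
have [Cst Cst0 ev] := rsum_event H1 H2 fB tau0 thE th1 th2 p0.
(* The events have total probability at most [2 * C1 * Cst] times the power [2 * p] of [M^-1]. As
   [M >= 1] and [p > 0], this is at most [2 * C1 * Cst / M], which is below [dl]. *)
pose M := 1 + 2 * (C1 * Cst) / dl.
have M1 : 1 <= M by rewrite lerDl divr_ge0 ?(ltW dl0)// !mulr_ge0.
have M0 : 0 < M by exact: lt_le_trans M1.
exists M; first exact: ltW.
have hid k i N j : descendant k i N j ->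
    `|id (dt R N j.+1) - id (dt R N j)| <= 1 * 2^-1 ^+ N.
  move=> _; rewrite /= dtS addrAC subrr add0r mul1r exprVn.
  by rewrite ger0_norm// invr_ge0 exprn_ge0.
have l0 k : 0 < M * b ^+ k by rewrite mulr_gt0// exprn_gt0.
pose I k : finType := ('I_(n0 * 2 ^ k) * 'I_m)%type.
pose E k (ic : I k) := sval (cid (ev ic.2 id k ic.1 1 _ ler01 (l0 k) (hid k ic.1))).
have EP k (ic : I k) := svalP (cid (ev ic.2 id k ic.1 1 _ ler01 (l0 k) (hid k ic.1))).
pose C2 := Cst * (M^-1 ^+ 2) ^+ p.
have C20 : 0 <= C2 by rewrite mulr_ge0// !exprn_ge0// invr_ge0 ltW.
have [|||A [mA pA hA]] := @family_event I E C1 C2 2 rho C10 C20 (ler0n _ 2) rho0 hp.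
- by move=> k ic; case: (EP k ic).
- move=> k; rewrite card_prod !card_ord /C1 -mulnA mulnCA mulnC natrM.
  by rewrite [(2 ^ k)%:R]natrX.
- move=> k ic; case: (EP k ic) => _ h _; apply: (le_trans h); rewrite lee_fin.
  rewrite le_eqVlt; apply/orP; left; apply/eqP.
  have -> : (1 * th ^+ k / (M * b ^+ k)) ^+ 2 = M^-1 ^+ 2 * ((th / b) ^+ 2) ^+ k.
    rewrite -(exprM _ 2 k) mulnC exprM -exprMn; congr (_ ^+ _).
    by rewrite mul1r expr_div_n; field; rewrite !gt_eqF// exprn_gt0.
  by rewrite exprMn mulrA -/C2; congr (_ * _); exact: exprAC.
exists A; split => //.
  apply: (le_trans pA); rewrite lee_fin /C2.
  have le1 : (M^-1 ^+ 2) ^+ p <= M^-1.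
    have Mi0 : 0 <= M^-1 by rewrite invr_ge0 ltW.
    have Mi1 : M^-1 <= 1 by rewrite invf_le1.
    rewrite -exprM -[leRHS]expr1; apply: ler_exp_le1 => //.
    by rewrite muln_gt0.
  apply: (@le_trans _ _ (2 * (C1 * (Cst * M^-1)))).
    by rewrite ler_wpM2l// ler_wpM2l// ler_wpM2l.
  have -> : 2 * (C1 * (Cst * M^-1)) = 2 * (C1 * Cst) / M by rewrite !mulrA.
  rewrite ler_pdivrMr// /M mulrDr mulr1 (mulrC dl (_ / dl)) divfK ?gt_eqF//.
  by rewrite lerDr ltW.
move=> w nA k i it.
apply: mx_norm_leP => [|c z]; first exact: ltW.
have ik := dt_lt_ord it.
case: (EP k (Ordinal ik, c)) => _ _ /(_ w (hA w nA k (Ordinal ik, c)) k (leqnn _)).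
rewrite (ord1 z) /rsum dsum_id /= dtS addrAC subrr add0r mulVf ?mul1r ?expf_neq0//.
by rewrite -dtS entryB.
Qed.


End Events.

Section NoiseEvent.
Variables (R : realType) (d0 : measure_display) (Omega : measurableType d0).
Variable P : probability Omega R.
Variables (H : R) (m d : nat) (B : R -> Omega -> 'cV[R]_m).
Hypotheses (H1 : 1 / 2 < H) (H2 : H < 1).
Hypothesis fB : is_fBm P H B.

Lemma dsum_noise_entry (F : R -> 'cV[R]_d -> 'M[R]_(d, m)) N k i w z r c0 :
  dsum N k i (noise_part F (B^~ w) N ^~ z) r c0 =
  \sum_(c < m) rsum B c (fun t => F t z r c) N k i w.
Proof.
rewrite /dsum summxE exchange_big /=; apply: eq_bigr => j _.
rewrite /noise_part mxE (ord1 c0); apply: eq_bigr => c _.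
by rewrite entryZ !entryB mulrA.
Qed.

Lemma rsumB (c : 'I_m) (G G' : R -> R) N k i w :
  rsum B c G N k i w - rsum B c G' N k i w = rsum B c (fun t => G t - G' t) N k i w.
Proof.
rewrite /rsum -dsumB /dsum; apply: eq_bigr => j _; ring.
Qed.

Variables (tau theta b gam : R).
Hypotheses (tau0 : 0 < tau) (thetaE : theta = 2 * tau * 2 `^ (- H)).
Hypotheses (theta1 : theta < 1) (theta2 : 2 * theta ^+ 2 < 1) (thb : theta < b).

(** The threshold [eta] precedes [F] and [K]: smallness of the primitive is all that is asked of the
    coefficients, which makes the estimate uniform in [n]. The factor [m] in the conclusion comes
    from adding the coordinates of [B]. *)
Lemma noise_event (n0 K0 : nat) (eps dl : R) : 0 < eps -> 0 < dl ->
  exists2 eta : R, 0 < eta &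
  forall (F : R -> 'cV[R]_d -> 'M[R]_(d, m)) (K : R), 0 <= K -> K <= eta ->
  (forall N j z, dt R N j.+1 <= n0%:R ->
     `|F (dt R N j.+1) z - F (dt R N j) z| <= 2 * K * tau ^+ N) ->
  (forall N j z z', dt R N j.+1 <= n0%:R ->
     `|F (dt R N j.+1) z - F (dt R N j) z - (F (dt R N j.+1) z' - F (dt R N j) z')|
        <= 2 * K * tau ^+ N * `|z - z'| `^ gam) ->
  exists A, [/\ measurable A, (P A <= dl%:E)%E &
    forall w, ~ A w -> small_noise b gam (noise_part F (B^~ w)) (@in_grid R d K0)
      (m%:R * eps) n0%:R].
Proof.
move=> eps0 dl0.
have th0 : 0 < theta by rewrite thetaE !mulr_gt0// powR_gt0.
have b0 : 0 < b by exact: lt_trans thb.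
have r0 : 0 <= theta / b by rewrite divr_ge0 ?ltW.
have r1 : theta / b < 1 by rewrite ltr_pdivrMr// mul1r.
(* Growth per level of the number of events: [2] for the time cells and [2 ^+ d] for each point of a
   pair in the grid. *)
pose nu : R := 2 * (2 ^+ d) ^+ 2.
have nu0 : 0 <= nu by rewrite mulr_ge0// !exprn_ge0.
have [p p0 hp] := choose_power nu r0 r1.
pose rho := ((theta / b) ^+ 2) ^+ p.
have rho0 : 0 <= rho by rewrite !exprn_ge0.
pose C1 : R := n0%:R * d%:R * m%:R * ((((2 * K0).+1)%:R ^+ d) ^+ 2).
have C10 : 0 <= C1 by rewrite !mulr_ge0// !exprn_ge0.
have [Cst Cst0 ev] := rsum_event H1 H2 fB tau0 thetaE theta1 theta2 p0.
pose X := 1 + 4 * (C1 * Cst) / dl.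
have X1 : 1 <= X by rewrite lerDl divr_ge0 ?(ltW dl0)// !mulr_ge0.
have X0 : 0 < X by exact: lt_le_trans X1.
exists (eps / (2 * X)); first by rewrite divr_gt0// mulr_gt0.
move=> F K K00 Kle HF1 HF2.
have Kq : 2 * K / eps <= X^-1.
  rewrite ler_pdivrMr//; have := ler_wpM2l (ler0n R 2) Kle.
  suff -> : 2 * (eps / (2 * X)) = X^-1 * eps by [].
  by field; rewrite gt_eqF.
have Kq0 : 0 <= 2 * K / eps by rewrite divr_ge0 ?mulr_ge0// ltW.
have W0 : 0 <= Cst * ((2 * K / eps) ^+ 2) ^+ p.
  by apply: mulr_ge0 => //; apply: exprn_ge0; exact: exprn_ge0.
have tN N : 0 <= tau ^+ N by rewrite exprn_ge0// ltW.
have twoK : 0 <= 2 * K by rewrite mulr_ge0.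
have e0 k : 0 < eps * b ^+ k by rewrite mulr_gt0// exprn_gt0.
have bnd k : Cst * ((2 * K * theta ^+ k / (eps * b ^+ k)) ^+ 2) ^+ p =
    Cst * ((2 * K / eps) ^+ 2) ^+ p * rho ^+ k.
  have -> : (2 * K * theta ^+ k / (eps * b ^+ k)) ^+ 2 =
      (2 * K / eps) ^+ 2 * ((theta / b) ^+ 2) ^+ k.
    rewrite -(exprM _ 2 k) mulnC exprM -exprMn; congr (_ ^+ _).
    by rewrite expr_div_n; field; rewrite !gt_eqF// exprn_gt0.
  by rewrite exprMn mulrA; congr (_ * _); exact: exprAC.
have ins k (i : 'I_(n0 * 2 ^ k)) N j : descendant k i N j -> dt R N j.+1 <= n0%:R.
  move=> /(descendant_dt R)[_ h]; apply: (le_trans h).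
  have -> : n0%:R = dt R k (n0 * 2 ^ k) by rewrite /dt natrM natrX mulfK// expf_neq0.
  by rewrite le_dt.
have ev1 k (i : 'I_(n0 * 2 ^ k)) (r : 'I_d) (c : 'I_m) (z : 'cV[R]_d) :
  exists E : set Omega, [/\ measurable E,
    (P E <= (Cst * ((2 * K / eps) ^+ 2) ^+ p * rho ^+ k)%:E)%E &
    forall w, ~ E w -> forall N, (k <= N)%N ->
      `|rsum B c (fun t => F t z r c) N k i w| <= eps * b ^+ k].
  have [|E [mE pE hE]] := ev c (fun t => F t z r c) k i (2 * K) _ twoK (e0 k).
    move=> N j dj; rewrite -entryB; apply: (le_trans (mx_entry_le _ _ _)).
    by apply: HF1; exact: ins dj.
  by exists E; split => //; rewrite -bnd.
have ev2 k (i : 'I_(n0 * 2 ^ k)) (r : 'I_d) (c : 'I_m) (z z' : 'cV[R]_d) :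
  exists E : set Omega, [/\ measurable E,
    (P E <= (Cst * ((2 * K / eps) ^+ 2) ^+ p * rho ^+ k)%:E)%E &
    forall w, ~ E w -> forall N, (k <= N)%N ->
      `|rsum B c (fun t => F t z r c - F t z' r c) N k i w|
         <= eps * b ^+ k * `|z - z'| `^ gam].
  (* Equal points may give a zero threshold, which [rsum_event] excludes; the sum then vanishes and
     the empty event serves. *)
  have [zz|zz] := eqVneq z z'.
    exists set0; split => //.
      by rewrite measure0 lee_fin; apply: mulr_ge0 => //; exact: exprn_ge0.
    move=> w _ N kN; rewrite zz /rsum /dsum big1; last first.
      by move=> j _; rewrite !subrr !mul0r.
    by rewrite normr0; exact: mulr_ge0 (ltW (e0 k)) (powR_ge0 _ _).
  set D := `|z - z'| `^ gam.
  have D0 : 0 < D by rewrite powR_gt0// normr_gt0 subr_eq0.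
  have l0 : 0 < eps * b ^+ k * D by rewrite mulr_gt0.
  have L0 : 0 <= 2 * K * D by rewrite mulr_ge0// ltW.
  have [|E [mE pE hE]] := ev c (fun t => F t z r c - F t z' r c) k i _ _ L0 l0.
    move=> N j dj; rewrite subrACA -!entryB.
    apply: (le_trans (mx_entry_le _ _ _)); rewrite mulrAC.
    by apply: HF2; exact: ins dj.
  exists E; split => //; rewrite -bnd.
  suff -> : 2 * K * theta ^+ k / (eps * b ^+ k) = 2 * K * D * theta ^+ k / (eps * b ^+ k * D) by [].
  by field; rewrite !gt_eqF// exprn_gt0.
pose I k : finType := ('I_(n0 * 2 ^ k) * 'I_d * 'I_m * (grid_index d K0 k * grid_index d K0 k))%type.
pose E1 k (x : I k) := sval (cid (ev1 k x.1.1.1 x.1.1.2 x.1.2 (grid_pt R x.2.1))).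
have E1P k (x : I k) := svalP (cid (ev1 k x.1.1.1 x.1.1.2 x.1.2 (grid_pt R x.2.1))).
pose E2 k (x : I k) :=
  sval (cid (ev2 k x.1.1.1 x.1.1.2 x.1.2 (grid_pt R x.2.1) (grid_pt R x.2.2))).
have E2P k (x : I k) :=
  svalP (cid (ev2 k x.1.1.1 x.1.1.2 x.1.2 (grid_pt R x.2.1) (grid_pt R x.2.2))).
pose E k (x : I k) := E1 k x `|` E2 k x.
pose C2 := 2 * (Cst * ((2 * K / eps) ^+ 2) ^+ p).
have C20 : 0 <= C2 by apply: mulr_ge0.
have [|||A [mA pA hA]] := @family_event _ _ _ P I E C1 C2 nu rho C10 C20 nu0 rho0 hp.
- by move=> k x; apply: measurableU; [case: (E1P k x) | case: (E2P k x)].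
- move=> k; rewrite !card_prod !card_ord.
  have cg := card_grid_index d K0 k.
  apply: (@le_trans _ _ ((n0 * 2 ^ k * d * m * (((2 * K0).+1 * 2 ^ k) ^ d
      * ((2 * K0).+1 * 2 ^ k) ^ d))%:R)).
    by rewrite ler_nat leq_mul2l leq_mul ?orbT.
  rewrite /C1 /nu !natrM !natrX !natrM !natrX.
  rewrite le_eqVlt; apply/orP; left; apply/eqP.
  have e1 : (2 ^+ k : R) ^+ d = (2 ^+ d) ^+ k by exact: exprAC.
  have e2 : (2 * (2 ^+ d) ^+ 2 : R) ^+ k = 2 ^+ k * ((2 ^+ d) ^+ k) ^+ 2.
    by rewrite exprMn; congr (_ * _); exact: exprAC.
  by rewrite e2 exprMn e1; ring.
- move=> k x; case: (E1P k x) => m1 p1 _; case: (E2P k x) => m2 p2 _.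
  apply: (le_trans (prob_setU_le P m1 m2)); apply: (le_trans (leeD p1 p2)).
  rewrite -EFinD lee_fin /C2; set u := Cst * _; set v := rho ^+ k.
  by have -> : 2 * u * v = u * v + u * v by ring.
exists A; split => //.
  apply: (le_trans pA); rewrite lee_fin /C2.
  have le1 : ((2 * K / eps) ^+ 2) ^+ p <= X^-1.
    have Xi1 : X^-1 <= 1 by rewrite invf_le1.
    apply: (@le_trans _ _ (2 * K / eps)) => //.
    rewrite -exprM -[leRHS]expr1; apply: ler_exp_le1 => //; first exact: le_trans Xi1.
    by rewrite muln_gt0.
  apply: (@le_trans _ _ (2 * (C1 * (2 * (Cst * X^-1))))).
    by rewrite !(ler_wpM2l)// ?mulr_ge0.
  have -> : 2 * (C1 * (2 * (Cst * X^-1))) = 4 * (C1 * Cst) / X.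
    by field; rewrite gt_eqF.
  rewrite ler_pdivrMr// /X mulrDr mulr1 (mulrC dl (_ / dl)) divfK ?gt_eqF//.
  by rewrite lerDr ltW.
move=> w nA N k i kN it; have ik := dt_lt_ord it.
have b1 z r c : in_grid K0 k z ->
    `|rsum B c (fun t => F t z r c) N k i w| <= eps * b ^+ k.
  move=> [u ->]; case: (E1P k (Ordinal ik, r, c, (u, u))) => _ _; apply => //.
  by move=> h; apply: (hA w nA k (Ordinal ik, r, c, (u, u))); left.
have b2 z z' r c : in_grid K0 k z -> in_grid K0 k z' ->
    `|rsum B c (fun t => F t z r c - F t z' r c) N k i w|
       <= eps * b ^+ k * `|z - z'| `^ gam.
  move=> [u ->] [u' ->]; case: (E2P k (Ordinal ik, r, c, (u, u'))) => _ _; apply => //.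
  by move=> h; apply: (hA w nA k (Ordinal ik, r, c, (u, u'))); right.
split.
  move=> z hz; apply: mx_norm_leP => [|r c0]; first by rewrite -mulrA mulr_ge0// ltW.
  rewrite dsum_noise_entry; apply: (le_trans (ler_norm_sum _ _ _)).
  apply: (@le_trans _ _ (\sum_(c < m) eps * b ^+ k)).
    by apply: ler_sum => c _; exact: b1.
  by rewrite sumr_const card_ord -[leLHS]mulr_natl mulrA.
move=> z z' hz hz'; apply: mx_norm_leP => [|r c0].
  by rewrite -mulrA -mulrA mulrA mulr_ge0 ?mulr_ge0 ?powR_ge0// ?exprn_ge0 ?ltW.
rewrite entryB !dsum_noise_entry -sumrB; apply: (le_trans (ler_norm_sum _ _ _)).
apply: (@le_trans _ _ (\sum_(c < m) (eps * b ^+ k * `|z - z'| `^ gam))).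
  by apply: ler_sum => c _; rewrite rsumB; exact: b2.
by rewrite sumr_const card_ord -[leLHS]mulr_natl !mulrA.
Qed.

End NoiseEvent.

(** * Convergence in probability *)

Section Sums.
Variables (R : realType) (V : normedModType R).

Lemma young_driverD (b M M' : R) (Phi Phi' : nat -> nat -> V -> V) th :
  young_driver b M Phi th -> young_driver b M' Phi' th ->
  young_driver b (M + M') (fun k i v => Phi k i v + Phi' k i v) th.
Proof.
move=> h h' k i it; have [a1 a2 a3 a4] := h _ _ it; have [c1 c2 c3 c4] := h' _ _ it.
split.
- by move=> v; rewrite a1 c1 addrACA.
- by move=> v; apply: (le_trans (ler_normD _ _)); rewrite mulrDl lerD.
- move=> v w; rewrite opprD addrACA.
  by apply: (le_trans (ler_normD _ _)); rewrite !mulrDl lerD.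
- move=> v w v' w'; have aux (p p' r r' : V) : p + p' - (r + r') = (p - r) + (p' - r').
    by rewrite opprD addrACA.
  rewrite (aux _ _ (Phi k i w')) (aux _ _ (Phi k i w)) aux.
  by apply: (le_trans (ler_normD _ _)); rewrite !(mulrDl _ _ (b ^+ k)) (mulrDl _ _ (_ + _)) lerD.
Qed.

Lemma small_noiseD (b gam e e' : R) psi psi' (net : nat -> V -> Prop) th :
  small_noise b gam psi net e th -> small_noise b gam psi' net e' th ->
  small_noise b gam (fun N j z => psi N j z + psi' N j z) net (e + e') th.
Proof.
move=> h h' N k i kN it; have [a1 a2] := h _ _ _ kN it; have [c1 c2] := h' _ _ _ kN it.
split=> [z nz|z z' nz nz'].
  rewrite dsumD mulrDl; apply: (le_trans (ler_normD _ _)).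
  by apply: lerD; [exact: a1 | exact: c1].
rewrite !dsumD opprD addrACA !mulrDl; apply: (le_trans (ler_normD _ _)).
by apply: lerD; [exact: a2 | exact: c2].
Qed.

Lemma small_noise_eps (b gam e e' : R) psi (net : nat -> V -> Prop) th :
  0 <= b -> e <= e' -> small_noise b gam psi net e th -> small_noise b gam psi net e' th.
Proof.
move=> b0 ee h N k i kN it; have [a1 a2] := h _ _ _ kN it.
have ek : e * b ^+ k <= e' * b ^+ k by rewrite ler_wpM2r// exprn_ge0.
split=> [z nz|z z' nz nz']; first exact: le_trans (a1 z nz) ek.
by apply: (le_trans (a2 _ _ nz nz')); rewrite ler_wpM2r// powR_ge0.
Qed.

End Sums.

(** * The drift as a Young term driven by time *)

Section Drift.
Variables (R : realType) (d : nat).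

Lemma timepB (s t : R) : timep t - timep s = (t - s)%:M.
Proof. by apply/matrixP => i j; rewrite !mxE (ord1 i) (ord1 j) eqxx. Qed.

Lemma timep_dt k i : timep (dt R k i.+1) - timep (dt R k i) = ((2 ^+ k)^-1)%:M.
Proof. by rewrite timepB dtS addrAC subrr add0r. Qed.

Lemma timep_increment (b : R) k i : 2^-1 <= b ->
  `|timep (dt R k i.+1) - timep (dt R k i)| <= 1 * b ^+ k.
Proof.
move=> hb; have b0 : 0 <= b by apply: le_trans hb; rewrite invr_ge0.
rewrite timep_dt mul1r; apply: mx_norm_leP => [|r c]; first by rewrite exprn_ge0.
rewrite mxE (ord1 r) (ord1 c) eqxx mulr1n ger0_norm ?invr_ge0 ?exprn_ge0//.
by rewrite -exprVn lerXn2r ?nnegrE// invr_ge0.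
Qed.

(** Against the path [t] the factors [2 ^+ N] and [2 ^- N] cancel, and the sum telescopes to the
    increment of [G] over the cell, for every [N]. The bound is therefore deterministic and valid on
    any net. *)
Lemma drift_small_noise (b gam tau K : R) (n0 : nat) (net : nat -> 'cV[R]_d -> Prop)
    (G : R -> 'cV[R]_d -> 'M[R]_(d, 1)) : 0 <= K -> 0 <= tau -> tau <= b ->
  (forall N j z, dt R N j.+1 <= n0%:R ->
     `|G (dt R N j.+1) z - G (dt R N j) z| <= K * tau ^+ N) ->
  (forall N j z z', dt R N j.+1 <= n0%:R ->
     `|G (dt R N j.+1) z - G (dt R N j) z - (G (dt R N j.+1) z' - G (dt R N j) z')|
        <= K * tau ^+ N * `|z - z'| `^ gam) ->
  small_noise b gam (noise_part G (@timep R)) net K n0%:R.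
Proof.
move=> K0 t0 tb G1 G2 N k i kN it.
have E z : dsum N k i (noise_part G (@timep R) N ^~ z) =
    G (dt R k i.+1) z - G (dt R k i) z.
  have E1 : dsum N k i (noise_part G (@timep R) N ^~ z) =
      dsum N k i (fun j => G (dt R N j.+1) z - G (dt R N j) z).
    apply: eq_bigr => j _; rewrite /noise_part timep_dt scale_scalar_mx.
    by rewrite divff ?mulmx1// expf_neq0.
  rewrite E1 /dsum telescope_sumr; last by rewrite leq_mul2l leqnSn orbT.
  have e l : dt R N (2 ^ (N - k) * l) = dt R k l by rewrite -{1}(subnKC kN) dt_scale.
  by rewrite !e.
have tk : K * tau ^+ k <= K * b ^+ k.
  by rewrite ler_wpM2l// lerXn2r ?nnegrE// (le_trans t0).
split=> [z _|z z' _ _]; rewrite !E; first exact: le_trans (G1 _ _ _ it) tk.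
by apply: (le_trans (G2 _ _ _ _ it)); rewrite ler_wpM2r// powR_ge0.
Qed.

(** Lowering the exponent from [gamma] to [gam] is free for points at distance at most one. Farther
    apart the two one-point bounds are added, which is the source of the factor [2]. *)
Lemma fhat_dyadic (kappa gamma gam K tau : R) (q n0 : nat)
    (f : R -> 'cV[R]_d -> 'M[R]_(d, q)) :
  0 <= K -> 0 < gam -> gam <= gamma -> tau = 2 `^ (- (1 - kappa)) ->
  (forall s t (x y : 'cV[R]_d), 0 <= s -> 0 <= t -> `|t - s| <= 1 ->
      `|fhat f t x - fhat f s x| <= K * `|t - s| `^ (1 - kappa) /\
      `|fhat f t x - fhat f s x - fhat f t y + fhat f s y|
         <= K * `|t - s| `^ (1 - kappa) * `|x - y| `^ gamma) ->
  (forall N j z, dt R N j.+1 <= n0%:R ->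
     `|fhat f (dt R N j.+1) z - fhat f (dt R N j) z| <= 2 * K * tau ^+ N) /\
  (forall N j z z', dt R N j.+1 <= n0%:R ->
     `|fhat f (dt R N j.+1) z - fhat f (dt R N j) z
       - (fhat f (dt R N j.+1) z' - fhat f (dt R N j) z')|
        <= 2 * K * tau ^+ N * `|z - z'| `^ gam).
Proof.
move=> K0 g0 gg tE HK.
have Et N j : `|dt R N j.+1 - dt R N j| = (2 ^+ N)^-1.
  by rewrite dtS addrAC subrr add0r ger0_norm ?invr_ge0 ?exprn_ge0.
have E1 N j : `|dt R N j.+1 - dt R N j| `^ (1 - kappa) = tau ^+ N.
  rewrite Et tE -[RHS]powR_mulrn ?powR_ge0// -powRrM -powR_inv1 ?exprn_ge0//.
  by rewrite -powR_mulrn// -!powRrM; congr (_ `^ _); ring.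
have le1 N j : `|dt R N j.+1 - dt R N j| <= 1.
  by rewrite Et invf_le1 ?exprn_gt0// exprn_ege1// ler1n.
have t0 N : 0 <= tau ^+ N by rewrite exprn_ge0// tE powR_ge0.
have A1 N j z : `|fhat f (dt R N j.+1) z - fhat f (dt R N j) z| <= K * tau ^+ N.
  have [h _] := HK _ _ z z (dt_ge0 R N j) (dt_ge0 R N j.+1) (le1 N j).
  by rewrite E1 in h.
split=> [N j z _|N j z z' _].
  by apply: (le_trans (A1 N j z)); rewrite -mulrA mulr_natl mulr2n lerDl mulr_ge0.
have [_ h] := HK _ _ z z' (dt_ge0 R N j) (dt_ge0 R N j.+1) (le1 N j).
rewrite E1 in h.
have KT : 0 <= K * tau ^+ N by rewrite mulr_ge0.
have [z1|z1] := leP `|z - z'| 1.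
  rewrite opprB [in leLHS]addrA addrAC; apply: (le_trans h).
  rewrite -(mulrA 2) -(mulrA 2) mulr_natl mulr2n.
  have le : `|z - z'| `^ gamma <= `|z - z'| `^ gam.
    have [->|zn] := eqVneq `|z - z'| 0.
      by rewrite !powR0// gt_eqF// (lt_le_trans g0).
    by apply: ger_powR => //; rewrite lt_neqAle eq_sym zn normr_ge0.
  apply: (le_trans (ler_wpM2l KT le)); rewrite lerDl mulr_ge0// powR_ge0.
apply: (le_trans (ler_normB _ _)); apply: (le_trans (lerD (A1 N j z) (A1 N j z'))).
have -> : K * tau ^+ N + K * tau ^+ N = 2 * K * tau ^+ N by ring.
rewrite ler_peMr// ?mulr_ge0//.
by rewrite -[leLHS](powRr0 `|z - z'|); apply: ler_powR; exact: ltW.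
Qed.

End Drift.

Section ConvProb.
Variables (R : realType) (d0 : measure_display) (Omega : measurableType d0).
Variable P : probability Omega R.

(** One sequence of events must serve all accuracies. Intersecting over [j] those obtained for
    [dl = 1 / (j + 1)] keeps the enclosure, and the probability is eventually below each such
    [dl]. *)
Lemma conv_prob_of_eventual (alpha : R) (d : nat)
    (xn : nat -> Omega -> R -> 'cV[R]_d) (x : Omega -> R -> 'cV[R]_d) :
  (forall T e dl : R, 0 < T -> 0 < e -> 0 < dl -> exists n1 : nat, forall n,
     exists A : set Omega, [/\ measurable A,
       [set w | (e%:E < hnorm alpha T (fun t => (xn n w t - x w t)%R))%E] `<=` A &
       (n1 <= n)%N -> (P A <= dl%:E)%E]) ->
  conv_prob_Calpha P alpha xn x.
Proof.
move=> H T T0 e e0.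
have dj j : 0 < (j.+1%:R)^-1 :> R by rewrite invr_gt0.
pose n1 j := sval (cid (H T e _ T0 e0 (dj j))).
have Hn j := svalP (cid (H T e _ T0 e0 (dj j))).
pose A j n := sval (cid (Hn j n)).
have AP j n := svalP (cid (Hn j n)).
exists (fun n => \bigcap_j A j n); split.
- by move=> n; apply: bigcap_measurable => // j _; case: (AP j n).
- by move=> n w bad j _; case: (AP j n) => _ + _; exact.
have mI n : measurable (\bigcap_j A j n).
  by apply: bigcap_measurable => // j _; case: (AP j n).
apply/fine_cvgP; split.
  by apply: nearW => n; exact: fin_num_measure.
apply/cvgrPdist_le => dl dl0.
have [j hj] : exists j, (j.+1%:R)^-1 <= dl.
  exists (Num.truncn dl^-1); rewrite invf_ple ?posrE//.
  by apply: ltW; exact: truncnS_gt.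
exists (n1 j) => // n /= jn.
rewrite sub0r normrN ger0_norm ?fine_ge0//.
rewrite -lee_fin fineK ?fin_num_measure//.
apply: (@le_trans _ _ (P (A j n))).
  apply: le_measure; rewrite ?inE//; first by case: (AP j n).
  by move=> w; apply.
have [_ _ /(_ jn) h] := AP j n.
by apply: (le_trans h); rewrite lee_fin.
Qed.

End ConvProb.

Section Arithmetic.
Variable R : realType.

Lemma half_add_quarters (u v r : R) : u <= r / 2 -> v <= r / 4 -> u + 2 * v <= r.
Proof. by lra. Qed.

Lemma two_quarters_le (r : R) : 0 < r -> r / 4 + r / 4 <= r.
Proof. by lra. Qed.

(** In [3 + C] one unit pays for the supremum, two for Hoelder quotients at distance above one, and
    [C] for those at shorter distance. Taking [D + 1] instead of [D] bounds [e] itself as well. *)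
Lemma scale_budget (D e C M : R) : 0 < e -> 0 <= D * e -> 0 <= D * e * C ->
  0 <= e * C -> (D + 1) * e * (3 + C) = M ->
  [/\ e <= M, D * e <= M & D * e + (D * e * C + 2 * (D * e)) <= M].
Proof. by move=> ? ? ? ? <-; split; lra. Qed.

End Arithmetic.

(** * Young solutions as dyadic equations with noise *)

Section Solutions.
Variables (R : realType) (d m : nat) (b zeta : R) (n0 : nat).
Hypotheses (b0 : 0 < b) (hb : 2^-1 <= b).
Hypotheses (z0 : 0 < zeta) (z1 : zeta <= 1) (zb : 2 * (2 `^ (- zeta) * b) < 1).

(** The empty list is a partition of [[0, 0]], with mesh and Riemann sum zero. *)
Lemma young_int_at0 (q : nat) (y : R -> 'M[R]_(d, q)) (bp : R -> 'cV[R]_q) I :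
  young_int y bp 0 0 I -> I = 0.
Proof.
move=> HI; apply/eqP; rewrite -normr_le0; apply/ler_addgt0Pr => e e0.
have [dl dl0 h] := HI _ e0; have := h [::].
rewrite /is_part /= eqxx => /(_ isT); rewrite /mesh big_nil => /(_ dl0).
by rewrite /RSsum big_nil sub0r normrN add0r => /ltW.
Qed.

Variables (fb : 'cV[R]_d -> 'M[R]_(d, m)) (gb : 'cV[R]_d -> 'cV[R]_d).
Variables (bp : R -> 'cV[R]_m) (x0 : 'cV[R]_d).

Let Phi k i v := driver_part fb bp k i v + driver_part gb (@timep R) k i v.

Lemma young_sol_drift_at0 alpha f g x :
  young_sol_drift alpha f g bp x0 x -> x 0 = x0.
Proof.
move=> [_ /(_ 0 (lexx _))[I [J [/young_int_at0 -> /young_int_at0 -> ->]]]].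
by rewrite !addr0.
Qed.

Lemma sol_drift_dsum alpha f g x : young_sol_drift alpha f g bp x0 x ->
  forall k i e, 0 < e -> exists N0, forall N, (N0 <= N)%N ->
  `|dsum N k i (fun j => f (dt R N j) (x (dt R N j)) *m
                           (bp (dt R N j.+1) - bp (dt R N j)))
    + dsum N k i (fun j => g (dt R N j) (x (dt R N j)) *m
                           (timep (dt R N j.+1) - timep (dt R N j)))
    - (x (dt R k i.+1) - x (dt R k i))| <= e.
Proof.
move=> [_ sol] k i e e0.
have [I [J [hI hJ ->]]] := sol _ (dt_ge0 R k i).
have [I' [J' [hI' hJ' ->]]] := sol _ (dt_ge0 R k i.+1).
have e2 : 0 < e / 2 by rewrite divr_gt0.
have [N1 h1] := young_int_dsum hI hI' e2; have [N2 h2] := young_int_dsum hJ hJ' e2.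
exists (maxn N1 N2) => N; rewrite geq_max => /andP[N1N N2N].
have {}h1 := h1 _ N1N; have {}h2 := h2 _ N2N.
have -> : x0 + I' + J' - (x0 + I + J) = (I' - I) + (J' - J).
  by rewrite opprD addrACA; congr (_ + _); rewrite opprD addrACA subrr add0r.
rewrite opprD addrACA; apply: (le_trans (ler_normD _ _)).
by apply: (le_trans (lerD h1 h2)); lra.
Qed.

Lemma limit_sol_approx alpha x :
  young_sol_drift alpha (fun _ => fb) (fun _ => gb) bp x0 x ->
  approx_sol Phi (fun _ _ _ => 0) (fun _ => id) x n0%:R.
Proof.
move=> sol k i it e e0; have [N0 h] := sol_drift_dsum sol k i e0.
exists N0 => N N0N; have := h _ N0N; rewrite -dsumD.
suff -> : dsum N k i (fun j => Phi N j (x (dt R N j)) + 0) =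
  dsum N k i (fun j => Phi N j (x (dt R N j))) by [].
by apply: eq_bigr => j _; exact: addr0.
Qed.

Lemma perturbed_sol_approx alpha f g pi y (Lb M : R) : 0 <= Lb -> 0 <= M ->
  Cz2 zeta f -> Cz2 zeta g ->
  (forall x y, `|fb x - fb y| <= Lb * `|x - y|) ->
  (forall x y, `|gb x - gb y| <= Lb * `|x - y|) ->
  (forall k i, dt R k i.+1 <= n0%:R ->
     `|bp (dt R k i.+1) - bp (dt R k i)| <= M * b ^+ k) ->
  (forall k v, `|pi k v - v| <= (2 ^+ k)^-1) ->
  young_sol_drift alpha f g bp x0 y ->
  approx_sol Phi (fun N j z =>
      noise_part (fhat (fun t z => f t z - fb z)) bp N j z
      + noise_part (fhat (fun t z => g t z - gb z)) (@timep R) N j z) pi y n0%:R.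
Proof.
move=> L0 M0 Hf Hg lf lg HB Hpi sol k i it e e0.
have e3 : 0 < e / 3 by rewrite divr_gt0.
have [N1 h1] := sol_drift_dsum sol k i e3.
have [N2 h2] := approx_part b0 y z0 z1 zb L0 M0 Hf lf HB Hpi it e3.
have tinc k' i' : dt R k' i'.+1 <= n0%:R ->
   `|timep (dt R k' i'.+1) - timep (dt R k' i')| <= 1 * b ^+ k'.
  by move=> _; exact: timep_increment.
have [N3 h3] := approx_part b0 y z0 z1 zb L0 ler01 Hg lg tinc Hpi it e3.
exists (maxn N1 (maxn N2 N3)) => N; rewrite !geq_max => /and3P[N1N N2N N3N].
have {}h1 := h1 _ N1N; have {}h2 := h2 _ N2N; have {}h3 := h3 _ N3N.
have -> : dsum N k i (fun j => Phi N j (y (dt R N j)) +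
   (noise_part (fhat (fun t z => f t z - fb z)) bp N j (pi N (y (dt R N j)))
   + noise_part (fhat (fun t z => g t z - gb z)) (@timep R) N j (pi N (y (dt R N j)))))
  = dsum N k i (fun j => driver_part fb bp N j (y (dt R N j)) +
       noise_part (fhat (fun t z => f t z - fb z)) bp N j (pi N (y (dt R N j))))
  + dsum N k i (fun j => driver_part gb (@timep R) N j (y (dt R N j)) +
       noise_part (fhat (fun t z => g t z - gb z)) (@timep R) N j (pi N (y (dt R N j)))).
  by rewrite -dsumD; apply: eq_bigr => j _; rewrite /Phi addrACA.
set S1 := dsum _ _ _ _ in h2 *; set S2 := dsum _ _ _ _ in h3 *.
set S3 := dsum _ _ _ _ in h1 h2; set S4 := dsum _ _ _ _ in h1 h3.
have -> : S1 + S2 - (y (dt R k i.+1) - y (dt R k i)) =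
  ((S1 - S3) + (S2 - S4)) + (S3 + S4 - (y (dt R k i.+1) - y (dt R k i))).
  by rewrite addrACA -opprD subrKA.
apply: (le_trans (ler_normD _ _)).
apply: (le_trans (lerD (le_trans (ler_normD _ _) (lerD h2 h3)) h1)); lra.
Qed.

End Solutions.

Section Main.
Variables (R : realType) (d m : nat) (d0 : measure_display).
Variables (Omega : measurableType d0) (P : probability Omega R) (H : R).
Variables (B : R -> Omega -> 'cV[R]_m) (alpha kappa gamma zeta : R) (x0 : 'cV[R]_d).
Hypotheses (H1 : 1 / 2 < H) (H2 : H < 1) (fB : is_fBm P H B).
Hypotheses (kap0 : 0 < kappa) (gam0 : 0 < gamma) (al2 : 1 / 2 < alpha).
Hypotheses (Hk : 1 / 2 < H - kappa) (Hkg : 1 < H - kappa + gamma * alpha).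
Hypotheses (alH : alpha < H - kappa) (alz : alpha < zeta) (z1 : zeta <= 1).

Lemma powR2_mul (x y : R) : 2 `^ x * 2 `^ y = 2 `^ (x + y) :> R.
Proof. by rewrite powRD// pnatr_eq0 implybT. Qed.

(** The order of choices matters: horizon and probability fix the constant [M] of [B]; it determines
    [D], hence the radius [K0] and, with the accuracy, [eps]; these fix the noise threshold [etaN],
    and [n] is taken large last. The bad event joins those for [B] and for the noise, of probability
    at most [dl / 4] each, with the null set where the equations fail. *)
Lemma drift_conv_prob (fn : nat -> R -> 'cV[R]_d -> 'M[R]_(d, m))
    (fb : 'cV[R]_d -> 'M[R]_(d, m))
    (gn : nat -> R -> 'cV[R]_d -> 'cV[R]_d) (gb : 'cV[R]_d -> 'cV[R]_d)
    (xn : nat -> Omega -> R -> 'cV[R]_d) (x : Omega -> R -> 'cV[R]_d) :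
  (forall n, Cz2 zeta (fn n)) -> isBC2 fb ->
  (fun n => negnorm kappa gamma (fun t y => fn n t y - fb y)) @ \oo --> 0%E ->
  (forall n, Cz2 zeta (gn n)) -> isBC2 gb ->
  (fun n => negnorm kappa gamma (fun t y => gn n t y - gb y)) @ \oo --> 0%E ->
  {ae P, forall w,
     (forall n, young_sol_drift alpha (fn n) (gn n) (fun t => B t w) x0 (xn n w))
     /\ young_sol_drift alpha (fun _ => fb) (fun _ => gb) (fun t => B t w) x0 (x w)} ->
  conv_prob_Calpha P alpha xn x.
Proof.
move=> Cf bf cf Cg bg cg [Nul [mNul pNul subNul]].
pose gam := Num.min gamma 1.
have gam_gt0 : 0 < gam by rewrite lt_min gam0 ltr01.
have gam_le1 : gam <= 1 by rewrite ge_min lexx orbT.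
have gam_le : gam <= gamma by rewrite ge_min lexx.
have al0 : 0 < alpha by move: al2; lra.
have z0 : 0 < zeta by exact: lt_trans alz.
(* When [gam] is [1] instead of [gamma], the inequality holds because [H - kappa] and [alpha] both
   exceed one half. *)
have gk : 1 < H - kappa + gam * alpha.
  rewrite /gam minEle; case: ifP => _ //.
  by rewrite mul1r; move: Hk al2; lra.
(* Above [alpha] the exponent allows absorption on short cells, above [1 - gam * alpha] it makes the
   noise sewable, and below [H - kappa] it leaves room for the union bound. *)
have [eta [eta1 eta2 eta3]] : exists eta,
    [/\ alpha < eta, 1 - gam * alpha < eta & eta < H - kappa].
  exists ((Num.max alpha (1 - gam * alpha) + (H - kappa)) / 2).
  have mx : Num.max alpha (1 - gam * alpha) < H - kappa.
    by rewrite gt_max alH/= ltrBlDr.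
  have h1 : alpha <= Num.max alpha (1 - gam * alpha) by rewrite le_max lexx.
  have h2 : 1 - gam * alpha <= Num.max alpha (1 - gam * alpha).
    by rewrite le_max lexx orbT.
  by split; move: mx h1 h2; set M := Num.max _ _; lra.
have H2' := H2; have H1' := H1; have kap0' := kap0; have al2' := al2; have z1' := z1.
have alz' := alz; have Hk' := Hk.
have [a aE] : exists a, a = 2 `^ (- alpha) :> R by eexists.
have [b bE] : exists b, b = 2 `^ (- eta) :> R by eexists.
have [tau tauE] : exists tau, tau = 2 `^ (- (1 - kappa)) :> R by eexists.
have [theta thE] : exists theta, theta = 2 `^ (- (H - kappa)) :> R by eexists.
have b0 : 0 < b by rewrite bE powR_gt0.
have ba : b < a by rewrite bE aE powR2_ltr// ltrN2.
have a1 : a < 1 by rewrite aE powR2_lt1// oppr_lt0.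
have two1 : 2 `^ 1 = 2 :> R by rewrite powRr1.
have half x' : x' <= 1 -> 2^-1 <= 2 `^ (- x') :> R.
  move=> h; rewrite -(powR_inv1 (ler0n _ 2)); apply: ler_powR; first by rewrite ler1n.
  by rewrite lerN2.
have hb : 2^-1 <= b by rewrite bE half//; move: eta3 H2' kap0'; lra.
have ha : 2^-1 <= a by exact: le_trans hb (ltW ba).
have bg1 : 2 * (b * a `^ gam) < 1.
  rewrite bE aE -powRrM -{1}two1 !powR2_mul powR2_lt1//; move: eta2.
  by rewrite mulNr (mulrC alpha); lra.
have zb : 2 * (2 `^ (- zeta) * b) < 1.
  by rewrite bE -{1}two1 !powR2_mul powR2_lt1//; move: eta1 alz' al2'; lra.
have tau0 : 0 < tau by rewrite tauE powR_gt0.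
have taub : tau <= b by rewrite tauE bE ltW// powR2_ltr//; move: eta3 H2'; lra.
have thetaE : theta = 2 * tau * 2 `^ (- H).
  by rewrite thE tauE -{2}two1 !powR2_mul; congr (_ `^ _); ring.
have th1 : theta < 1 by rewrite thE powR2_lt1//; move: Hk'; lra.
have th2 : 2 * theta ^+ 2 < 1.
  rewrite thE expr2 -{1}two1 !powR2_mul powR2_lt1//; move: Hk'; lra.
have thb : theta < b by rewrite thE bE powR2_ltr// ltrN2.
have Hb : 2 `^ (- H) < b by rewrite bE powR2_ltr// ltrN2; move: eta3 kap0'; lra.
apply: conv_prob_of_eventual => T e dl T0 e0 dl0.
pose n0 := (Num.truncn T).+1.
have Tn0 : T <= n0%:R by apply: ltW; exact: truncnS_gt.
have dl4 : 0 < dl / 4 by rewrite divr_gt0.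
have [M M0 [AB [mAB pAB hAB]]] := fbm_increment_event H1 H2 fB n0 dl4 Hb.
have [Lf Lf0 [f1 f2 f3]] := isBC2_bounds bf.
have [Lg Lg0 [g1 g2 g3]] := isBC2_bounds bg.
pose Mt := m%:R * Lf * M + 1%:R * Lg * 1.
have Mt0 : 0 <= Mt by rewrite addr_ge0// !mulr_ge0.
have [D D0 path] := @pathwise_conclusion R 'cV[R]_d a b gam Mt b0 ba a1 gam_gt0
  gam_le1 bg1 Mt0 _ _ erefl erefl n0.
pose K0 := (Num.truncn (`|x0| + D + 2)).+1.
have hK0 : `|x0| + D + 2 <= K0%:R by apply: ltW; exact: truncnS_gt.
pose Ca := (1 + 2 * (1 - a)^-1) / a.
have a0 : 0 < a by exact: lt_trans ba.
have Ca0 : 0 <= Ca.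
  by rewrite divr_ge0 ?(ltW a0)// addr_ge0// mulr_ge0// invr_ge0 subr_ge0 ltW.
pose eps := Num.min 1 e / ((D + 1) * (3 + Ca)).
have D1 : 0 < D + 1 by rewrite ltr_wpDl.
have Ca3 : 0 < 3 + Ca by rewrite ltr_wpDr.
have Dp : 0 < (D + 1) * (3 + Ca) by rewrite mulr_gt0.
have me0 : 0 < Num.min 1 e by rewrite lt_min ltr01.
have eps0 : 0 < eps by rewrite divr_gt0.
have epsE : (D + 1) * eps * (3 + Ca) = Num.min 1 e.
  by rewrite /eps mulrAC mulrC divfK// gt_eqF.
have me1 : Num.min 1 e <= 1 by rewrite ge_min lexx.
have mee : Num.min 1 e <= e by rewrite ge_min lexx orbT.
have De0 : 0 <= D * eps by rewrite mulr_ge0// ltW.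
have W0 : 0 <= D * eps * Ca by rewrite mulr_ge0.
have W1 : 0 <= eps * Ca by rewrite mulr_ge0// ltW.
have [ee1 ee2 ee3] := scale_budget eps0 De0 W0 W1 epsE.
have eps1 : eps <= 1 by exact: le_trans ee1 me1.
have Deps1 : D * eps <= 1 by exact: le_trans ee2 me1.
have Depse : D * eps + (D * eps * Ca + 2 * (D * eps)) <= e.
  exact: le_trans ee3 mee.
pose epsn := eps / (2 * (m%:R + 1)).
have m1 : 0 < m%:R + 1 :> R by rewrite ltr_wpDl.
have epsn0 : 0 < epsn by rewrite divr_gt0// mulr_gt0.
have mepsn : m%:R * epsn <= eps / 2.
  have -> : m%:R * epsn = eps / 2 * (m%:R / (m%:R + 1)).
    by rewrite /epsn; field; rewrite gt_eqF.
  apply: ler_piMr; first exact: divr_ge0 (ltW eps0) (ler0n _ 2).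
  by rewrite ler_pdivrMr// mul1r lerDl.
have [etaN etaN0 nev] := @noise_event R d0 Omega P H m d B H1 H2 fB tau theta b gam
  tau0 thetaE th1 th2 thb n0 K0 epsn (dl / 4) epsn0 dl4.
have [n1 hn1] := negnorm_cvg0 etaN0 cf.
have eps4 : 0 < eps / 4 by rewrite divr_gt0.
have [n2 hn2] := negnorm_cvg0 eps4 cg.
exists (maxn n1 n2) => n.
(* An enclosing event is demanded for every [n]; the whole space serves for small [n], where no
   probability is claimed. *)
have [nn|] := leqP (maxn n1 n2) n; last first.
  by move=> _; exists setT; split.
move: (nn); rewrite geq_max => /andP[n1n n2n].
have [K [K00 KetaN HK]] := hn1 _ n1n; have [K' [K'0 K'eps HK']] := hn2 _ n2n.
have [F1 F2] := fhat_dyadic n0 K00 gam_gt0 gam_le tauE HK.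
have [G1 G2] := fhat_dyadic n0 K'0 gam_gt0 gam_le tauE HK'.
have [AN [mAN pAN hAN]] := nev _ _ K00 KetaN F1 F2.
exists (AB `|` (Nul `|` AN)); split.
- by do 2 apply: measurableU => //.
- move=> w /= bad; apply: contrapT => nA.
  have nAB : ~ AB w by move=> h; apply: nA; left.
  have nNul : ~ Nul w by move=> h; apply: nA; right; left.
  have nAN : ~ AN w by move=> h; apply: nA; right; right.
  have [/(_ n) soly solx] : (forall n, young_sol_drift alpha (fn n) (gn n) (fun t => B t w) x0 (xn n w))
     /\ young_sol_drift alpha (fun _ => fb) (fun _ => gb) (fun t => B t w) x0 (x w).
    by apply: contrapT => nh; apply: nNul; apply: subNul.
  have incB := hAB w nAB.
  have tinc k i : dt R k i.+1 <= n0%:R ->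
      `|timep (dt R k i.+1) - timep (dt R k i)| <= 1 * b ^+ k.
    by move=> _; exact: timep_increment.
  have dr1 := driver_part_young (bp := fun t => B t w) b0 Lf0 M0 f1 f2 f3 incB.
  have dr2 := driver_part_young b0 Lg0 ler01 g1 g2 g3 tinc.
  have dr := young_driverD dr1 dr2.
  have K'2 : 0 <= 2 * K' by rewrite mulr_ge0.
  have sn := small_noiseD (hAN w nAN)
    (drift_small_noise (in_grid K0) K'2 (ltW tau0) taub G1 G2).
  have see : m%:R * epsn + 2 * K' <= eps.
    exact: half_add_quarters.
  have {}sn := small_noise_eps (ltW b0) see sn.
  have Lb0 : 0 <= Lf + Lg by rewrite addr_ge0.
  have lf u v : `|fb u - fb v| <= (Lf + Lg) * `|u - v|.
    by apply: (le_trans (f2 _ _)); rewrite ler_wpM2r// lerDl.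
  have lg u v : `|gb u - gb v| <= (Lf + Lg) * `|u - v|.
    by apply: (le_trans (g2 _ _)); rewrite ler_wpM2r// lerDr.
  have asy := perturbed_sol_approx (bp := fun t => B t w) b0 hb z0 z1 zb Lb0 M0 (Cf n) (Cg n) lf lg incB
     (@dround_dist R d) soly.
  have asx := limit_sol_approx (n0 := n0) solx.
  have rnd k (v : 'cV[R]_d) : `|dround k v - v| <= a ^+ k.
    apply: (le_trans (dround_dist _ _)); rewrite -exprVn lerXn2r ?nnegrE ?invr_ge0//.
    exact: ltW.
  have x00 := young_sol_drift_at0 solx; have y00 := young_sol_drift_at0 soly.
  have xy0 : x w 0 = xn n w 0 by rewrite x00 y00.
  have hK : `|x w 0| + D + 2 <= K0%:R by rewrite x00.
  have ux := holder_ucont n0 al0 solx.1; have uy := holder_ucont n0 al0 soly.1.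
  have [r1 r2] := path _ _ _ _ _ _ _ K0%:R (ltW eps0) eps1 Deps1 dr sn
    (@in_gridS R d K0) (@dround_in_grid R d K0) rnd asy asx
    (holder_dyadic n0 al0 aE solx.1) (holder_dyadic n0 al0 aE soly.1) xy0 hK uy.
  have uz := ucontB uy ux.
  have sup t : 0 <= t -> t <= n0%:R -> `|xn n w t - x w t| <= D * eps.
    by move=> t0 tn; apply: (sup_of_dyadic uz t0 tn r2).
  suff hn : (hnorm alpha T (fun t => (xn n w t - x w t)%R) <= e%:E)%E.
    by move: bad; rewrite ltNge hn.
  have := @hnorm_le R alpha T (D * eps) (D * eps * Ca + 2 * (D * eps)) d
    (fun t => xn n w t - x w t).
  move=> hn; apply: (le_trans (hn _ _)); last by rewrite lee_fin.
    by move=> t t0 tT; apply: sup => //; exact: le_trans Tn0.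
  move=> s t s0 st tT.
  have tn := le_trans tT Tn0.
  have pw0 := powR_ge0 (t - s) alpha.
  have [ts|ts] := leP (t - s) 1.
    apply: (le_trans (holder_of_dyadic al0 aE a1 De0 uz s0 st tn ts r1)).
    by rewrite ler_wpM2r// lerDl mulr_ge0.
  (* At distance above one the supremum bound suffices, as the power [alpha] of [t - s] is at least
     one. *)
  apply: (@le_trans _ _ (2 * (D * eps))).
    apply: (le_trans (ler_normB _ _)); rewrite mulr_natl mulr2n lerD// sup//.
      by apply: le_trans s0 (ltW st).
    exact: le_trans (ltW st) tn.
  apply: (@le_trans _ _ (D * eps * Ca + 2 * (D * eps))); first by rewrite lerDr.
  apply: ler_peMr; first by rewrite addr_ge0// mulr_ge0.
  by have := ler_powR (ltW ts) (ltW al0); rewrite powRr0.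
move=> _; apply: (le_trans (prob_setU_le P mAB (measurableU _ _ mNul mAN))).
have h := prob_setU_le P mNul mAN; rewrite pNul add0e in h.
apply: (le_trans (leeD pAB (le_trans h pAN))); rewrite -EFinD lee_fin.
exact: two_quarters_le.
Qed.


End Main.

(** * The driftless equation as the case of zero drift *)

Section NoDrift.
Variables (R : realType) (d m : nat) (alpha kappa gamma zeta : R) (x0 : 'cV[R]_d).

Lemma nodrift_sol (f : R -> 'cV[R]_d -> 'M[R]_(d, m)) (bp : R -> 'cV[R]_m) x :
  young_sol alpha f bp x0 x ->
  young_sol_drift alpha f (fun _ _ => 0) bp x0 x.
Proof.
move=> [hx sol]; split => // t t0; have [I [hI ->]] := sol t t0.
exists I, 0; split => //; last by rewrite addr0.
move=> e e0; exists 1 => // p _ _.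
by rewrite /RSsum big1 ?subrr ?normr0// => uv _; exact: mul0mx.
Qed.


Lemma isBC2_0 (k : nat) : @isBC2 R d k (fun _ => 0).
Proof.
have K (h : 'cV[R]_d -> 'M[R]_(d, k)) v : h = (fun _ => 0) ->
    (fun y => derive h y v) = fun _ => 0.
  by move=> ->; apply/funext => y; exact: derive_cst.
have D1 i := K _ (pdir R i) erefl.
have D2 i j := K _ (pdir R j) (D1 i).
split; first by move=> y; exact: differentiable_cst.
split; first by move=> i y; rewrite (D1 i); exact: differentiable_cst.
split; first by move=> i j; rewrite (D2 i j); move=> y; exact: cst_continuous.
exists 0 => y i j; split.
- by rewrite normr0.
- by rewrite (congr1 (fun h => h y) (D1 i)) normr0.
- by rewrite (congr1 (fun h => h y) (D2 i j)) normr0.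
Qed.

Lemma Cz2_0 (k : nat) : Cz2 zeta (fun (_ : R) (_ : 'cV[R]_d) => 0 : 'M[R]_(d, k)).
Proof.
split; first by move=> t _; exact: isBC2_0.
by exists 0 => s t _ _ _ y i j; rewrite !subrr normr0 mul0r.
Qed.

(** The integrand [0 - 0] is the form that the difference [gn n t y - gb y] takes for zero drifts.
    The value [K = 0] is admissible, and admissible values are nonnegative. *)
Lemma negnorm0 (k : nat) :
  negnorm kappa gamma (fun (_ : R) (_ : 'cV[R]_d) => 0 - 0 : 'M[R]_(d, k)) = 0%E.
Proof.
have F0 t y : fhat (fun (_ : R) (_ : 'cV[R]_d) => 0 - 0 : 'M[R]_(d, k)) t y = 0.
  apply/matrixP => i j; rewrite mxE [RHS]mxE.
  rewrite [X in Rintegral _ _ X](_ : _ = fun _ => 0).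
    by rewrite Rintegral_cst ?mul0r.
  by apply/funext => r; rewrite subrr mxE.
apply/le_anti/andP; split.
  apply: ereal_inf_lbound; exists 0 => //; split => // s t y y' _ _ _.
  by rewrite !F0 !subr0 addr0 normr0 !mul0r.
by apply: le_ereal_inf_tmp => _ [K [K0 _] <-]; rewrite lee_fin.
Qed.

End NoDrift.

Theorem theorem3p13 (R : realType) (d m : nat) (d0 : measure_display)
  (Omega : measurableType d0) (P : probability Omega R) (H : R)
  (B : R -> Omega -> 'cV[R]_m) (alpha kappa gamma zeta : R) (x0 : 'cV[R]_d) :
  1 / 2 < H -> H < 1 -> is_fBm P H B ->
  0 < alpha -> 0 < kappa -> 0 < gamma ->
  1 / 2 < alpha -> 1 / 2 < H - kappa -> 1 < H - kappa + gamma * alpha ->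
  alpha < H - kappa -> alpha < zeta -> zeta <= 1 ->
  (forall (fn : nat -> R -> 'cV[R]_d -> 'M[R]_(d, m))
          (fb : 'cV[R]_d -> 'M[R]_(d, m))
          (xn : nat -> Omega -> R -> 'cV[R]_d) (x : Omega -> R -> 'cV[R]_d),
     (forall n, Cz2 zeta (fn n)) -> isBC2 fb ->
     (fun n => negnorm kappa gamma (fun t y => fn n t y - fb y)) @ \oo --> 0%E ->
     {ae P, forall w, (forall n, young_sol alpha (fn n) (fun t => B t w) x0 (xn n w))
                      /\ young_sol alpha (fun _ => fb) (fun t => B t w) x0 (x w)} ->
     conv_prob_Calpha P alpha xn x) /\
  (forall (fn : nat -> R -> 'cV[R]_d -> 'M[R]_(d, m))
          (fb : 'cV[R]_d -> 'M[R]_(d, m))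
          (gn : nat -> R -> 'cV[R]_d -> 'cV[R]_d) (gb : 'cV[R]_d -> 'cV[R]_d)
          (xn : nat -> Omega -> R -> 'cV[R]_d) (x : Omega -> R -> 'cV[R]_d),
     (forall n, Cz2 zeta (fn n)) -> isBC2 fb ->
     (fun n => negnorm kappa gamma (fun t y => fn n t y - fb y)) @ \oo --> 0%E ->
     (forall n, Cz2 zeta (gn n)) -> isBC2 gb ->
     (fun n => negnorm kappa gamma (fun t y => gn n t y - gb y)) @ \oo --> 0%E ->
     {ae P, forall w,
        (forall n, young_sol_drift alpha (fn n) (gn n) (fun t => B t w) x0 (xn n w))
        /\ young_sol_drift alpha (fun _ => fb) (fun _ => gb) (fun t => B t w) x0 (x w)} ->
     conv_prob_Calpha P alpha xn x).
Proof.
move=> H1 H2 fB _ kap0 gam0 al2 Hk Hkg alH alz z1; split; last first.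
  move=> fn fb gn gb xn x Cf bf cf Cg bg cg ae.
  exact: (drift_conv_prob H1 H2 fB kap0 gam0 al2 Hk Hkg alH alz z1 Cf bf cf Cg bg cg ae).
move=> fn fb xn x Cf bf cf ae.
have cg : (fun n : nat => negnorm kappa gamma
    (fun (_ : R) (_ : 'cV[R]_d) => 0 - 0 : 'M[R]_(d, 1))) @ \oo --> 0%E.
  by rewrite negnorm0; exact: cvg_cst.
apply: (drift_conv_prob (x0 := x0) H1 H2 fB kap0 gam0 al2 Hk Hkg alH alz z1 Cf bf cf
  (gn := fun _ _ _ => 0) (gb := fun _ => 0) (fun _ => Cz2_0 d zeta 1) (isBC2_0 R d 1) cg).
apply: filterS ae => w [h1 h2]; split => [n|]; apply: nodrift_sol => //.
Qed.
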